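(* Let $\lambda\in\mathbb R$ be a constant, and for $t\ge0$ let $\Omega(t)$ be antisymmetric, $\Gamma(t)$ symmetric with $\operatorname{tr}\Gamma(t)=0$, both continuous and bounded, and let $D_r(t)$ be a symmetric positive definite $3\times3$ matrix, continuously differentiable in $t$, such that $D_r(t)$, $dD_r/dt$ and $D_r(t)^{-1}$ are bounded on $[0,\infty)$ (i.e. the eigenvalues of $D_r(t)$ are bounded above and bounded below by a positive constant). Let $B_0$ be symmetric positive definite with $\det B_0=1$ and $A_0=A(B_0)$. Consider the Fast Exact Closure system with anisotropic diffusion $$\frac{dA}{dt}=\tfrac12\,\mathbb C(B):\big[B\cdot(\Omega+\lambda\Gamma)+(-\Omega+\lambda\Gamma)\cdot B\big]+2D_r+3(\operatorname{tr}D_r)A-5\,\mathbb C(B):(B\cdot D_r+D_r\cdot B),$$ $$\frac{dB}{dt}=-\tfrac12\big(B\cdot(\Omega+\lambda\Gamma)+(-\Omega+\lambda\Gamma)\cdot B\big)-\mathbb D(B):\big(2D_r+3(\operatorname{tr}D_r)A\big)+5(B\cdot D_r+D_r\cdot B),$$ with $A(0)=A_0$, $B(0)=B_0$. Then this system has a solution for all $t\ge0$ which stays physical: for every $t\ge0$, $B(t)$ is symmetric positive definite and finite (no eigenvalue becomes $0$ or infinite in finite time), $\det B(t)=1$, and $A(t)=A(B(t))$ is positive definite with trace $1$.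
   Context: All matrices are real $3\times3$. For a symmetric positive definite matrix $B$ define $$A(B)=\tfrac12\int_0^\infty \frac{(B+sI)^{-1}\,ds}{\sqrt{\det(B+sI)}},\qquad \mathbb C(B)=\tfrac34\int_0^\infty\frac{\mathcal S\big((B+sI)^{-1}\otimes(B+sI)^{-1}\big)\,ds}{\sqrt{\det(B+sI)}},$$ where for a rank-4 tensor $\mathbb T$, $\mathcal S(\mathbb T)_{ijkl}$ is the average of $\mathbb T_{mnpq}$ over all permutations $(m,n,p,q)$ of $(i,j,k,l)$. For a rank-4 tensor $\mathbb T$ and a matrix $M$, $(\mathbb T:M)_{ij}=\sum_{k,l}\mathbb T_{ijkl}M_{kl}$. The linear map $M\mapsto \mathbb C(B):M$ on symmetric matrices is invertible; $\mathbb D(B)$ denotes the rank-4 tensor with $\mathbb D_{ijkl}=\mathbb D_{jikl}=\mathbb D_{ijlk}$ representing its inverse, i.e. $\mathbb C(B):\mathbb D(B):M=\mathbb D(B):\mathbb C(B):M=M$ for every symmetric $M$. Here $t$ is time along a material (Lagrangian) trajectory. *)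

(* Defs.v *)
From HB Require Import structures.
From mathcomp Require Import all_boot all_order all_algebra all_fingroup.
From mathcomp Require Import all_classical all_reals all_analysis.
Set Implicit Arguments. Unset Strict Implicit. Unset Printing Implicit Defensive.
Import Order.TTheory GRing.Theory Num.Theory.
Import numFieldNormedType.Exports.
Local Open Scope classical_set_scope.
Local Open Scope ring_scope.

Section Defs.
Variable R : realType.

Definition tensor4 := 'I_3 -> 'I_3 -> 'I_3 -> 'I_3 -> R.

Definition sym4 (T : tensor4) : tensor4 := fun i j k l =>
  let idx : 'I_4 -> 'I_3 := fun m =>
    match val m with 0%N => i | 1%N => j | 2%N => k | _ => l end in
  (24%:R)^-1 * \sum_(s : 'S_4)
      T (idx (s ord0)) (idx (s (inord 1))) (idx (s (inord 2))) (idx (s (inord 3))).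

Definition tprod (M N : 'M[R]_3) : tensor4 := fun i j k l => M i j * N k l.

Definition tcontr (T : tensor4) (M : 'M[R]_3) : 'M[R]_3 :=
  \matrix_(i, j) \sum_(k < 3) \sum_(l < 3) T i j k l * M k l.

Definition sym_mx (M : 'M[R]_3) : Prop := M^T = M.

Definition posdef (M : 'M[R]_3) : Prop :=
  sym_mx M /\ forall v : 'cV[R]_3, v != 0 -> 0 < (v^T *m M *m v) ord0 ord0.

Definition Aof (B : 'M[R]_3) : 'M[R]_3 :=
  \matrix_(i, j) (2^-1 * Rintegral (@lebesgue_measure R) `[0%R, +oo[%classic
     (fun s : R => invmx (B + s%:M) i j / Num.sqrt (\det (B + s%:M)))).

Definition Cof (B : 'M[R]_3) : tensor4 := fun i j k l =>
  3 / 4 * Rintegral (@lebesgue_measure R) `[0%R, +oo[%classic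
     (fun s : R => sym4 (tprod (invmx (B + s%:M)) (invmx (B + s%:M))) i j k l
                    / Num.sqrt (\det (B + s%:M))).

Definition is_Dof (B : 'M[R]_3) (D : tensor4) : Prop :=
  (forall i j k l, D i j k l = D j i k l) /\
  (forall i j k l, D i j k l = D i j l k) /\
  (forall M : 'M[R]_3, sym_mx M ->
     tcontr (Cof B) (tcontr D M) = M /\ tcontr D (tcontr (Cof B) M) = M).

End Defs.

(* Main.v *)
Require Import Defs.
From HB Require Import structures.
From mathcomp Require Import all_boot all_order all_algebra all_fingroup.
From mathcomp Require Import all_classical all_reals all_analysis.
From mathcomp Require Import measurable_realfun ring lra.
Import Order.TTheory GRing.Theory Num.Theory.
Import numFieldNormedType.Exports.
Local Open Scope classical_set_scope.
Local Open Scope ring_scope.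

Set Implicit Arguments. Unset Strict Implicit. Unset Printing Implicit Defensive.

(** Write [M = (B + s I)^-1]. Differentiating under the integral sign gives
    [dA(B) = - C(B)], and [C(B) : B = 3/2 A(B)], so [D(B) : A(B) = 2/3 B] and the
    B-equation closes on itself; along it [d/dt A(B) = - C(B) : dB/dt] is the
    A-equation.

    Since [tr A(B) = det B^(-1/2)] and [tr (C(B) : H)] is proportional to
    [tr (B^-1 H)], the function [z = tr A(B)] satisfies
    [z' = - 2 tr(D_r) (z - 1)], so [det B = 1] is preserved. The Lyapunov function
    is [y = tr (A(B) B)]: because [C(B)] is symmetric and [C(B) : B = 3/2 A],
    [y' = - 1/2 tr (A B')], where the [D(B) : D_r] term contributes
    [2/3 tr (B D_r) >= 0] and all the other ones are at least [- const * y]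
    because [A B] is positive semidefinite. Hence [y] decays at most
    exponentially. On [det B = 1] one has [y = O((tr B)^(-1/4))], so [tr B]
    stays bounded on bounded time intervals, and then so does [B^-1].

    For existence, the field is multiplied by a cutoff whose support shrinks in
    time inside the positive definite cone; the cut-off equation is solved
    globally by Picard iteration, the two identities above still hold for it,
    and they show that its solution never meets the region where the cutoff
    differs from 1. *)

(** * Derivative comparison *)

Section MatrixNorm.
Variables (R : realType) (m n : nat).
Implicit Types (M N : 'M[R]_(m, n)).

Lemma mx_entry_le M i j : `|M i j| <= `|M|.
Proof.
rewrite [leRHS]/Num.Def.normr/= mx_normrE.
exact: (le_bigmax _ (fun ij => `|M ij.1 ij.2|) (i, j)).
Qed.

Lemma mx_norm_le M a : 0 <= a -> (forall i j, `|M i j| <= a) -> `|M| <= a.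
Proof.
move=> a0 h; rewrite [leLHS]/Num.Def.normr/= mx_normrE.
by apply: bigmax_le => // -[i j] _; exact: h.
Qed.

Lemma continuous_at_mxP (T : topologicalType) (X : T -> 'M[R]_(m, n)) t :
  {for t, continuous X} <-> forall i j, {for t, continuous (fun s => X s i j)}.
Proof.
split=> [h i j|h].
- apply/cvgrPdist_le => e e0; move/cvgrPdist_le : h => /(_ _ e0).
  apply: filterS => s; apply: le_trans.
  by have := mx_entry_le (X t - X s) i j; rewrite !mxE.
- apply/cvgrPdist_le => e e0.
  have : \forall s \near t, forall ij : 'I_m * 'I_n, `|X t ij.1 ij.2 - X s ij.1 ij.2| <= e.
    apply: filter_forall => -[i j] /=.
    by move/cvgrPdist_le : (h i j); exact.
  apply: filterS => s hs; apply: mx_norm_le; first exact: ltW.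
  by move=> i j; have := hs (i, j); rewrite !mxE.
Qed.

Lemma is_derive_mxP (V : normedModType R) (X : V -> 'M[R]_(m, n)) t v dX :
  is_derive t v X dX <-> forall i j, is_derive t v (fun s => X s i j) (dX i j).
Proof.
split=> [[dv dE] i j|h].
- have hd := (derivable_mxP X t v).1 dv.
  apply: DeriveDef; first exact: hd.
  by rewrite -dE derive_mx// mxE.
- have dv : derivable X t v by apply/derivable_mxP => i j; case: (h i j).
  apply: DeriveDef => //; rewrite derive_mx//.
  by apply/matrixP => i j; rewrite mxE; case: (h i j).
Qed.

End MatrixNorm.

Section Comparison.
Variable R : realType.

Lemma is_derive_continuous (f : R -> R) (t df : R) :
  is_derive t (1 : R) f df -> {for t, continuous f}.
Proof. by case=> df1 _; exact/differentiable_continuous/derivable1_diffP. Qed.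

Lemma nondecreasing_of_derive (f df : R -> R) (a b : R) : a <= b ->
  (forall t, a <= t <= b -> {for t, continuous f}) ->
  (forall t, a < t < b -> is_derive t 1 f (df t)) ->
  (forall t, a < t < b -> 0 <= df t) -> f a <= f b.
Proof.
move=> ab cf dfE df0.
move: ab; rewrite le_eqVlt => /orP[/eqP-> //|ab].
have dfE' x : x \in `]a, b[%R -> is_derive x 1 f (df x) by rewrite in_itv; exact: dfE.
have cf' : {within `[a, b], continuous f}.
  by apply: continuous_in_subspaceT => y; rewrite inE/= in_itv/= => /cf.
have [c] := MVT ab dfE' cf'.
rewrite in_itv/= => cab fE.
by rewrite -subr_ge0 fE mulr_ge0 ?df0// subr_ge0 ltW.
Qed.

Lemma le_dist_of_derive (f g df dg : R -> R) (a b : R) : a <= b ->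
  (forall t, a <= t <= b -> {for t, continuous f}) ->
  (forall t, a <= t <= b -> {for t, continuous g}) ->
  (forall t, a < t < b -> is_derive t 1 f (df t)) ->
  (forall t, a < t < b -> is_derive t 1 g (dg t)) ->
  (forall t, a < t < b -> `|df t| <= dg t) -> `|f b - f a| <= g b - g a.
Proof.
move=> ab cf cg df' dg' h.
have h1 := @nondecreasing_of_derive (g \- f) (dg \- df) a b ab.
have h2 := @nondecreasing_of_derive (g \+ f) (dg \+ df) a b ab.
rewrite ler_norml; apply/andP; split.
- have : g a + f a <= g b + f b.
    apply: h2 => t ht; first by apply: continuousD; [exact: cg|exact: cf].
      by apply: is_deriveD; [exact: dg'|exact: df'].
    by have := h _ ht; rewrite /= ler_norml => /andP[]; lra.
  lra.
- have : g a - f a <= g b - f b.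
    apply: h1 => t ht; first by apply: continuousB; [exact: cg|exact: cf].
      by apply: is_deriveB; [exact: dg'|exact: df'].
    by have := h _ ht; rewrite /= ler_norml => /andP[]; lra.
  lra.
Qed.

Lemma le_dist_of_derive_mx m n (f df : R -> 'M[R]_(m, n)) (g dg : R -> R) (a b : R) :
  a <= b ->
  (forall t, a <= t <= b -> {for t, continuous f}) ->
  (forall t, a <= t <= b -> {for t, continuous g}) ->
  (forall t, a < t < b -> is_derive t 1 f (df t)) ->
  (forall t, a < t < b -> is_derive t 1 g (dg t)) ->
  (forall t, a < t < b -> `|df t| <= dg t) -> `|f b - f a| <= g b - g a.
Proof.
move=> ab cf cg df' dg' h; apply: mx_norm_le.
  rewrite subr_ge0; apply: (@nondecreasing_of_derive _ dg) => //.
  by move=> t /h; apply: le_trans.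
move=> i j; rewrite !mxE.
apply: (@le_dist_of_derive (fun t => f t i j) g (fun t => df t i j) dg) => //.
- by move=> t ht; have := (continuous_at_mxP f t).1 (cf _ ht) i j.
- by move=> t ht; have := (is_derive_mxP f t 1 (df t)).1 (df' _ ht) i j.
- by move=> t /h; apply: le_trans; exact: mx_entry_le.
Qed.

Lemma continuous_max0 : continuous (fun t : R => Num.max t 0).
Proof.
move=> x; apply/cvgrPdist_le => e e0; near=> y.
apply: (@le_trans _ _ `|x - y|).
  have hm (z : R) : Num.max z 0 = (z + `|z|) / 2.
    case: (ltP z 0) => z0; [rewrite ltr0_norm|rewrite ger0_norm]; lra.
  rewrite !hm; have := ler_dist_dist x y; rewrite !ler_norml.
  have [h|h] := lerP 0 (x - y); [rewrite (ger0_norm h)|rewrite (ltr0_norm h)]; lra.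
near: y; move/cvgrPdist_le: (@cvg_id _ (nbhs x)); exact.
Unshelve. all: by end_near. Qed.

Lemma exists_primitive (f : R -> R) : continuous f ->
  exists F : R -> R, [/\ continuous F, forall t : R, t <= 0 -> F t = 0
    & forall t : R, 0 < t -> is_derive t (1 : R) F (f t)].
Proof.
move=> cf.
pose G t := (\int[lebesgue_measure]_(s in `[(-1), t]) f s)%R.
have dG (t : R) : -1 < t -> is_derive t (1 : R) G (f t).
  move=> t0; have t1 : t < t + 1 by rewrite ltrDl.
  have If : lebesgue_measure.-integrable `[(-1), t + 1] (EFin \o f).
    apply: continuous_compact_integrable; first exact: segment_compact.
    exact: continuous_subspaceT.
  have [d1 d2] := continuous_FTC1_closed t1 If t0 (cf t).
  by apply: (DeriveDef d1); rewrite -derive1E.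
exists (fun t => G (Num.max t 0) - G 0); split.
- move=> t; apply: cvgB; last exact: cvg_cst.
  apply: (@continuous_comp _ _ _ (fun t : R => Num.max t 0) G); first exact: continuous_max0.
  apply: (is_derive_continuous (df := f (Num.max t 0))); apply: dG.
  by apply: (@lt_le_trans _ _ 0); rewrite ?le_max ?lexx ?orbT// ltrN10.
- by move=> t t0; rewrite max_r// subrr.
- move=> t t0; apply: (@near_eq_is_derive _ _ _ (fun s => G s - G 0)).
    near=> s; rewrite max_l//; apply/ltW; near: s; exact: lt_nbhsr.
  rewrite -[f t]subr0; apply: is_deriveB; apply: dG.
  by apply: lt_trans t0; rewrite ltrN10.
Unshelve. all: by end_near. Qed.

Lemma exists_primitive_mx m n (f : R -> 'M[R]_(m, n)) : continuous f ->
  exists F : R -> 'M[R]_(m, n), [/\ continuous F, forall t : R, t <= 0 -> F t = 0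
    & forall t : R, 0 < t -> is_derive t (1 : R) F (f t)].
Proof.
move=> cf.
have /choice [F hF] : forall ij : 'I_m * 'I_n, exists F : R -> R,
    [/\ continuous F, forall t : R, t <= 0 -> F t = 0
    & forall t : R, 0 < t -> is_derive t (1 : R) F (f t ij.1 ij.2)].
  move=> [i j]; apply: exists_primitive => t.
  by have := (continuous_at_mxP f t).1 (cf t) i j.
exists (fun t => \matrix_(i, j) F (i, j) t); split.
- move=> t; apply/continuous_at_mxP => i j.
  have -> : (fun s => (\matrix_(i, j) F (i, j) s) i j) = F (i, j).
    by apply/funext => s; rewrite mxE.
  by have [h _ _] := hF (i, j); exact: h.
- move=> t t0; apply/matrixP => i j; rewrite !mxE.
  by have [_ h _] := hF (i, j); exact: h.
- move=> t t0; apply/is_derive_mxP => i j.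
  have -> : (fun s => (\matrix_(i, j) F (i, j) s) i j) = F (i, j).
    by apply/funext => s; rewrite mxE.
  by have [_ _ h] := hF (i, j); exact: h.
Qed.

End Comparison.

(** * Picard iteration *)

Section Picard.
Variables (R : realType) (m n : nat).
Implicit Types (G : R -> 'M[R]_(m, n) -> 'M[R]_(m, n)) (x : R -> 'M[R]_(m, n)).

Lemma continuous_along G x :
  (forall T : R, exists L : R, forall t X Y, t <= T -> `|G t X - G t Y| <= L * `|X - Y|) ->
  (forall X, continuous (G ^~ X)) -> continuous x -> continuous (fun t => G t (x t)).
Proof.
move=> hL hC cx t; apply/cvgrPdist_le => e e0.
have [L hLt] := hL (t + 1).
have L1 : 0 < `|L| + 1 by rewrite ltr_pwDr.
near=> s.
rewrite (_ : _ - _ = (G t (x t) - G s (x t)) + (G s (x t) - G s (x s))); last first.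
  by rewrite addrA subrK.
rewrite (le_trans (ler_normD _ _))// (splitr e) lerD//.
  near: s; have /cvgrPdist_le := hC (x t) t; apply; exact: divr_gt0.
apply: (le_trans (hLt _ _ _ _)).
  by near: s; apply: lt_le_nbhsl; rewrite ltrDl.
apply: (@le_trans _ _ ((`|L| + 1) * `|x t - x s|)).
  by apply: ler_wpM2r => //; have := ler_norm L; lra.
rewrite mulrC -ler_pdivlMr//; near: s.
by have /cvgrPdist_le := cx t; apply; rewrite !divr_gt0.
Unshelve. all: by end_near. Qed.

Lemma geometric_limit (u : nat -> R) (K : R) :
  (forall k, `|u k.+1 - u k| <= K / 2 ^+ k) ->
  exists l, forall k, `|u k - l| <= 2 * K / 2 ^+ k.
Proof.
move=> h.
have p k : 2 ^+ k.+1 = 2 * 2 ^+ k :> R by rewrite exprS.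
have p0 k : 0 < 2 ^+ k :> R by rewrite exprn_gt0.
pose r k := (2 ^+ k)^-1 : R.
have rS k : r k.+1 = r k / 2 by rewrite /r p invfM mulrC.
have {}h k : `|u k.+1 - u k| <= K * r k by exact: h.
suff : exists l, forall k, `|u k - l| <= 2 * K * r k by [].
pose v k := u k - 2 * K * r k; pose w k := u k + 2 * K * r k.
have vS k : v k <= v k.+1.
  by rewrite /v rS; have := h k; rewrite ler_norml => /andP[]; lra.
have wS k : w k.+1 <= w k.
  by rewrite /w rS; have := h k; rewrite ler_norml => /andP[]; lra.
have vm i d : v i <= v (i + d)%N.
  by elim: d => [|d IH]; rewrite ?addn0// addnS; exact: le_trans (vS _).
have wm i d : w (i + d)%N <= w i.
  by elim: d => [|d IH]; rewrite ?addn0// addnS; exact: le_trans (wS _) _.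
have K0 : 0 <= K by have := h 0; rewrite /r expr0 invr1 mulr1; apply: le_trans.
have vw k : v k <= w k.
  by rewrite /v /w; have : 0 <= K * r k; [rewrite mulr_ge0// invr_ge0 ltW|lra].
have vwm i j : v i <= w j.
  by apply: (le_trans (vm i j)); apply: (le_trans (vw _)); rewrite addnC.
pose S := [set v i | i in [set: nat]].
have ubS j : ubound S (w j) by move=> _ [i _ <-].
have sS : has_sup S by split; [exists (v 0), 0%N|exists (w 0)].
exists (sup S) => k; rewrite ler_norml; apply/andP; split.
  by have : sup S <= w k; [apply: ge_sup => //; case: sS|rewrite /w; lra].
have : v k <= sup S by apply: ub_le_sup => //; [case: sS|exists k].
by rewrite /v; lra.
Qed.

Lemma exists_geometric_le (K e : R) : 0 < e -> exists k : nat, K / 2 ^+ k <= e.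
Proof.
move=> e0.
have [N hN] : exists N : nat, `|K| / e < N%:R.
  exists (Num.bound (`|K| / e)); apply: archi_boundP; rewrite divr_ge0//; exact: ltW.
have pN : N%:R <= 2 ^+ N :> R by rewrite -natrX ler_nat ltnW// ltn_expl.
have p0 : 0 < 2 ^+ N :> R by rewrite exprn_gt0.
exists N; rewrite ler_pdivrMr//; apply: le_trans (ler_norm _) _.
move: hN; rewrite ltr_pdivrMr// => /ltW/le_trans; apply.
by rewrite mulrC ler_wpM2l// ltW.
Qed.

Lemma le_of_geometric (a b K : R) : (forall k : nat, a <= b + K / 2 ^+ k) -> a <= b.
Proof.
move=> h; apply/ler_addgt0Pr => e e0.
have [k hk] := exists_geometric_le K e0.
by apply: le_trans (h k) _; rewrite lerD2l.
Qed.

Lemma is_derive_scaled_expR (K a t : R) :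
  is_derive t (1 : R) (fun s => K * expR (a * s)) (a * (K * expR (a * t))).
Proof. by apply: is_derive_eq; rewrite /GRing.scale/= mulr1; ring. Qed.

Theorem picard_lindelof G (x0 : 'M[R]_(m, n)) :
  (forall T : R, exists L : R, forall t X Y, t <= T -> `|G t X - G t Y| <= L * `|X - Y|) ->
  (forall X, continuous (G ^~ X)) ->
  exists x, [/\ continuous x, x 0 = x0 &
    forall t : R, 0 < t -> is_derive t (1 : R) x (G t (x t))].
Proof.
move=> hL hC.
have next x : exists y, continuous x -> [/\ continuous y, forall t : R, t <= 0 -> y t = x0
    & forall t : R, 0 < t -> is_derive t (1 : R) y (G t (x t))].
  have [cx|ncx] := pselect (continuous x); last by exists x.
  have [F [cF F0 dF]] := exists_primitive_mx (continuous_along hL hC cx).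
  exists (fun t => x0 + F t) => _; split.
  - by move=> t; apply: cvgD; [exact: cvg_cst|exact: cF].
  - by move=> t /F0 ->; rewrite addr0.
  - move=> t t0; rewrite -[G _ _]add0r; apply: is_deriveD; exact: dF.
have [P hP] := choice next.
pose X k := iter k P (fun=> x0).
have cX k : continuous (X k).
  elim: k => [|k IH]; first exact: cst_continuous.
  by have [] := hP _ IH.
have X0 k t : t <= 0 -> X k t = x0.
  by case: k => [//|k]; have [_ h _] := hP _ (cX k); exact: h.
have dX k (t : R) : 0 < t -> is_derive t (1 : R) (X k.+1) (G t (X k t)).
  by have [_ _ h] := hP _ (cX k); exact: h.
(* The weight [expR (2 L t)] turns each iteration into a contraction by 1/2. *)
have main (T : R) : exists K, forall t k, t <= T -> `|X k.+1 t - X k t| <= K / 2 ^+ k.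
  have [L0 hL0] := hL T.
  pose L := Num.max L0 1.
  have L1 : 1 <= L by rewrite le_max lexx orbT.
  have {}hL0 t Y Z : t <= T -> `|G t Y - G t Z| <= L * `|Y - Z|.
    move=> tT; apply: le_trans (hL0 _ _ _ tT) _.
    by rewrite ler_wpM2r// le_max lexx.
  have [C [C0 hC0]] : exists C, 0 <= C /\ forall t, 0 <= t <= T -> `|G t x0| <= C.
    have [T0|T0] := lerP 0 T; last first.
      exists 0; split => // t /andP[t0 tT].
      by have := le_lt_trans (le_trans t0 tT) T0; rewrite ltxx.
    have cG : {within `[0, T], continuous (fun t => `|G t x0|)}.
      apply: continuous_subspaceT => t; apply: cvg_norm; exact: hC.
    have [c _ hc] := EVT_max T0 cG.
    by exists `|G c x0|; split => // t ht; apply: hc; rewrite in_itv.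
  pose g (K t : R) := K * expR (2 * L * t).
  have dg K (t : R) : is_derive t (1 : R) (g K) (2 * L * g K t)
    by exact: is_derive_scaled_expR.
  have key k t : 0 <= t <= T -> `|X k.+1 t - X k t| <= g (C / 2 ^+ k) t.
    have cg K s : {for s, continuous (g K)} by exact: is_derive_continuous.
    have g0 K s : 0 <= K -> 0 <= g K s by move=> K0; rewrite /g mulr_ge0// expR_ge0.
    elim: k t => [|k IH] t /andP[t0 tT].
      have := @le_dist_of_derive_mx R m n (X 1%N) (fun s => G s x0)
         (g C) (fun s => 2 * L * g C s) 0 t t0.
      rewrite (X0 1%N 0)// expr0 divr1 => h.
      apply: le_trans (h _ (fun s _ => cg _ s) _ (fun s _ => dg _ s) _) _.
      - by move=> s _; exact: cX.
      - by move=> s /andP[s0 _]; exact: (dX 0%N).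
      - move=> s /andP[s0 st]; apply: (@le_trans _ _ C).
          by apply: hC0; rewrite ltW//= (le_trans (ltW st)).
        have : 1 <= expR (2 * L * s) by rewrite -expR0 ler_expR !mulr_ge0//; lra.
        move=> e1; have : C <= g C s by rewrite /g ler_peMr.
        by move=> /le_trans; apply; rewrite ler_peMl ?g0//; lra.
      - by rewrite lerBlDr lerDl g0.
    have C1 : 0 <= C / 2 ^+ k.+1 by rewrite divr_ge0 ?exprn_ge0.
    have := @le_dist_of_derive_mx R m n (fun s => X k.+2 s - X k.+1 s)
      (fun s => G s (X k.+1 s) - G s (X k s))
      (g (C / 2 ^+ k.+1)) (fun s => 2 * L * g (C / 2 ^+ k.+1) s) 0 t t0.
    rewrite !(X0 _ 0)// subrr subr0 => h;
    apply: le_trans (h _ (fun s _ => cg _ s) _ (fun s _ => dg _ s) _) _.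
    - by move=> s _; apply: cvgB; exact: cX.
    - by move=> s /andP[s0 _]; apply: is_deriveB; exact: dX.
    - move=> s /andP[s0 st]; have sT : s <= T by exact: le_trans (ltW st) tT.
      apply: le_trans (hL0 _ _ _ sT) _; rewrite -mulrA [leRHS]mulrCA ler_wpM2l//; first lra.
      apply: le_trans (IH s _) _; first by rewrite (ltW s0).
      by rewrite /g exprS invfM; lra.
    - by rewrite lerBlDr lerDl g0.
  exists (C * expR (2 * L * `|T|)) => t k tT.
  have [t0|t0] := lerP 0 t; last first.
    have tn := ltW t0; rewrite (X0 k.+1 t tn) (X0 k t tn) subrr normr0.
    apply: divr_ge0; last exact: exprn_ge0.
    by rewrite mulr_ge0// expR_ge0.
  apply: le_trans (key _ _ _) _; first exact/andP.
  rewrite /g mulrAC ler_wpM2r// ?invr_ge0 ?exprn_ge0//.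
  rewrite ler_wpM2l// ler_expR ler_wpM2l//; first lra.
  by rewrite (le_trans tT) ?ler_norm.
have lim t : exists l : 'M[R]_(m, n), exists K : R, forall k, `|X k t - l| <= K / 2 ^+ k.
  have [K hK] := main t.
  have /choice [l hl] : forall ij : 'I_m * 'I_n, exists l, forall k,
      `|X k t ij.1 ij.2 - l| <= 2 * K / 2 ^+ k.
    move=> [i j]; apply: geometric_limit => k.
    apply: le_trans (hK t k (lexx _)); have := mx_entry_le (X k.+1 t - X k t) i j.
    by rewrite !mxE.
  exists (\matrix_(i, j) l (i, j)), (2 * K) => k; apply: mx_norm_le.
    apply: le_trans (mulr_ge0 (ler0n _ 2) (le_trans (normr_ge0 _) (hK t k (lexx _)))) _.
    by rewrite mulrA.
  by move=> i j; rewrite !mxE; exact: (hl (i, j)).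
have {lim} [x hx] := choice lim.
have ux (T : R) : exists K : R, forall t k, t <= T -> `|X k t - x t| <= K / 2 ^+ k.
  have [K hK] := main T; exists (2 * K) => t k tT.
  have [Kt hKt] := hx t.
  apply: (@le_of_geometric _ _ Kt) => p.
  have dist q : `|X k t - X (k + q)%N t| <= 2 * K / 2 ^+ k - 2 * K / 2 ^+ (k + q).
    elim: q => [|q IH]; first by rewrite addn0 !subrr normr0.
    rewrite addnS; apply: le_trans (ler_distD (X (k + q)%N t) _ _) _.
    have := hK t (k + q)%N tT; move=> h; rewrite distrC in h.
    apply: le_trans (lerD IH h) _; rewrite exprS invfM; lra.
  apply: le_trans (ler_distD (X (k + p)%N t) _ _) _.
  have Kt0 : 0 <= Kt by have := hKt 0%N; rewrite expr0 divr1; apply: le_trans.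
  have K0 : 0 <= K by have := hK t 0%N tT; rewrite expr0 divr1; apply: le_trans.
  apply: le_trans (lerD (dist p) (hKt _)) _.
  have e0 : 0 <= 2 * K / 2 ^+ (k + p) by rewrite divr_ge0 ?exprn_ge0 ?mulr_ge0.
  have : Kt / 2 ^+ (k + p) <= Kt / 2 ^+ p.
    rewrite ler_wpM2l// lef_pV2 ?posrE ?exprn_gt0//.
    by rewrite ler_eXn2l ?leq_addl// ltr1n.
  lra.
have x_0 t : t <= 0 -> x t = x0.
  move=> t0; apply/eqP; rewrite -subr_eq0 -normr_le0 distrC.
  have [K hK] := hx t; apply: (@le_of_geometric _ _ K) => k.
  by rewrite add0r -(X0 k t).
have cx : continuous x.
  move=> t; apply/cvgrPdist_le => e e0.
  have [K hK] := ux (t + 1); have e4 : 0 < e / 4 by rewrite divr_gt0.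
  have [k hk] := exists_geometric_le K e4.
  near=> s.
  have h1 : `|X k t - x t| <= e / 4 by apply: le_trans (hK _ _ _) hk; rewrite lerDl.
  have h2 : `|X k s - x s| <= e / 4.
    apply: le_trans (hK _ _ _) hk.
    by near: s; apply: lt_le_nbhsl; rewrite ltrDl.
  have h3 : `|X k t - X k s| <= e / 4.
    by near: s; have /cvgrPdist_le := cX k t; exact.
  apply: le_trans (ler_distD (X k t) _ _) _.
  have := ler_distD (X k s) (X k t) (x s); rewrite distrC in h1.
  lra.
have [Y] := next x; move=> /(_ cx) [cY Y0 dY].
have xY : x = Y.
  apply/funext => t; have [t0|t0] := lerP t 0; first by rewrite x_0// Y0.
  have [K hK] := ux t; have [L hLt] := hL t.
  apply/eqP; rewrite -subr_eq0 -normr_le0.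
  apply: (@le_of_geometric _ _ (K + `|L| * K * t)) => k.
  have := @le_dist_of_derive_mx R m n (fun s => X k.+1 s - Y s)
    (fun s => G s (X k s) - G s (x s))
    (fun s => `|L| * (K / 2 ^+ k) * s) (fun s => `|L| * (K / 2 ^+ k)) 0 t (ltW t0).
  rewrite (X0 k.+1 0)// (Y0 0)// subrr subr0 mulr0 subr0 => h.
  have {}h : `|X k.+1 t - Y t| <= `|L| * (K / 2 ^+ k) * t.
    apply: h => s.
    - by move=> _; apply: cvgB; [exact: cX|exact: cY].
    - by move=> _; apply: cvgM; [exact: cvg_cst|exact: cvg_id].
    - by move=> /andP[s0 _]; apply: is_deriveB; [exact: dX|exact: dY].
    - by move=> _; apply: is_derive_eq; rewrite /GRing.scale/= mulr1.
    - move=> /andP[s0 /ltW st]; apply: le_trans (hLt _ _ _ st) _.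
      apply: (@le_trans _ _ (`|L| * `|X k s - x s|)).
        by rewrite ler_wpM2r// ler_norm.
      by rewrite ler_wpM2l// hK.
  apply: le_trans (ler_distD (X k.+1 t) _ _) _; rewrite add0r distrC.
  apply: le_trans (lerD (hK _ _ (lexx _)) h) _.
  have : K / 2 ^+ k.+1 <= K / 2 ^+ k.
    have K0 : 0 <= K / 2 ^+ k.+1 by apply: le_trans (hK _ _ (lexx _)).
    by move: K0; rewrite exprS invfM; lra.
  lra.
exists x; split => //; first exact: x_0.
by move=> t t0; rewrite [X in is_derive _ _ X _]xY; exact: dY.
Unshelve. all: by end_near. Qed.

End Picard.

(** * Positive definite 3x3 matrices *)

Section ThreeByThree.
Variable R : realType.
Implicit Types (M N P B X H : 'M[R]_3) (v w : 'cV[R]_3).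

Definition i0 : 'I_3 := @Ordinal 3 0 isT.
Definition i1 : 'I_3 := @Ordinal 3 1 isT.
Definition i2 : 'I_3 := @Ordinal 3 2 isT.

Lemma sum3 (V : nmodType) (F : 'I_3 -> V) : \sum_(i < 3) F i = F i0 + F i1 + F i2.
Proof.
rewrite !big_ord_recl big_ord0 addr0 addrA.
by congr (_ + _ + _); congr (F _); exact: val_inj.
Qed.

Lemma ord3_ind (Q : 'I_3 -> Prop) : Q i0 -> Q i1 -> Q i2 -> forall i, Q i.
Proof.
move=> h0 h1 h2 [[|[|[|//]]] h].
- by rewrite (_ : Ordinal h = i0)//; exact: val_inj.
- by rewrite (_ : Ordinal h = i1)//; exact: val_inj.
- by rewrite (_ : Ordinal h = i2)//; exact: val_inj.
Qed.

Lemma det3 M : \det M =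
  M i0 i0 * (M i1 i1 * M i2 i2 - M i1 i2 * M i2 i1)
  - M i0 i1 * (M i1 i0 * M i2 i2 - M i1 i2 * M i2 i0)
  + M i0 i2 * (M i1 i0 * M i2 i1 - M i1 i1 * M i2 i0).
Proof.
rewrite (expand_det_row _ i0) sum3 /cofactor.
rewrite !(expand_det_row _ ord0) !big_ord_recl !big_ord0 /cofactor !det_mx11 !mxE /=.
have e (a : 'I_3) (b : 'I_2) : lift a b = 
   match val a, val b with 0%N, 0%N => i1 | 0%N, _ => i2 | 1%N, 0%N => i0 | 1%N, _ => i2
   | _, 0%N => i0 | _, _ => i1 end.
  by move: a b => [[|[|[|//]]] ha] [[|[|//]] hb]; apply: val_inj.
rewrite !e /= /bump /= !expr0 !expr1 !expr2 /=; ring.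
Qed.

Definition qf P v := (v^T *m P *m v) ord0 ord0.
Definition sq v := (v^T *m v) ord0 ord0.

Lemma sqE v : sq v = v i0 0 ^+ 2 + v i1 0 ^+ 2 + v i2 0 ^+ 2.
Proof. by rewrite /sq mxE sum3 !mxE. Qed.

Lemma qfE P v : qf P v =
  \sum_(i < 3) \sum_(j < 3) P i j * v i 0 * v j 0.
Proof.
rewrite /qf mxE exchange_big; apply: eq_bigr => j _ /=.
rewrite mxE big_distrl; apply: eq_bigr => i _ /=.
by rewrite mxE; ring.
Qed.

Lemma qfD P N v : qf (P + N) v = qf P v + qf N v.
Proof. by rewrite /qf mulmxDr mulmxDl mxE. Qed.

Lemma qfZ (a : R) P v : qf (a *: P) v = a * qf P v.
Proof. by rewrite /qf -scalemxAr -scalemxAl mxE. Qed.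

Lemma qf_scalar (a : R) v : qf a%:M v = a * sq v.
Proof. by rewrite /qf /sq mul_mx_scalar -scalemxAl mxE. Qed.

Lemma sq_ge0 v : 0 <= sq v.
Proof. by rewrite sqE !addr_ge0 ?sqr_ge0. Qed.

Lemma sq_eq0 v : sq v = 0 -> v = 0.
Proof.
rewrite sqE => /eqP; rewrite !paddr_eq0 ?addr_ge0 ?sqr_ge0// !sqrf_eq0.
move=> /andP[/andP[/eqP h0 /eqP h1] /eqP h2]; apply/matrixP => i j.
by rewrite mxE (ord1 j); elim/ord3_ind: i.
Qed.

Lemma sq_gt0 v : v != 0 -> 0 < sq v.
Proof. by move=> v0; rewrite lt_neqAle sq_ge0 andbT eq_sym; apply: contra v0 => /eqP/sq_eq0 ->. Qed.

Lemma entry_sq_le v i : v i 0 ^+ 2 <= sq v.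
Proof.
rewrite sqE; elim/ord3_ind: i; have := sqr_ge0 (v i0 0); have := sqr_ge0 (v i1 0);
  have := sqr_ge0 (v i2 0); lra.
Qed.

Lemma qf_le P v : qf P v <= 3 * `|P| * sq v.
Proof.
have h i j : P i j * v i 0 * v j 0 <= `|P| * ((v i 0 ^+ 2 + v j 0 ^+ 2) / 2).
  have := mx_entry_le P i j => hP.
  have h1 : `|v i 0 * v j 0| <= (v i 0 ^+ 2 + v j 0 ^+ 2) / 2.
    rewrite ler_norml; have := sqr_ge0 (v i 0 + v j 0); have := sqr_ge0 (v i 0 - v j 0).
    rewrite !expr2; lra.
  rewrite -mulrA; apply: le_trans (ler_norm _) _; rewrite normrM.
  exact: ler_pM.
rewrite qfE; apply: (@le_trans _ _ (\sum_(i < 3) \sum_(j < 3)  `|P| * ((v i 0 ^+ 2 + v j 0 ^+ 2) / 2))).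
  by apply: ler_sum => i _; apply: ler_sum => j _.
rewrite !sum3 sqE; lra.
Qed.

Definition geI (c : R) P := sym_mx P /\ forall v, c * sq v <= qf P v.

Lemma geI_le c d P : d <= c -> geI c P -> geI d P.
Proof.
move=> dc [sP hP]; split => // v; apply: le_trans (hP v).
by rewrite ler_wpM2r// sq_ge0.
Qed.

Lemma geI_scalar c s P : geI c P -> geI (c + s) (P + s%:M).
Proof.
move=> [sP hP]; split; first by rewrite /sym_mx linearD/= tr_scalar_mx sP.
by move=> v; rewrite qfD qf_scalar mulrDl lerD2r.
Qed.

Lemma geI_posdef c P : 0 < c -> geI c P -> posdef P.
Proof.
move=> c0 [sP hP]; split => // v v0; apply: lt_le_trans (hP v).
by rewrite mulr_gt0// sq_gt0.
Qed.

Lemma qf3 P v : sym_mx P -> qf P v = P i0 i0 * v i0 0 ^+ 2 + P i1 i1 * v i1 0 ^+ 2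
  + P i2 i2 * v i2 0 ^+ 2 + 2 * (P i0 i1 * v i0 0 * v i1 0 + P i0 i2 * v i0 0 * v i2 0
  + P i1 i2 * v i1 0 * v i2 0).
Proof.
move=> sP; rewrite qfE !sum3.
have -> : P i1 i0 = P i0 i1 by rewrite -[in LHS]sP mxE.
have -> : P i2 i0 = P i0 i2 by rewrite -[in LHS]sP mxE.
have -> : P i2 i1 = P i1 i2 by rewrite -[in LHS]sP mxE.
ring.
Qed.

Definition col3 (a b c : R) : 'cV[R]_3 :=
  \col_i (if i == i0 then a else if i == i1 then b else c).

Lemma col3_0 a b c : col3 a b c i0 0 = a. Proof. by rewrite mxE. Qed.
Lemma col3_1 a b c : col3 a b c i1 0 = b. Proof. by rewrite mxE. Qed.
Lemma col3_2 a b c : col3 a b c i2 0 = c. Proof. by rewrite mxE. Qed.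
Definition col3E := (col3_0, col3_1, col3_2).

Lemma sym_swap P : sym_mx P ->
  [/\ P i1 i0 = P i0 i1, P i2 i0 = P i0 i2 & P i2 i1 = P i1 i2].
Proof. by move=> sP; split; rewrite -[in LHS]sP mxE. Qed.

Lemma posdef_col3 P (a b c : R) : posdef P -> [|| a != 0, b != 0 | c != 0] ->
  0 < qf P (col3 a b c).
Proof.
move=> [_ hP] abc; apply: hP; apply: contraTneq abc => h.
have := col3_0 a b c; have := col3_1 a b c; have := col3_2 a b c; rewrite h !mxE.
by move=> <- <- <-; rewrite eqxx.
Qed.

Lemma posdef_diag P i : posdef P -> 0 < P i i.
Proof.
move=> pP; have [sP _] := pP.
have q a b c h : 0 < _ := @posdef_col3 P a b c pP h.
have n1 : (1 : R) != 0 by rewrite oner_eq0.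
elim/ord3_ind: i.
- by have := q 1 0 0; rewrite qf3// !col3E n1 => /(_ isT); lra.
- by have := q 0 1 0; rewrite qf3// !col3E n1 orbT => /(_ isT); lra.
- by have := q 0 0 1; rewrite qf3// !col3E n1 !orbT => /(_ isT); lra.
Qed.

Lemma posdef_minors P : posdef P ->
  [/\ 0 < P i0 i0, 0 < P i0 i0 * P i1 i1 - P i0 i1 ^+ 2 & 0 < \det P].
Proof.
move=> pP; have [sP hP] := pP; have [e10 e20 e21] := sym_swap sP.
have p0 := posdef_diag i0 pP.
have q a b c h : 0 < _ := @posdef_col3 P a b c pP h.
have p1 : 0 < P i0 i0 * P i1 i1 - P i0 i1 ^+ 2.
  have := q (- P i0 i1) (P i0 i0) 0; rewrite (gt_eqF p0) orbT => /(_ isT).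
  rewrite qf3// !col3E (_ : _ + _ = P i0 i0 * (P i0 i0 * P i1 i1 - P i0 i1 ^+ 2)); last ring.
  by rewrite pmulr_rgt0.
split => //.
have := q (P i0 i1 * P i1 i2 - P i0 i2 * P i1 i1) (P i0 i1 * P i0 i2 - P i0 i0 * P i1 i2)
   (P i0 i0 * P i1 i1 - P i0 i1 ^+ 2); rewrite (gt_eqF p1) !orbT => /(_ isT).
rewrite qf3// !col3E (_ : _ + _ = (P i0 i0 * P i1 i1 - P i0 i1 ^+ 2) * \det P).
  by rewrite pmulr_rgt0.
rewrite det3 e10 e20 e21; ring.
Qed.

Lemma posdef_det P : posdef P -> 0 < \det P.
Proof. by case/posdef_minors. Qed.

Lemma posdef_unit P : posdef P -> P \in unitmx.
Proof. by move=> /posdef_det h; rewrite unitmxE unitfE gt_eqF. Qed.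

Lemma sym_inv P : sym_mx P -> sym_mx (invmx P).
Proof. by move=> sP; rewrite /sym_mx trmx_inv sP. Qed.

Lemma geI_inv_entry c P i j : 0 < c -> geI c P -> `|invmx P i j| <= c^-1.
Proof.
move=> c0 gP; have [sP hP] := gP; have uP := posdef_unit (geI_posdef c0 gP).
pose w := col j (invmx P).
have we k : w k 0 = invmx P k j by rewrite /w mxE.
have qw : qf P w = w j 0.
  have -> : qf P w = (w^T *m (P *m w)) 0 0 by rewrite mulmxA.
  by rewrite [P *m w](_ : _ = delta_mx j 0) -?colE ?mxE// /w colE mulKVmx.
have := hP w; rewrite qw => h1.
have w0 : 0 <= w j 0 by apply: le_trans h1; rewrite mulr_ge0 ?sq_ge0// ltW.
have wj : w j 0 <= c^-1.
  have [->|wn0] := eqVneq (w j 0) 0; first by rewrite invr_ge0 ltW.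
  have wp : 0 < w j 0 by rewrite lt_neqAle eq_sym wn0.
  rewrite -[leRHS]mul1r ler_pdivlMr// mulrC -(ler_pM2r wp) mul1r -mulrA -expr2.
  by apply: le_trans h1; rewrite ler_pM2l// entry_sq_le.
rewrite -we -(@ler_pXn2r _ 2)// ?nnegrE ?invr_ge0 ?(ltW c0)//.
rewrite real_normK ?num_real// -(ler_pM2l c0) [leRHS](_ : _ = c^-1).
  apply: le_trans wj; apply: le_trans h1; rewrite ler_pM2l//; exact: entry_sq_le.
by field; rewrite gt_eqF.
Qed.

Lemma geI_inv_norm c P : 0 < c -> geI c P -> `|invmx P| <= c^-1.
Proof.
move=> c0 gP; apply: mx_norm_le; first by rewrite invr_ge0 ltW.
by move=> i j; exact: geI_inv_entry.
Qed.

Lemma qf_sub P v w (x : R) : sym_mx P ->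
  qf P (v - x *: w) = qf P v - 2 * x * (v^T *m P *m w) 0 0 + x ^+ 2 * qf P w.
Proof.
move=> sP.
have e : (w^T *m P *m v) 0 0 = (v^T *m P *m w) 0 0.
  have -> : w^T *m P *m v = (v^T *m P *m w)^T by rewrite !trmx_mul trmxK sP mulmxA.
  by rewrite mxE.
have eT : (v - x *: w)^T = v^T - x *: w^T by apply/matrixP => i j; rewrite !mxE.
rewrite /qf eT mulmxBr !mulmxBl -!scalemxAr -!scalemxAl.
set a := v^T *m P *m v; set b := v^T *m P *m w; set d := w^T *m P *m v.
set f := w^T *m P *m w; rewrite -/b -/d in e.
by clearbody a b d f; rewrite !mxE e; ring.
Qed.

Lemma posdef_geI P k : posdef P -> 0 < k -> `|invmx P| <= k -> geI (3 * k)^-1 P.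
Proof.
move=> pP k0 hk; have [sP hP] := pP; split => // v.
have uP := posdef_unit pP.
pose w := invmx P *m v.
have sN := sym_inv sP.
have wP : v^T *m P *m w = v^T *m v by rewrite /w -mulmxA mulKVmx.
have qw : qf P w = qf (invmx P) v.
  have -> : qf P w = (w^T *m (P *m w)) 0 0 by rewrite mulmxA.
  by rewrite /w mulKVmx// trmx_mul sN.
have qN : qf (invmx P) v <= 3 * k * sq v.
  by apply: le_trans (qf_le _ _) _; rewrite ler_wpM2r ?sq_ge0// ler_wpM2l.
have q0 : 0 <= qf P (v - (3 * k)^-1 *: w).
  have [->|n0] := eqVneq (v - (3 * k)^-1 *: w) 0; last exact/ltW/hP.
  by rewrite /qf mulmx0 mxE.
move: q0; rewrite qf_sub// wP -/(sq v) qw.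
have : (3 * k)^-1 ^+ 2 * qf (invmx P) v <= (3 * k)^-1 ^+ 2 * (3 * k * sq v).
  by rewrite ler_wpM2l// sqr_ge0.
rewrite [X in _ <= X](_ : _ = (3 * k)^-1 * sq v); last by field; rewrite gt_eqF.
lra.
Qed.

Lemma posdef_exists_geI P : posdef P -> exists2 c, 0 < c & geI c P.
Proof.
move=> pP; exists (3 * (`|invmx P| + 1))^-1.
  by rewrite invr_gt0 mulr_gt0// ltr_pwDr.
by apply: posdef_geI; rewrite ?ltr_pwDr ?lerDl.
Qed.

Lemma norm_mulmx M N : `|M *m N| <= 3 * `|M| * `|N|.
Proof.
apply: mx_norm_le => [|i j]; first by rewrite !mulr_ge0.
rewrite mxE; apply: le_trans (ler_norm_sum _ _ _) _.
have h k : `|M i k * N k j| <= `|M| * `|N| by rewrite normrM ler_pM ?mx_entry_le.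
by rewrite sum3; have := h i0; have := h i1; have := h i2; lra.
Qed.

Lemma norm_tr M : `|\tr M| <= 3 * `|M|.
Proof.
rewrite /mxtrace; apply: le_trans (ler_norm_sum _ _ _) _; rewrite sum3.
by have := mx_entry_le M i0 i0; have := mx_entry_le M i1 i1; have := mx_entry_le M i2 i2; lra.
Qed.

Lemma norm3M (a b c k : R) : `|a| <= k -> `|b| <= k -> `|c| <= k -> `|a * b * c| <= k ^+ 3.
Proof.
move=> ha hb hc; rewrite !normrM !exprS expr0 mulr1 mulrA.
by rewrite !ler_pM// mulr_ge0.
Qed.

Lemma norm_det M : `|\det M| <= 6 * `|M| ^+ 3.
Proof.
rewrite det3; have h a b c d e f := norm3M (mx_entry_le M a b) (mx_entry_le M c d) (mx_entry_le M e f).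
have h1 := h i0 i0 i1 i1 i2 i2; have h2 := h i0 i0 i1 i2 i2 i1.
have h3 := h i0 i1 i1 i0 i2 i2; have h4 := h i0 i1 i1 i2 i2 i0.
have h5 := h i0 i2 i1 i0 i2 i1; have h6 := h i0 i2 i1 i1 i2 i0.
move: h1 h2 h3 h4 h5 h6; rewrite !ler_norml; lra.
Qed.

Definition e2 M := M i0 i0 * M i1 i1 - M i0 i1 * M i1 i0 + (M i0 i0 * M i2 i2 - M i0 i2 * M i2 i0)
  + (M i1 i1 * M i2 i2 - M i1 i2 * M i2 i1).

Lemma mxtrace3 M : \tr M = M i0 i0 + M i1 i1 + M i2 i2.
Proof. by rewrite /mxtrace sum3. Qed.

Lemma norm_e2 M : `|e2 M| <= 6 * `|M| ^+ 2.
Proof.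
have h a b c d : `|M a b * M c d| <= `|M| ^+ 2 by rewrite normrM expr2 ler_pM ?mx_entry_le.
have h1 := h i0 i0 i1 i1; have h2 := h i0 i1 i1 i0; have h3 := h i0 i0 i2 i2.
have h4 := h i0 i2 i2 i0; have h5 := h i1 i1 i2 i2; have h6 := h i1 i2 i2 i1.
by move: h1 h2 h3 h4 h5 h6; rewrite /e2 !ler_norml; lra.
Qed.

Lemma det_add_scalar M (s : R) : \det (M + s%:M) = s ^+ 3 + \tr M * s ^+ 2 + e2 M * s + \det M.
Proof. by rewrite !det3 mxtrace3 /e2 !mxE /=; ring. Qed.

End ThreeByThree.

Section Cholesky.
Variable R : realType.
Implicit Types (M N P B X H U : 'M[R]_3).

Definition low3 (a b c d e f : R) : 'M[R]_3 := \matrix_(i, j)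
  match val i, val j with
  | 0%N, 0%N => a | 1%N, 0%N => b | 1%N, 1%N => c
  | 2%N, 0%N => d | 2%N, 1%N => e | 2%N, 2%N => f | _, _ => 0 end.

Lemma cholesky P : posdef P -> exists2 U : 'M[R]_3, U \in unitmx & P = U *m U^T.
Proof.
move=> pP; have [p0 p1 p2] := posdef_minors pP; have [sP _] := pP.
have [e10 e20 e21] := sym_swap sP.
move: p2; rewrite det3 e10 e20 e21 => p2.
set x := P i0 i0 in p0 p1 p2; set y := P i0 i1 in p1 p2; set z := P i0 i2 in p2.
set t := P i1 i1 in p1 p2; set u := P i1 i2 in p2; set w := P i2 i2 in p2.
pose m := x * t - y ^+ 2.
have E1 : 0 < t - y ^+ 2 / x by rewrite subr_gt0 ltr_pdivrMr// mulrC -subr_gt0.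
have E2 : 0 < w - z ^+ 2 / x - (u - z * y / x) ^+ 2 / (t - y ^+ 2 / x).
  rewrite -(pmulr_rgt0 _ p1).
  rewrite [X in 0 < X](_ : _ = x * (t * w - u * u) - y * (y * w - u * z) + z * (y * u - t * z))//.
  by field; rewrite (gt_eqF p0) (mulrC t) (gt_eqF p1).
pose a := Num.sqrt x; pose c := Num.sqrt (t - y ^+ 2 / x).
pose f := Num.sqrt (w - z ^+ 2 / x - (u - z * y / x) ^+ 2 / (t - y ^+ 2 / x)).
have a0 : 0 < a by rewrite sqrtr_gt0.
have c0 : 0 < c by rewrite sqrtr_gt0.
have f0 : 0 < f by rewrite sqrtr_gt0.
have a2 : a ^+ 2 = x by rewrite sqr_sqrtr// ltW.
have c2 : c ^+ 2 = t - y ^+ 2 / x by rewrite sqr_sqrtr// ltW.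
have f2 : f ^+ 2 = w - z ^+ 2 / x - (u - z * y / x) ^+ 2 / c ^+ 2.
  by rewrite sqr_sqrtr ?c2// ltW.
have an : a != 0 by rewrite gt_eqF.
have cn : c != 0 by rewrite gt_eqF.
exists (low3 a (y / a) c (z / a) ((u - z * y / x) / c) f).
  rewrite unitmxE unitfE det3 !mxE /= !(mulr0, mul0r, subr0, addr0).
  by rewrite !mulf_neq0// gt_eqF.
have st : t = c ^+ 2 + y ^+ 2 / x by rewrite c2 subrK.
have sw : w = f ^+ 2 + z ^+ 2 / x + (u - z * y / x) ^+ 2 / c ^+ 2 by rewrite f2; ring.
apply/matrixP => i j; rewrite mxE sum3.
elim/ord3_ind: i; elim/ord3_ind: j; rewrite !mxE /= ?e10 ?e20 ?e21 -/x -/y -/z -/t -/u -/w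
  ?st ?sw -?a2; field; rewrite ?an ?cn//.
Qed.

Lemma trace_mul_ge0 P N : posdef P -> posdef N -> 0 <= \tr (P *m N).
Proof.
move=> /cholesky[U uU ->] [_ hN].
rewrite -mulmxA mxtrace_mulC /mxtrace; apply: sumr_ge0 => j _.
have -> : (U^T *m N *m U) j j = qf N (col j U).
  rewrite qfE mxE exchange_big; apply: eq_bigr => k _ /=.
  rewrite mxE big_distrl; apply: eq_bigr => l _ /=; rewrite !mxE; ring.
have [->|n0] := eqVneq (col j U) 0; last exact/ltW/hN.
by rewrite /qf mulmx0 mxE.
Qed.

Lemma norm_trmx M : `|M^T| = `|M|.
Proof.
have h N : `|N^T| <= `|N| by apply: mx_norm_le => // i j; rewrite mxE mx_entry_le.
by apply/eqP; rewrite eq_le h -{1}[M]trmxK h.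
Qed.

Lemma sym_norm_sq_le_trace N : sym_mx N -> `|N| ^+ 2 <= \tr (N *m N).
Proof.
move=> sN.
have h i j : N i j ^+ 2 <= \tr (N *m N).
  rewrite -{2}sN mxtrace3 !mxE !sum3 !mxE.
  have s k l : 0 <= N k l * N k l by rewrite -expr2 sqr_ge0.
  rewrite expr2; elim/ord3_ind: i; elim/ord3_ind: j;
  have := s i0 i0; have := s i0 i1; have := s i0 i2; have := s i1 i0; have := s i1 i1;
  have := s i1 i2; have := s i2 i0; have := s i2 i1; have := s i2 i2; lra.
have t0 : 0 <= \tr (N *m N) by apply: le_trans (h i0 i0); exact: sqr_ge0.
have -> : \tr (N *m N) = Num.sqrt (\tr (N *m N)) ^+ 2 by rewrite sqr_sqrtr.
rewrite ler_pXn2r// ?nnegrE//.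
by apply: mx_norm_le => // i j; rewrite -sqrtr_sqr ler_wsqrtr.
Qed.

Lemma trace_sandwich_ge P H : posdef P -> sym_mx H ->
  `|H| ^+ 2 <= 81 * `|P| ^+ 2 * \tr (invmx P *m H *m invmx P *m H).
Proof.
move=> pP sH; have uP := posdef_unit pP; have [U uU PE] := cholesky pP.
have uT : U^T \in unitmx by rewrite unitmx_tr.
pose Y := invmx U *m H *m invmx U^T.
have iP : invmx P = invmx U^T *m invmx U.
  apply: (can_inj (mulKmx uP)); rewrite mulmxV// {1}PE -mulmxA (mulmxA U^T) mulmxV// mul1mx mulmxV//.
have sY : Y^T = Y by rewrite /Y !trmx_mul !trmx_inv trmxK sH mulmxA.
have tE : \tr (invmx P *m H *m invmx P *m H) = \tr (Y *m Y).
  rewrite iP /Y -!mulmxA mxtrace_mulC; congr (\tr _); rewrite -!mulmxA.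
  by [].
have HE : H = U *m Y *m U^T by rewrite /Y !mulmxA mulmxV// mul1mx -mulmxA mulVmx// mulmx1.
have U2 : `|U| ^+ 2 <= `|P|.
  have h i j : U i j ^+ 2 <= `|P|.
    apply: (@le_trans _ _ (P i i)); last by apply: le_trans (mx_entry_le _ _ _); exact: ler_norm.
    rewrite PE mxE sum3 !mxE; have := sqr_ge0 (U i i0); have := sqr_ge0 (U i i1).
    by have := sqr_ge0 (U i i2); elim/ord3_ind: j; rewrite !expr2; lra.
  have -> : `|P| = Num.sqrt `|P| ^+ 2 by rewrite sqr_sqrtr.
  rewrite ler_pXn2r// ?nnegrE//.
  by apply: mx_norm_le => // i j; rewrite -sqrtr_sqr ler_wsqrtr.
have Y2 : `|Y| ^+ 2 <= \tr (Y *m Y) by exact: sym_norm_sq_le_trace.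
have hH : `|H| <= 9 * `|P| * `|Y|.
  rewrite {1}HE; apply: le_trans (norm_mulmx _ _) _.
  have -> : `|U^T| = `|U|.
    exact: norm_trmx.
  have := norm_mulmx U Y => h1.
  apply: (@le_trans _ _ (3 * (3 * `|U| * `|Y|) * `|U|)).
    by rewrite ler_wpM2r// ler_wpM2l.
  rewrite (_ : _ * _ = 9 * `|Y| * `|U| ^+ 2); last ring.
  by rewrite [leRHS]mulrAC ler_wpM2l// mulr_ge0.
rewrite tE; apply: (@le_trans _ _ ((9 * `|P| * `|Y|) ^+ 2)).
  by rewrite ler_pXn2r// nnegrE ?mulr_ge0.
rewrite !exprMn (_ : 9 ^+ 2 = 81); last by ring.
by rewrite ler_wpM2l// mulr_ge0// sqr_ge0.
Qed.

End Cholesky.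

(** * Resolvent estimates *)

Section Resolvent.
Variable R : realType.
Implicit Types (M N P B X H U : 'M[R]_3).

Definition rdet P : R := (Num.sqrt (\det P))^-1.

Lemma rdet_gt0 P : posdef P -> 0 < rdet P.
Proof. by move=> /posdef_det h; rewrite invr_gt0 sqrtr_gt0. Qed.

Lemma rdet_sqr P : posdef P -> rdet P ^+ 2 = \det (invmx P).
Proof.
by move=> /posdef_det h; rewrite exprVn sqr_sqrtr ?ltW// det_inv.
Qed.

Lemma invmx_sub P N : P \in unitmx -> N \in unitmx ->
  invmx N - invmx P = - (invmx N *m (N - P) *m invmx P).
Proof.
move=> uP uN; rewrite mulmxBr mulVmx// mulmxBl mul1mx -mulmxA mulmxV// mulmx1.
by rewrite opprB.
Qed.

Lemma sqrt_ratio_estimates (x y q : R) : 0 < x -> 0 < y -> y = x * (1 + q) ->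
  `|(Num.sqrt y)^-1 - (Num.sqrt x)^-1| <= `|q| * (Num.sqrt y)^-1 /\
  `|(Num.sqrt y)^-1 - (Num.sqrt x)^-1 + 2^-1 * q * (Num.sqrt x)^-1|
    <= 2 * q ^+ 2 * (Num.sqrt y)^-1.
Proof.
move=> x0 y0 yE; set u := Num.sqrt x; set w := Num.sqrt y.
have u0 : 0 < u by rewrite sqrtr_gt0.
have w0 : 0 < w by rewrite sqrtr_gt0.
have u2 : u ^+ 2 = x by rewrite sqr_sqrtr// ltW.
have w2 : w ^+ 2 = y by rewrite sqr_sqrtr// ltW.
pose rho := w / u; have r0 : 0 < rho by rewrite divr_gt0.
have uE : u^-1 = rho * w^-1 by rewrite /rho; field; rewrite !gt_eqF.
have qE : q = rho ^+ 2 - 1.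
  rewrite /rho expr_div_n u2 w2 yE; field; by rewrite gt_eqF.
have wi : 0 <= w^-1 by rewrite invr_ge0 ltW.
rewrite uE qE; split.
- rewrite -[X in `|X - _|]mul1r -mulrBl normrM (ger0_norm wi) ler_wpM2r//.
  rewrite (_ : rho ^+ 2 - 1 = (rho - 1) * (rho + 1)); last by ring.
  rewrite normrM distrC ler_peMr// ger0_norm; lra.
- rewrite [X in `|X|](_ : _ = ((rho - 1) ^+ 2 * ((2 + rho) / 2)) * w^-1); last by clearbody rho; field; rewrite gt_eqF.
  rewrite normrM (ger0_norm wi) ler_wpM2r//.
  rewrite ger0_norm; last by rewrite mulr_ge0 ?sqr_ge0//; lra.
  rewrite (_ : 2 * _ = (rho - 1) ^+ 2 * (2 * (rho + 1) ^+ 2)); last by ring.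
  rewrite ler_wpM2l ?sqr_ge0//; have := sqr_ge0 rho; rewrite !expr2; lra.
Qed.

Lemma det_ratio P N : P \in unitmx ->
  let X := invmx P *m (N - P) in
  \det N = \det P * (1 + (\tr X + e2 X + \det X)).
Proof.
move=> uP X.
have -> : N = P *m (X + 1%:M).
  by rewrite /X mulmxDr mulmx1 mulKVmx// subrK.
rewrite det_mulmx det_add_scalar; congr (_ * _); ring.
Qed.

(* The weight [gamma^-p] at [P >= gamma I] becomes the decay [(1 + s)^-p] of
   [s |-> F (B + s I)], uniformly in [B]. *)
Definition lipw (p : nat) (F : 'M[R]_3 -> R) := forall c D : R, 0 < c -> 0 <= D ->
  exists2 K : R, 0 <= K & forall gamma P N, c <= gamma -> geI gamma P -> geI gamma N ->
    `|N - P| <= D ->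
    `|F P| <= K / gamma ^+ p /\ `|F N - F P| <= K * `|N - P| / gamma ^+ p.

Definition diffw (p : nat) (F : 'M[R]_3 -> R) (dF : 'M[R]_3 -> 'M[R]_3 -> R) :=
  forall c D : R, 0 < c -> 0 <= D ->
  exists2 K : R, 0 <= K & forall gamma P N, c <= gamma -> geI gamma P -> geI gamma N ->
    `|N - P| <= D ->
    `|F N - F P - dF P (N - P)| <= K * `|N - P| ^+ 2 / gamma ^+ p.

Lemma lipw_weaken p F : lipw p.+1 F -> lipw p F.
Proof.
move=> h c D c0 D0; have [K K0 hK] := h c D c0 D0.
exists (K / c); first by rewrite divr_ge0// ltW.
move=> g P N cg gP gN hD; have [h1 h2] := hK g P N cg gP gN hD.
have g0 : 0 < g by exact: lt_le_trans cg.
have e : (g ^+ p.+1)^-1 <= c^-1 / g ^+ p.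
  rewrite exprS invfM ler_wpM2r ?invr_ge0 ?exprn_ge0 ?(ltW g0)//.
  by rewrite lef_pV2// posrE.
split.
- by apply: le_trans h1 _; rewrite -mulrA ler_wpM2l.
- apply: le_trans h2 _.
  rewrite (_ : K / c * _ / _ = K * `|N - P| * (c^-1 / g ^+ p)); last by ring.
  by rewrite ler_wpM2l// mulr_ge0.
Qed.

Lemma lipwD p F G : lipw p F -> lipw p G -> lipw p (fun P => F P + G P).
Proof.
move=> hF hG c D c0 D0; have [K K0 hK] := hF c D c0 D0; have [L L0 hL] := hG c D c0 D0.
exists (K + L); first exact: addr_ge0.
move=> g P N cg gP gN hD; have [h1 h2] := hK g P N cg gP gN hD.
have [h3 h4] := hL g P N cg gP gN hD; split.
- by apply: le_trans (ler_normD _ _) _; rewrite mulrDl lerD.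
- rewrite (_ : _ - _ = (F N - F P) + (G N - G P)); last by ring.
  by apply: le_trans (ler_normD _ _) _; rewrite !mulrDl lerD.
Qed.

Lemma lipwZ p F (a : R) : lipw p F -> lipw p (fun P => a * F P).
Proof.
move=> hF c D c0 D0; have [K K0 hK] := hF c D c0 D0.
exists (`|a| * K); first by rewrite mulr_ge0.
move=> g P N cg gP gN hD; have [h1 h2] := hK g P N cg gP gN hD; split.
- by rewrite normrM -mulrA ler_wpM2l.
- by rewrite -mulrBr normrM -!mulrA ler_wpM2l// mulrA.
Qed.

Lemma lipwM p q F G : lipw p F -> lipw q G -> lipw (p + q) (fun P => F P * G P).
Proof.
move=> hF hG c D c0 D0; have [K K0 hK] := hF c D c0 D0; have [L L0 hL] := hG c D c0 D0.
exists (2 * K * L); first by rewrite !mulr_ge0.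
move=> g P N cg gP gN hD; have [h1 h2] := hK g P N cg gP gN hD.
have [h3 h4] := hL g P N cg gP gN hD.
have hDD : `|N - N| <= D by rewrite subrr normr0.
have [h5 _] := hL g N N cg gN gN hDD.
have g0 : 0 < g by exact: lt_le_trans cg.
have gp : (g ^+ (p + q))^-1 = (g ^+ p)^-1 * (g ^+ q)^-1 by rewrite exprD invfM.
have p0 : 0 <= (g ^+ p)^-1 by rewrite invr_ge0 exprn_ge0// ltW.
have q0 : 0 <= (g ^+ q)^-1 by rewrite invr_ge0 exprn_ge0// ltW.
split.
- rewrite normrM gp; apply: (@le_trans _ _ ((K / g ^+ p) * (L / g ^+ q))).
    by rewrite ler_pM.
  have : 0 <= K * L * ((g ^+ p)^-1 * (g ^+ q)^-1) by rewrite !mulr_ge0.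
  lra.
- rewrite (_ : _ - _ = (F N - F P) * G N + F P * (G N - G P)); last by ring.
  apply: le_trans (ler_normD _ _) _; rewrite !normrM gp.
  apply: (@le_trans _ _ ((K * `|N - P| / g ^+ p) * (L / g ^+ q) + (K / g ^+ p) * (L * `|N - P| / g ^+ q))).
    by rewrite lerD// ler_pM.
  lra.
Qed.

Lemma diffwM p q F G dF dG : lipw p F -> lipw q G -> diffw p F dF -> diffw q G dG ->
  diffw (p + q) (fun P => F P * G P) (fun P H => dF P H * G P + F P * dG P H).
Proof.
move=> hF hG hdF hdG c D c0 D0.
have [K K0 hK] := hF c D c0 D0; have [L L0 hL] := hG c D c0 D0.
have [K' K'0 hK'] := hdF c D c0 D0; have [L' L'0 hL'] := hdG c D c0 D0.
exists (K' * L + K * L' + K * L); first by rewrite !addr_ge0 ?mulr_ge0.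
move=> g P N cg gP gN hD; have [h1 h2] := hK g P N cg gP gN hD.
have [h3 h4] := hL g P N cg gP gN hD.
have h5 := hK' g P N cg gP gN hD; have h6 := hL' g P N cg gP gN hD.
have g0 : 0 < g by exact: lt_le_trans cg.
have gp : (g ^+ (p + q))^-1 = (g ^+ p)^-1 * (g ^+ q)^-1 by rewrite exprD invfM.
have p0 : 0 <= (g ^+ p)^-1 by rewrite invr_ge0 exprn_ge0// ltW.
have q0 : 0 <= (g ^+ q)^-1 by rewrite invr_ge0 exprn_ge0// ltW.
rewrite (_ : _ - _ = (F N - F P - dF P (N - P)) * G P + F P * (G N - G P - dG P (N - P))
   + (F N - F P) * (G N - G P)); last by ring.
apply: le_trans (ler_normD _ _) _; apply: le_trans (lerD (ler_normD _ _) (lexx _)) _.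
rewrite !normrM gp.
apply: (@le_trans _ _ ((K' * `|N - P| ^+ 2 / g ^+ p) * (L / g ^+ q) +
   (K / g ^+ p) * (L' * `|N - P| ^+ 2 / g ^+ q) + (K * `|N - P| / g ^+ p) * (L * `|N - P| / g ^+ q))).
  by rewrite !lerD// ler_pM.
by rewrite !expr2; lra.
Qed.

Lemma norm_invmxM c g P N : 0 < c -> c <= g -> geI g P ->
  `|invmx P *m N| <= 3 * `|N| / g.
Proof.
move=> c0 cg gP; have g0 : 0 < g by exact: lt_le_trans cg.
apply: le_trans (norm_mulmx _ _) _; rewrite mulrAC ler_wpM2l// ?mulr_ge0//.
exact: geI_inv_norm.
Qed.

Lemma rdet_le c g P : 0 < c -> c <= g -> geI g P -> rdet P <= (6 / c + 1) / g.
Proof.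
move=> c0 cg gP; have g0 : 0 < g by exact: lt_le_trans cg.
have pP := geI_posdef g0 gP.
have k0 : 0 < 6 / c by rewrite divr_gt0.
rewrite -(@ler_pXn2r _ 2)// ?nnegrE ?(ltW (rdet_gt0 pP)) ?divr_ge0 ?addr_ge0 ?(ltW k0) ?(ltW g0)//.
rewrite rdet_sqr//; apply: le_trans (ler_norm _) _; apply: le_trans (norm_det _) _.
apply: (@le_trans _ _ (6 * (g^-1) ^+ 3)).
  by rewrite ler_wpM2l// ler_pXn2r// ?nnegrE ?invr_ge0 ?(ltW g0)// geI_inv_norm.
rewrite expr_div_n -exprVn exprS mulrA ler_wpM2r ?exprn_ge0 ?invr_ge0 ?(ltW g0)//.
apply: (@le_trans _ _ (6 / c)); last by rewrite expr2; nra.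
by rewrite ler_wpM2l// lef_pV2// posrE.
Qed.

Lemma lipw_invmx i j : lipw 1 (fun P => invmx P i j).
Proof.
move=> c D c0 D0; exists (1 + 9 / c); first by rewrite addr_ge0// divr_ge0// ltW.
move=> g P N cg gP gN hD; have g0 : 0 < g by exact: lt_le_trans cg.
have uP := posdef_unit (geI_posdef g0 gP); have uN := posdef_unit (geI_posdef g0 gN).
have c9 : 0 <= 9 / c by rewrite divr_ge0// ltW.
have gi : 0 <= g^-1 by rewrite invr_ge0 ltW.
rewrite expr1; split.
- apply: le_trans (geI_inv_entry _ _ g0 gP) _; nra.
- have -> : invmx N i j - invmx P i j = (invmx N - invmx P) i j by rewrite !mxE.
  apply: le_trans (mx_entry_le _ _ _) _; rewrite invmx_sub// normrN.
  apply: le_trans (norm_mulmx _ _) _.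
  apply: (@le_trans _ _ (3 * (3 * `|N - P| / g) * c^-1)).
    rewrite ler_pM ?mulr_ge0//; first by rewrite ler_wpM2l// (norm_invmxM _ c0).
    by apply: geI_inv_norm => //; exact: geI_le gP.
  by have : 0 <= `|N - P| / g; [rewrite divr_ge0// ltW|lra].
Qed.

Lemma diffw_invmx i j :
  diffw 1 (fun P => invmx P i j) (fun P H => - (invmx P *m H *m invmx P) i j).
Proof.
move=> c D c0 D0; exists (81 / c ^+ 2); first by rewrite divr_ge0// exprn_ge0// ltW.
move=> g P N cg gP gN hD; have g0 : 0 < g by exact: lt_le_trans cg.
have uP := posdef_unit (geI_posdef g0 gP); have uN := posdef_unit (geI_posdef g0 gN).
have gi : 0 <= g^-1 by rewrite invr_ge0 ltW.
have -> : invmx N i j - invmx P i j - - (invmx P *m (N - P) *m invmx P) i j =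
   (invmx N *m (N - P) *m invmx P *m (N - P) *m invmx P) i j.
  have -> : invmx N *m (N - P) *m invmx P *m (N - P) *m invmx P =
     invmx N - invmx P + invmx P *m (N - P) *m invmx P.
    have e : invmx N *m (N - P) *m invmx P = invmx P - invmx N.
      by rewrite -[LHS]opprK -invmx_sub// opprB.
    by rewrite e !mulmxBl e addrC opprB.
  by rewrite opprK [RHS]mxE; congr (_ + _); rewrite !mxE.
apply: le_trans (mx_entry_le _ _ _) _.
have -> : invmx N *m (N - P) *m invmx P *m (N - P) *m invmx P =
   (invmx N *m (N - P)) *m (invmx P *m (N - P)) *m invmx P by rewrite !mulmxA.
have b1 := norm_invmxM (N - P) c0 cg gN; have b2 := norm_invmxM (N - P) c0 cg gP.
have b3 := geI_inv_norm g0 gP.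
have ci : g^-1 <= c^-1 by rewrite lef_pV2// posrE.
apply: le_trans (norm_mulmx _ _) _.
apply: (@le_trans _ _ (3 * (3 * (3 * `|N - P| / c) * (3 * `|N - P| / c)) * g^-1)).
  rewrite ler_pM ?mulr_ge0// ler_wpM2l//; apply: le_trans (norm_mulmx _ _) _.
  have b c' : c' <= 3 * `|N - P| / g -> c' <= 3 * `|N - P| / c.
    by move=> h; apply: le_trans h _; rewrite ler_wpM2l// mulr_ge0.
  by rewrite ler_pM ?mulr_ge0 ?b// ler_wpM2l// b.
by rewrite expr1 le_eqVlt; apply/orP; left; apply/eqP; field; rewrite !gt_eqF.
Qed.

Lemma rdet_estimates c D : 0 < c -> 0 <= D ->
  exists2 K : R, 0 <= K & forall g P N, c <= g -> geI g P -> geI g N -> `|N - P| <= D ->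
    [/\ `|rdet N - rdet P| <= K * `|N - P| / g,
        `|rdet P| <= K / g &
        `|rdet N - rdet P + 2^-1 * \tr (invmx P *m (N - P)) * rdet P| <= K * `|N - P| ^+ 2 / g].
Proof.
move=> c0 D0.
pose K0 := 6 / c + 1; pose K1 := 54 / c ^+ 2 * (1 + 3 * D / c); pose K2 := 9 / c + K1 * D.
have ci0 : 0 <= c^-1 by rewrite invr_ge0 ltW.
have K00 : 0 <= K0 by rewrite /K0 addr_ge0 ?mulr_ge0.
have K10 : 0 <= K1 by rewrite /K1 !mulr_ge0 ?addr_ge0 ?mulr_ge0// invr_ge0 exprn_ge0// ltW.
have K20 : 0 <= K2 by apply: addr_ge0; apply: mulr_ge0.
exists (K0 + K2 * K0 + (2 * K2 ^+ 2 * K0 + K1 * K0)).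
  have K22 : 0 <= K2 ^+ 2 by rewrite exprn_ge0.
  by repeat first [done | apply: addr_ge0 | apply: mulr_ge0].
move=> g P N cg gP gN hD; have g0 : 0 < g by exact: lt_le_trans cg.
have pP := geI_posdef g0 gP; have pN := geI_posdef g0 gN.
have uP := posdef_unit pP.
set h := `|N - P|; have h0 : 0 <= h by exact: normr_ge0.
have gi : 0 <= g^-1 by rewrite invr_ge0 ltW.
have rP := rdet_le c0 cg gP; have rN := rdet_le c0 cg gN; rewrite -/K0 in rP rN.
have rP0 := rdet_gt0 pP; have rN0 := rdet_gt0 pN.
set X := invmx P *m (N - P).
have hX : `|X| <= 3 * h / c.
  apply: le_trans (norm_invmxM _ c0 cg gP) _.
  by rewrite ler_wpM2l ?mulr_ge0// lef_pV2// posrE.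
have hXD : `|X| <= 3 * D / c.
  by apply: le_trans hX _; rewrite -!mulrA ler_wpM2l// ler_wpM2r.
pose q := \tr X + e2 X + \det X.
have [E1 E2] := sqrt_ratio_estimates (posdef_det pP) (posdef_det pN) (det_ratio N uP).
rewrite -/X -/q -/(rdet P) -/(rdet N) in E1 E2.
have qt : `|q - \tr X| <= K1 * h ^+ 2.
  have -> : q - \tr X = e2 X + \det X by rewrite /q; ring.
  apply: le_trans (ler_normD _ _) _; apply: le_trans (lerD (norm_e2 _) (norm_det _)) _.
  rewrite (_ : _ + _ = 6 * `|X| ^+ 2 * (1 + `|X|)); last by ring.
  have -> : K1 * h ^+ 2 = 6 * (3 * h / c) ^+ 2 * (1 + 3 * D / c).
    by rewrite /K1; field; rewrite gt_eqF.
  rewrite ler_pM ?mulr_ge0 ?exprn_ge0//; last by rewrite lerD2l.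
  by rewrite ler_wpM2l// ler_pXn2r// ?nnegrE ?mulr_ge0.
have qh : `|q| <= K2 * h.
  have -> : q = \tr X + (q - \tr X) by ring.
  apply: le_trans (ler_normD _ _) _; rewrite mulrDl lerD//.
    apply: le_trans (norm_tr _) _; rewrite (_ : 9 / c * h = 3 * (3 * h / c)); last by ring.
    by rewrite ler_wpM2l.
  by apply: le_trans qt _; rewrite -mulrA ler_wpM2l// expr2 ler_wpM2r.
have S1 : 0 <= K0 / g by rewrite mulr_ge0.
have S2 : 0 <= K2 * K0 / g by rewrite !mulr_ge0.
have S3 : 0 <= (2 * K2 ^+ 2 * K0 + K1 * K0) / g.
  have K22 : 0 <= K2 ^+ 2 by rewrite exprn_ge0.
  by repeat first [done | apply: addr_ge0 | apply: mulr_ge0].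
split.
- apply: le_trans E1 _; apply: (@le_trans _ _ ((K2 * h) * (K0 / g))).
    by rewrite ler_pM// ltW.
  rewrite (_ : K2 * h * _ = h * (K2 * K0 / g)); last by ring.
  rewrite (_ : _ * h / g = h * (K0 / g + K2 * K0 / g + (2 * K2 ^+ 2 * K0 + K1 * K0) / g)); last by ring.
  by rewrite ler_wpM2l//; lra.
- rewrite ger0_norm ?(ltW rP0)//; apply: le_trans rP _; rewrite -/K0; lra.
- rewrite (_ : _ + _ = (rdet N - rdet P + 2^-1 * q * rdet P) - 2^-1 * ((q - \tr X) * rdet P)); last by ring.
  apply: le_trans (ler_normB _ _) _.
  apply: (@le_trans _ _ (2 * (K2 * h) ^+ 2 * (K0 / g) + 2^-1 * (K1 * h ^+ 2 * (K0 / g)))).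
    rewrite lerD//.
      apply: le_trans E2 _; apply: ler_pM => //; [|exact: ltW|].
        by rewrite mulr_ge0// sqr_ge0.
      by rewrite ler_wpM2l// -[q ^+ 2]real_normK ?num_real// ler_pXn2r// nnegrE mulr_ge0.
    rewrite normrM ger0_norm ?invr_ge0// ler_wpM2l ?invr_ge0// normrM (ger0_norm (ltW rP0)).
    by rewrite ler_pM// ltW.
  rewrite (_ : _ + _ = h ^+ 2 * (2 * K2 ^+ 2 * K0 / g + 2^-1 * (K1 * K0 / g))); last by ring.
  rewrite (_ : _ * h ^+ 2 / g = h ^+ 2 * (K0 / g + K2 * K0 / g + (2 * K2 ^+ 2 * K0 + K1 * K0) / g)); last by ring.
  rewrite ler_wpM2l ?exprn_ge0//.
  have : 0 <= K1 * K0 / g by rewrite -mulrA; apply: mulr_ge0 => //; apply: mulr_ge0.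
  by rewrite mulrDl; lra.
Qed.

Lemma lipw_rdet : lipw 1 rdet.
Proof.
move=> c D c0 D0; have [K K0 hK] := rdet_estimates c0 D0; exists K => // g P N cg gP gN hD.
by rewrite expr1; have [h1 h2 _] := hK g P N cg gP gN hD.
Qed.

Lemma diffw_rdet : diffw 1 rdet (fun P H => - (2^-1 * \tr (invmx P *m H) * rdet P)).
Proof.
move=> c D c0 D0; have [K K0 hK] := rdet_estimates c0 D0; exists K => // g P N cg gP gN hD.
by rewrite expr1 opprK; have [_ _] := hK g P N cg gP gN hD.
Qed.

End Resolvent.

(** * Integrals over the half-line *)

Section HalfLine.
Variable R : realType.
Implicit Types (f g F : R -> R).

Definition Int f : R := Rintegral (@lebesgue_measure R) `[0%R, +oo[%classic f.

Definition halfline_cont f := forall s : R, 0 <= s -> {for s, continuous f}.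

Definition nice f := halfline_cont f /\
  exists K : R, forall s : R, 0 <= s -> `|f s| <= K / (1 + s) ^+ 2.

Lemma halfline_within f : halfline_cont f -> {within `[0, +oo[, continuous f}.
Proof.
move=> cf; apply: continuous_in_subspaceT => x.
by rewrite inE/= in_itv/= andbT; exact: cf.
Qed.

Lemma halfline_contD f g : halfline_cont f -> halfline_cont g ->
  halfline_cont (fun s => f s + g s).
Proof. by move=> cf cg s s0; apply: cvgD; [exact: cf|exact: cg]. Qed.

Lemma halfline_contM f g : halfline_cont f -> halfline_cont g ->
  halfline_cont (fun s => f s * g s).
Proof. by move=> cf cg s s0; apply: cvgM; [exact: cf|exact: cg]. Qed.

Lemma halfline_cont_cst (a : R) : halfline_cont (fun=> a).
Proof. by move=> s s0; exact: cvg_cst. Qed.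

Lemma is_derive_halfline F f : (forall s : R, 0 <= s -> is_derive s (1 : R) F (f s)) ->
  halfline_cont F.
Proof. by move=> h s s0; apply: is_derive_continuous; exact: h. Qed.

Lemma cvg_pinfty0 F (K : R) : (forall s, 0 <= s -> `|F s| <= K / (1 + s)) ->
  F s @[s --> +oo] --> 0.
Proof.
move=> h; apply/cvgrPdist_le => e e0; near=> s.
have s0 : 0 <= s by near: s; exact: nbhs_pinfty_ge.
rewrite sub0r normrN; apply: le_trans (h _ s0) _.
rewrite ler_pdivrMr; last by lra.
have : K / e <= s by near: s; apply: nbhs_pinfty_ge; exact: num_real.
by rewrite ler_pdivrMr// mulrC; nra.
Unshelve. all: by end_near. Qed.

Lemma is_derive_ge0_Int F f (l : R) : (forall s : R, 0 <= s -> 0 <= f s) ->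
  halfline_cont f -> (forall s : R, 0 <= s -> is_derive s (1 : R) F (f s)) ->
  F s @[s --> +oo] --> l ->
  (@lebesgue_measure R).-integrable `[0%R : R, +oo[ (EFin \o f) /\ Int f = l - F 0.
Proof.
move=> f0 cf dF Fl; have cF := is_derive_halfline dF.
have wf := halfline_within cf.
have d1 s : 0 < s -> derivable F s 1 by move=> /ltW/dF; case.
have d2 : F x @[x --> 0^'+] --> F 0 by apply: cvg_at_right_filter; exact: cF.
have d3 : {in `]0, +oo[, F^`()%classic =1 f}.
  move=> s; rewrite in_itv/= andbT => /ltW/dF[_ <-]; exact: derive1E.
have E := ge0_continuous_FTC2y f0 wf Fl d1 d2 d3.
split; last by rewrite /Int (Rintegral_ge0_continuous_FTC2y f0 wf Fl d1 d2 d3).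
apply/integrableP; split.
  by apply/measurable_EFinP; apply: subspace_continuous_measurable_fun.
rewrite (_ : (\int[_]_(x in _) _)%E = (\int[lebesgue_measure]_(x in `[0%R, +oo[) (f x)%:E)%E).
  by rewrite E -EFinB ltry.
apply: eq_integral => x; rewrite inE/= in_itv/= andbT => x0.
by rewrite ger0_norm ?f0.
Qed.

Lemma is_derive_inv1 (s : R) : 0 <= s ->
  is_derive s (1 : R) (fun s => - (1 + s)^-1) (1 / (1 + s) ^+ 2).
Proof.
move=> s0; have n0 : 1 + s != 0 by rewrite gt_eqF//; lra.
have h : is_derive s (1 : R) (fun s => (1 + s)^-1) (- (1 + s) ^- 2 *: (0 + 1)).
  exact: (@is_deriveV R (fun s => 1 + s)).
by have := is_deriveN h; rewrite /GRing.scale/= add0r mulr1 opprK div1r.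
Qed.

Lemma halfline_cont_inv1X n : halfline_cont (fun s => (1 + s) ^- n).
Proof.
move=> s s0; apply: cvgV; first by rewrite expf_neq0// gt_eqF//; lra.
have h : (fun s : R => 1 + s) s @[s --> s] --> 1 + s by apply: cvgD; [exact: cvg_cst|exact: cvg_id].
exact: (continuous_comp h (@exprn_continuous R n _)).
Qed.

Lemma Int_inv2 : (@lebesgue_measure R).-integrable `[0%R : R, +oo[ (EFin \o (fun s => 1 / (1 + s) ^+ 2)) /\
  Int (fun s => 1 / (1 + s) ^+ 2) = 1.
Proof.
have [||||i ->] := @is_derive_ge0_Int (fun s => - (1 + s)^-1) (fun s => 1 / (1 + s) ^+ 2) 0.
- by move=> s s0; rewrite divr_ge0 ?exprn_ge0//; lra.
- by apply: halfline_contM; [exact: halfline_cont_cst|exact: halfline_cont_inv1X].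
- exact: is_derive_inv1.
- apply: (@cvg_pinfty0 _ 1) => s s0; rewrite normrN div1r ger0_norm// invr_ge0; lra.
- by rewrite addr0 invr1 opprK add0r.
Qed.

Lemma nice_integrable f : nice f -> (@lebesgue_measure R).-integrable `[0%R : R, +oo[ (EFin \o f).
Proof.
move=> [cf [K hK]].
have iK : (@lebesgue_measure R).-integrable `[0%R : R, +oo[ (EFin \o (fun s => K * (1 / (1 + s) ^+ 2))).
  have [i _] := Int_inv2; have : (@lebesgue_measure R).-integrable `[0%R : R, +oo[
     (fun s : R => (K%:E * (1 / (1 + s) ^+ 2)%:E)%E) by exact: integrableZl.
  by apply: eq_integrable => // x _; rewrite /= EFinM.
apply: le_integrable iK => //.
  by apply/measurable_EFinP; apply: subspace_continuous_measurable_fun => //; exact: halfline_within.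
move=> x /=; rewrite in_itv/= andbT => x0; rewrite lee_fin.
apply: le_trans (hK _ x0) _; apply: le_trans (ler_norm _) _.
by rewrite div1r.
Qed.

Lemma niceD f g : nice f -> nice g -> nice (fun s => f s + g s).
Proof.
move=> [cf [K hK]] [cg [L hL]]; split; first exact: halfline_contD.
exists (K + L) => s s0; apply: le_trans (ler_normD _ _) _.
by rewrite mulrDl lerD ?hK ?hL.
Qed.

Lemma niceZ (a : R) f : nice f -> nice (fun s => a * f s).
Proof.
move=> [cf [K hK]]; split; first by apply: halfline_contM => //; exact: halfline_cont_cst.
exists (`|a| * K) => s s0; rewrite normrM -mulrA ler_wpM2l// hK//.
Qed.

Lemma nice0 : nice (fun=> 0).
Proof.
split; first exact: halfline_cont_cst.
by exists 0 => s _; rewrite normr0 mul0r.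
Qed.

Lemma nice_ext f g : f =1 g -> nice f -> nice g.
Proof. by move=> /funext ->. Qed.

Lemma nice_sum (I : Type) (r : seq I) (f : I -> R -> R) :
  (forall i, nice (f i)) -> nice (fun s => \sum_(i <- r) f i s).
Proof.
move=> h; elim: r => [|i r IH].
  by apply: (nice_ext _ nice0) => s; rewrite big_nil.
by apply: (nice_ext _ (niceD (h i) IH)) => s; rewrite big_cons.
Qed.

Lemma eq_Int f g : (forall s, 0 <= s -> f s = g s) -> Int f = Int g.
Proof.
move=> h; apply: eq_Rintegral => x; rewrite inE/= in_itv/= andbT; exact: h.
Qed.

Lemma IntD f g : nice f -> nice g -> Int (fun s => f s + g s) = Int f + Int g.
Proof. by move=> nf ng; apply: RintegralD => //; exact: nice_integrable. Qed.

Lemma IntZ (a : R) f : nice f -> Int (fun s => a * f s) = a * Int f.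
Proof. by move=> nf; apply: RintegralZl => //; exact: nice_integrable. Qed.

Lemma IntB f g : nice f -> nice g -> Int (fun s => f s - g s) = Int f - Int g.
Proof. by move=> nf ng; apply: RintegralB => //; exact: nice_integrable. Qed.

Lemma Int0 : Int (fun=> 0) = 0.
Proof.
rewrite -[RHS](mul0r (Int (fun=> 0))) -(IntZ _ nice0).
by congr Int; apply/funext => s; rewrite mulr0.
Qed.

Lemma Int_sum (I : Type) (r : seq I) (f : I -> R -> R) :
  (forall i, nice (f i)) -> Int (fun s => \sum_(i <- r) f i s) = \sum_(i <- r) Int (f i).
Proof.
move=> h; elim: r => [|i r IH].
  by rewrite [RHS]big_nil -[RHS]Int0; congr Int; apply/funext => s; rewrite big_nil.
rewrite big_cons -IH -IntD//; last exact: nice_sum.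
by congr Int; apply/funext => s; rewrite big_cons.
Qed.

Lemma le_Int f g : nice f -> nice g -> (forall s, 0 <= s -> f s <= g s) -> Int f <= Int g.
Proof.
move=> nf ng h; apply: le_Rintegral => //; [exact: nice_integrable|exact: nice_integrable|].
by move=> x /=; rewrite in_itv/= andbT; exact: h.
Qed.

Lemma nice_inv2 (K : R) : nice (fun s => K / (1 + s) ^+ 2).
Proof.
split; first by apply: halfline_contM; [exact: halfline_cont_cst|exact: halfline_cont_inv1X].
exists `|K| => s s0; rewrite normrM ler_wpM2l// ger0_norm// invr_ge0 exprn_ge0//; lra.
Qed.

Lemma Int_inv2Z (K : R) : Int (fun s => K / (1 + s) ^+ 2) = K.
Proof.
rewrite -[RHS]mulr1 -[X in _ = _ * X]Int_inv2.2 -IntZ; last exact: nice_inv2.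
by congr Int; apply/funext => s; rewrite div1r.
Qed.

Lemma norm_Int_le f (K : R) : nice f -> (forall s, 0 <= s -> `|f s| <= K / (1 + s) ^+ 2) ->
  `|Int f| <= K.
Proof.
move=> nf h; rewrite ler_norml; apply/andP; split.
- rewrite -[X in - X <= _]Int_inv2Z -mulN1r -IntZ; last exact: nice_inv2.
  apply: le_Int => //; first by apply: niceZ; exact: nice_inv2.
  by move=> s /h; rewrite ler_norml mulN1r => /andP[].
- rewrite -[leRHS]Int_inv2Z; apply: le_Int => //; first exact: nice_inv2.
  by move=> s /h; apply: le_trans; exact: ler_norm.
Qed.

Lemma Int_is_derive F f (l : R) : nice f ->
  (forall s : R, 0 <= s -> is_derive s (1 : R) F (f s)) ->
  F s @[s --> +oo] --> l -> Int f = l - F 0.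
Proof.
move=> nf dF Fl; have [cf [K hK]] := nf.
pose k (s : R) := K / (1 + s) ^+ 2.
pose G (s : R) := F s + K * - (1 + s)^-1.
have [||||_] := @is_derive_ge0_Int G (fun s => f s + k s) l.
- by move=> s /hK; rewrite ler_norml -/(k s) => /andP[]; lra.
- by apply: halfline_contD => //; case: (nice_inv2 K).
- move=> s s0; apply: is_deriveD; first exact: dF.
  have := is_deriveZ K (is_derive_inv1 s0).
  by rewrite /GRing.scale/= div1r.
- rewrite -[l]addr0; apply: cvgD => //.
  apply: (@cvg_pinfty0 _ `|K|) => s s0; rewrite normrM normrN ler_wpM2l// ger0_norm// invr_ge0; lra.
- rewrite IntD//; last exact: nice_inv2.
  by rewrite Int_inv2Z /G addr0 invr1; lra.
Qed.

Lemma Int_inv4 : nice (fun s => 1 / (1 + s) ^+ 4) /\ 0 < Int (fun s => 1 / (1 + s) ^+ 4).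
Proof.
have n4 : nice (fun s => 1 / (1 + s) ^+ 4).
  split; first by apply: halfline_contM; [exact: halfline_cont_cst|exact: halfline_cont_inv1X].
  exists 1 => s s0; rewrite !div1r ger0_norm ?invr_ge0 ?exprn_ge0//; try lra.
  rewrite lef_pV2 ?posrE ?exprn_gt0//; try lra.
  by rewrite ler_weXn2l//; lra.
split => //.
have d (s : R) : 0 <= s ->
    is_derive s (1 : R) (fun s => (- 3^-1) * (- - (1 + s)^-1) ^+ 3) (1 / (1 + s) ^+ 4).
  move=> s0; have n0 : 1 + s != 0 by rewrite gt_eqF//; lra.
  have h := is_deriveZ (- 3^-1) (is_deriveX 3 (is_deriveN (is_derive_inv1 s0))).
  apply: (is_derive_eq h); rewrite /GRing.scale/= opprK; field.
  by rewrite n0.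
rewrite (Int_is_derive (l := 0) n4 d); first by rewrite addr0 invr1 opprK; lra.
apply: (@cvg_pinfty0 _ 3^-1) => s s0.
have i0 : 0 <= (1 + s)^-1 by rewrite invr_ge0; lra.
have h3 : 0 <= (3 : R)^-1 by rewrite invr_ge0.
have i1 : (1 + s)^-1 <= 1 by rewrite invf_le1; lra.
rewrite opprK normrM normrN (ger0_norm h3) ger0_norm ?exprn_ge0// ler_wpM2l//.
by rewrite exprS ler_piMr// exprn_ile1.
Qed.

End HalfLine.

(** * Symmetrization *)

Section Symmetrization.

Lemma lift_perm_surj n (i : 'I_n.+1) (s : 'S_n.+1) : s ord0 = i ->
  exists t : 'S_n, lift_perm ord0 i t = s.
Proof.
move=> si.
pose f k := odflt k (unlift i (s (lift ord0 k))).
have fE k : lift i (f k) = s (lift ord0 k).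
  rewrite /f -si; have := neq_lift ord0 k.
  by rewrite -(can_eq (permK s)) => /unlift_some[] ? ? ->.
have fI : injective f.
  by move=> a b ab; apply: (@lift_inj _ ord0); apply: (@perm_inj _ s); rewrite -!fE ab.
exists (perm fI); apply/permP => k.
case: (unliftP ord0 k) => [k'|] ->; first by rewrite lift_perm_lift permE fE.
by rewrite lift_perm_id.
Qed.

Lemma lift_perm_inj n (i : 'I_n.+1) : injective (@lift_perm n ord0 i).
Proof.
move=> s t st; apply/permP => k; apply: (@lift_inj _ i).
by rewrite -!(lift_perm_lift ord0) st.
Qed.

Lemma sum_lift_perm (V : nmodType) n (F : 'S_n.+1 -> V) :
  \sum_(s : 'S_n.+1) F s = \sum_(i < n.+1) \sum_(s : 'S_n) F (lift_perm ord0 i s).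
Proof.
rewrite (partition_big (fun s : 'S_n.+1 => s ord0) xpredT)//=.
apply: eq_bigr => i _; rewrite (reindex (lift_perm ord0 i)).
  by apply: eq_bigl => s; rewrite lift_perm_id eqxx.
exists (fun s : 'S_n.+1 => odflt 1%g [pick t : 'S_n | lift_perm ord0 i t == s]) => s.
  move=> _; case: pickP => [t /eqP/lift_perm_inj-> //|/(_ s)]; by rewrite eqxx.
rewrite inE => /eqP/lift_perm_surj[t tE].
by case: pickP => [u /eqP //|/(_ t)]; rewrite tE eqxx.
Qed.

Variable R : realType.

Lemma sym4_tprod (M : 'M[R]_3) i j k l : sym_mx M ->
  sym4 (tprod M M) i j k l = 3^-1 * (M i j * M k l + M i k * M j l + M i l * M j k).
Proof.
move=> sM; have sw a b : M a b = M b a by rewrite -[in LHS]sM mxE.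
rewrite /sym4 sum_lift_perm.
under eq_bigr do rewrite sum_lift_perm.
under eq_bigr => a _ do under eq_bigr => b _ do rewrite sum_lift_perm.
under eq_bigr => a _ do under eq_bigr => b _ do under eq_bigr => c _ do rewrite sum_lift_perm.
have S0 (F : 'S_0 -> R) : \sum_s F s = F 1%g.
  rewrite (bigD1 1%g)//= big1 ?addr0// => s; case/negP; apply/eqP/permP; by case.
have e1 : inord 1 = lift ord0 ord0 :> 'I_4 by apply: ord_inj; rewrite inordK.
have e2' : inord 2 = lift ord0 (lift ord0 ord0) :> 'I_4 by apply: ord_inj; rewrite inordK.
have e3 : inord 3 = lift ord0 (lift ord0 (lift ord0 ord0)) :> 'I_4 by apply: ord_inj; rewrite inordK.
under eq_bigr => a _ do under eq_bigr => b _ do under eq_bigr => c _ do under eq_bigr => d _ do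
  rewrite S0 e1 e2' e3 !(lift_perm_lift, lift_perm_id).
rewrite !big_ord_recl !big_ord0 /tprod /= /bump /=.
rewrite (sw l k) (sw l j) (sw l i) (sw k j) (sw k i) (sw j i).
by field.
Qed.

End Symmetrization.

(** * Quadratic remainders *)

Section QuadraticRemainder.
Variable R : realType.

Lemma is_derive_of_quadratic (f : R -> R) (s d K delta : R) : 0 < delta ->
  (forall h, `|h| <= delta -> `|f (s + h) - f s - h * d| <= K * h ^+ 2) ->
  is_derive s (1 : R) f d.
Proof.
move=> d0 hq.
have lim : h^-1 *: (f (h *: (1 : R) + s) - f s) @[h --> 0^'] --> d.
  apply/cvgrPdist_le => e e0; near=> h.
  have h0 : h != 0 by near: h; exact: nbhs_dnbhs_neq.
  have hp : 0 < `|h| by rewrite normr_gt0.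
  have hd : `|h| <= delta.
    by near: h; exact: dnbhs0_le.
  have he : `|h| <= e / (`|K| + 1).
    by near: h; apply: dnbhs0_le; rewrite divr_gt0// ltr_pwDr.
  have := hq h hd.
  rewrite /GRing.scale/= mulr1 (addrC h).
  have -> : d - h^-1 * (f (s + h) - f s) = - h^-1 * (f (s + h) - f s - h * d).
    by field.
  move=> hb; rewrite normrM normrN normfV ler_pdivrMl//.
  apply: le_trans hb _; apply: le_trans (ler_norm _) _.
  rewrite normrM normrX expr2 mulrC -mulrA ler_wpM2l//.
  move: he; rewrite ler_pdivlMr ?ltr_pwDr// mulrDr mulr1; lra.
apply: DeriveDef; last exact: cvg_lim lim.
by apply/cvg_ex; exists d.
Unshelve. all: by end_near. Qed.

Lemma is_derive_mx_lipschitz (B : R -> 'M[R]_3) (t : R) dB : is_derive t (1 : R) B dB ->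
  exists2 delta, 0 < delta & forall h, `|h| <= delta -> `|B (t + h) - B t| <= (`|dB| + 1) * `|h|.
Proof.
move=> [dv dE].
have : h^-1 *: (B (h *: (1 : R) + t) - B t) @[h --> 0^'] --> dB.
  by rewrite -dE; exact: dv.
move=> /cvgrPdist_le/(_ _ ltr01)[e /= e0 he].
exists (e / 2); first by rewrite divr_gt0.
move=> h hd; have [->|h0] := eqVneq h 0.
  by rewrite addr0 subrr !normr0 mulr0.
have hlt : `|0 - h| < e by rewrite sub0r normrN; lra.
have := he h hlt h0; rewrite /GRing.scale/= mulr1 (addrC h) => h1.
have hp : 0 < `|h| by rewrite normr_gt0.
have E : B (t + h) - B t = h *: dB - h *: (dB - h^-1 *: (B (t + h) - B t)).
  by rewrite scalerBr scalerA divff// scale1r subKr.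
rewrite {1}E; apply: le_trans (ler_normB _ _) _; rewrite !normrZ.
rewrite mulrDl mul1r lerD//; first by rewrite mulrC.
by rewrite ler_piMr.
Qed.

Lemma is_derive_along (B : R -> 'M[R]_3) (t : R) dB (F : 'M[R]_3 -> R)
    (L : 'M[R]_3 -> R) (l : 'I_3 -> 'I_3 -> R) (K delta : R) :
  (forall H, L H = \sum_i \sum_j l i j * H i j) ->
  is_derive t (1 : R) B dB -> 0 < delta ->
  (forall h, `|h| <= delta -> `|F (B (t + h)) - F (B t) - L (B (t + h) - B t)|
     <= K * `|B (t + h) - B t| ^+ 2) ->
  is_derive t (1 : R) (fun s => F (B s)) (L dB).
Proof.
move=> LE dBt delta0 hF.
have [d2 d20 hB] := is_derive_mx_lipschitz dBt.
have dL : is_derive t (1 : R) (fun s => \sum_i \sum_j l i j * B s i j) (L dB).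
  rewrite LE.
  have e1 : (fun s => \sum_i \sum_j l i j * B s i j) = 
     \sum_i \sum_j (fun s => l i j * B s i j).
    by apply/funext => s; rewrite !fct_sumE; apply: eq_bigr => i _; rewrite fct_sumE.
  rewrite e1; do 2 (apply: is_derive_sum => ?).
  apply: is_deriveZ; exact: (is_derive_mxP B t 1 dB).1.
have Lsum s : L (B s) = \sum_i \sum_j l i j * B s i j by exact: LE.
have LB X Y : L (X - Y) = L X - L Y.
  rewrite !LE -sumrB; apply: eq_bigr => i _; rewrite -sumrB; apply: eq_bigr => j _.
  by rewrite !mxE mulrBr.
pose m := Num.min delta d2.
have m0 : 0 < m by rewrite lt_min delta0.
have dR : is_derive t (1 : R) (fun s => F (B s) - L (B s)) 0.
  apply: (@is_derive_of_quadratic _ _ _ (`|K| * (`|dB| + 1) ^+ 2) m) => // h.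
  rewrite le_min => /andP[h1 h2]; rewrite mulr0 subr0.
  have := hF h h1; rewrite LB => hq.
  rewrite (_ : _ - _ = F (B (t + h)) - F (B t) - (L (B (t + h)) - L (B t))); last by ring.
  apply: le_trans hq _; apply: (@le_trans _ _ (`|K| * `|B (t + h) - B t| ^+ 2)).
    by rewrite ler_wpM2r ?exprn_ge0// ler_norm.
  rewrite -mulrA ler_wpM2l// -[h ^+ 2]real_normK ?num_real// -exprMn.
  by rewrite ler_pXn2r ?nnegrE ?mulr_ge0 ?addr_ge0// hB.
rewrite -[L dB]add0r.
have -> : (fun s => F (B s)) = (fun s => F (B s) - L (B s)) + (fun s => \sum_i \sum_j l i j * B s i j).
  by apply/funext => s; rewrite fctE Lsum subrK.
exact: is_deriveD.
Qed.

End QuadraticRemainder.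

Section Rays.
Variable R : realType.
Implicit Types (M N P B X H U : 'M[R]_3).

Lemma norm_scalar_mx (s : R) : `|(s%:M : 'M[R]_3)| <= `|s|.
Proof.
apply: mx_norm_le => // i j; rewrite mxE; case: eqP => _; rewrite ?mulr1n ?mulr0n//.
by rewrite normr0.
Qed.

Lemma inv_weight (c s : R) p : 0 < c -> 0 <= s ->
  ((c + s) ^+ p)^-1 <= (1 + c^-1) ^+ p / (1 + s) ^+ p.
Proof.
move=> c0 s0; have ci : 0 < c^-1 by rewrite invr_gt0.
have cs : 0 < c + s by lra.
have s1 : 0 < 1 + s by lra.
have e : c^-1 * c = 1 by rewrite mulVf// gt_eqF.
have key : (c + s)^-1 <= (1 + c^-1) / (1 + s).
  rewrite ler_pdivlMr// mulrC ler_pdivrMr//.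
  rewrite mulrDl mul1r mulrDr e; have : 0 <= c^-1 * s by rewrite mulr_ge0// ltW.
  lra.
have l0 : 0 <= (c + s)^-1 by rewrite invr_ge0 ltW.
have [->|p0] := posnP p; first by rewrite !expr0 divr1 invr1.
by rewrite -expr_div_n -exprVn ler_pXn2r// nnegrE// (le_trans l0).
Qed.

Lemma lipw_ray p (F : 'M[R]_3 -> R) c D : lipw p F -> 0 < c -> 0 <= D ->
  exists2 K : R, 0 <= K & forall P N (s : R), geI c P -> geI c N -> `|N - P| <= D -> 0 <= s ->
    `|F (P + s%:M)| <= K / (1 + s) ^+ p /\
    `|F (N + s%:M) - F (P + s%:M)| <= K * `|N - P| / (1 + s) ^+ p.
Proof.
move=> hF c0 D0; have [K K0 hK] := hF c D c0 D0.
have ci : 0 < c^-1 by rewrite invr_gt0.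
have k0 : 0 <= (1 + c^-1) ^+ p by rewrite exprn_ge0//; lra.
exists (K * (1 + c^-1) ^+ p); first by rewrite mulr_ge0.
move=> P N s gP gN hD s0; have w := inv_weight p c0 s0.
have e : N + s%:M - (P + s%:M) = N - P by rewrite opprD addrACA subrr addr0.
have cs : c <= c + s by lra.
have := hK (c + s) (P + s%:M) (N + s%:M) cs (geI_scalar s gP) (geI_scalar s gN).
rewrite e => /(_ hD)[h1 h2]; split.
- by apply: le_trans h1 _; rewrite -mulrA ler_wpM2l.
- apply: le_trans h2 _.
  rewrite [leRHS](_ : _ = K * `|N - P| * ((1 + c^-1) ^+ p / (1 + s) ^+ p)); last by ring.
  by rewrite ler_wpM2l// mulr_ge0.
Qed.

Lemma diffw_ray p (F : 'M[R]_3 -> R) dF c D : diffw p F dF -> 0 < c -> 0 <= D ->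
  exists2 K : R, 0 <= K & forall P N (s : R), geI c P -> geI c N -> `|N - P| <= D -> 0 <= s ->
    `|F (N + s%:M) - F (P + s%:M) - dF (P + s%:M) (N - P)| <= K * `|N - P| ^+ 2 / (1 + s) ^+ p.
Proof.
move=> hF c0 D0; have [K K0 hK] := hF c D c0 D0.
have ci : 0 < c^-1 by rewrite invr_gt0.
have k0 : 0 <= (1 + c^-1) ^+ p by rewrite exprn_ge0//; lra.
exists (K * (1 + c^-1) ^+ p); first by rewrite mulr_ge0.
move=> P N s gP gN hD s0; have w := inv_weight p c0 s0.
have e : N + s%:M - (P + s%:M) = N - P by rewrite opprD addrACA subrr addr0.
have cs : c <= c + s by lra.
have := hK (c + s) (P + s%:M) (N + s%:M) cs (geI_scalar s gP) (geI_scalar s gN).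
rewrite e => /(_ hD) h2.
apply: le_trans h2 _.
rewrite [leRHS](_ : _ = K * `|N - P| ^+ 2 * ((1 + c^-1) ^+ p / (1 + s) ^+ p)); last by ring.
by rewrite ler_wpM2l// mulr_ge0// exprn_ge0.
Qed.

Lemma geI_ray c B (s h : R) : geI c B -> 0 <= s -> `|h| <= c / 2 -> geI (c / 2) (B + (s + h)%:M).
Proof.
move=> gB s0; rewrite ler_norml => /andP[h1 h2].
apply: geI_le (geI_scalar (s + h) gB); lra.
Qed.

Lemma lipw_cont p (F : 'M[R]_3 -> R) c B : lipw p F -> 0 < c -> geI c B ->
  halfline_cont (fun s => F (B + s%:M)).
Proof.
move=> hF c0 gB s s0.
have c2 : 0 < c / 2 by rewrite divr_gt0.
have [K K0 hK] := hF (c / 2) (c / 2) c2 (ltW c2).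
have p0 : 0 < (c / 2) ^+ p by rewrite exprn_gt0.
apply/cvgrPdist_le => e e0; near=> x.
have hx : `|x - s| <= c / 2.
  by rewrite distrC; near: x; have /cvgrPdist_le := @cvg_id _ (nbhs s); exact.
have := geI_ray (h := 0) gB s0; rewrite normr0 addr0 => /(_ (ltW c2)) g1.
have := geI_ray gB s0 hx; rewrite addrCA subrr addr0 => g2.
have E : B + x%:M - (B + s%:M) = (x - s)%:M.
  by rewrite opprD addrACA subrr add0r raddfB.
have hN : `|B + x%:M - (B + s%:M)| <= c / 2.
  by rewrite E; apply: le_trans (norm_scalar_mx _) _.
have [_ ] := hK _ _ _ (lexx _) g1 g2 hN; rewrite distrC => h.
apply: le_trans h _; rewrite ler_pdivrMr//.
apply: (@le_trans _ _ ((K + 1) * `|x - s|)).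
  rewrite E ler_pM//; first by lra.
  exact: norm_scalar_mx.
rewrite mulrC -ler_pdivlMr; last by lra.
rewrite distrC; near: x; have /cvgrPdist_le := @cvg_id _ (nbhs s); apply.
by rewrite divr_gt0 ?mulr_gt0//; lra.
Unshelve. all: by end_near. Qed.

Lemma lipw_nice (F : 'M[R]_3 -> R) c B : lipw 2 F -> 0 < c -> geI c B ->
  nice (fun s => F (B + s%:M)).
Proof.
move=> hF c0 gB; split; first exact: lipw_cont hF c0 gB.
have [K K0 hK] := lipw_ray hF c0 (lexx 0); exists K => s s0.
by have [] := hK B B s gB gB; rewrite ?subrr ?normr0.
Qed.

Lemma diffw_is_derive p (F : 'M[R]_3 -> R) dF c B (s : R) : diffw p F dF ->
  (forall P (h : R), dF P h%:M = h * dF P 1%:M) ->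
  0 < c -> geI c B -> 0 <= s ->
  is_derive s (1 : R) (fun s => F (B + s%:M)) (dF (B + s%:M) 1%:M).
Proof.
move=> hF hom c0 gB s0.
have c2 : 0 < c / 2 by rewrite divr_gt0.
have [K K0 hK] := hF (c / 2) (c / 2) c2 (ltW c2).
have p0 : 0 < (c / 2) ^+ p by rewrite exprn_gt0.
apply: (@is_derive_of_quadratic _ _ _ _ (K / (c / 2) ^+ p) (c / 2)) => // h hc.
have := geI_ray (h := 0) gB s0; rewrite normr0 addr0 => /(_ (ltW c2)) g1.
have g2 := geI_ray gB s0 hc.
have E : B + (s + h)%:M - (B + s%:M) = h%:M.
  by rewrite opprD addrACA subrr add0r -raddfB addrAC subrr add0r.
have hN : `|B + (s + h)%:M - (B + s%:M)| <= c / 2.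
  by rewrite E; apply: le_trans (norm_scalar_mx _) _.
have := hK _ _ _ (lexx _) g1 g2 hN; rewrite E hom => h1.
apply: le_trans h1 _; rewrite mulrAC ler_wpM2l ?divr_ge0 ?(ltW p0)//.
by rewrite -[leRHS]real_normK ?num_real// ler_pXn2r ?nnegrE// norm_scalar_mx.
Qed.

End Rays.

(** * The tensors A(B) and C(B) *)

Section ClosureTensors.
Variable R : realType.
Implicit Types (M N P B X H U : 'M[R]_3).

Lemma lipw_ext p (F G : 'M[R]_3 -> R) : F =1 G -> lipw p F -> lipw p G.
Proof. by move=> /funext ->. Qed.

Definition Mint i j P : R := invmx P i j * rdet P.

(* The derivative of [Mint i j] at [P] in the direction [H]. *)
Definition dMint i j P H : R :=
  - (invmx P *m H *m invmx P) i j * rdet P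
  + invmx P i j * - (2^-1 * \tr (invmx P *m H) * rdet P).

Lemma lipw_Mint i j : lipw 2 (Mint i j).
Proof. by apply: (@lipwM _ 1 1); [exact: lipw_invmx|exact: lipw_rdet]. Qed.

Lemma diffw_Mint i j : diffw 2 (Mint i j) (dMint i j).
Proof.
apply: (@diffwM _ 1 1); [exact: lipw_invmx|exact: lipw_rdet|exact: diffw_invmx|exact: diffw_rdet].
Qed.

Lemma AofE B i j : Aof B i j = 2^-1 * Int (fun s => Mint i j (B + s%:M)).
Proof. by rewrite mxE. Qed.

Definition Cint i j k l P : R :=
  4^-1 * ((invmx P i j * invmx P k l + (invmx P i k * invmx P j l + invmx P i l * invmx P j k))
  * rdet P).

Lemma lipw_Cint i j k l : lipw 2 (Cint i j k l).
Proof.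
apply: lipw_weaken; apply: lipwZ; apply: (@lipwM _ 2 1); last exact: lipw_rdet.
by apply: lipwD; [|apply: lipwD]; apply: (@lipwM _ 1 1); exact: lipw_invmx.
Qed.

Lemma geI_addsc c B (s : R) : 0 <= s -> geI c B -> geI c (B + s%:M).
Proof. by move=> s0 gB; apply: geI_le (geI_scalar s gB); lra. Qed.

Lemma CofE c B i j k l : 0 < c -> geI c B -> Cof B i j k l = Int (fun s => Cint i j k l (B + s%:M)).
Proof.
move=> c0 gB; have E : Int (fun s => sym4 (tprod (invmx (B + s%:M)) (invmx (B + s%:M))) i j k l
   * rdet (B + s%:M)) = Int (fun s => 4 / 3 * Cint i j k l (B + s%:M)).
  apply: eq_Int => s s0; have [sP _] := geI_addsc s0 gB.
  by rewrite sym4_tprod /Cint; [field|exact: sym_inv].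
transitivity (3 / 4 * Int (fun s => 4 / 3 * Cint i j k l (B + s%:M))); first by rewrite -E.
by rewrite IntZ; [field|exact: lipw_nice (lipw_Cint i j k l) c0 gB].
Qed.

Lemma Cint_contract P H i j : sym_mx P -> sym_mx H ->
  \sum_(k < 3) \sum_(l < 3) Cint i j k l P * H k l = - 2^-1 * dMint i j P H.
Proof.
move=> sP sH; have sM := sym_inv sP; rewrite /Cint /dMint.
have e1 : \tr (invmx P *m H) = \sum_(k < 3) \sum_(l < 3) invmx P k l * H k l.
  rewrite /mxtrace; apply: eq_bigr => k _; rewrite mxE; apply: eq_bigr => l _.
  by rewrite -[in LHS]sH mxE.
have e2 : (invmx P *m H *m invmx P) i j = \sum_(k < 3) \sum_(l < 3) invmx P i k * invmx P j l * H k l.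
  rewrite mxE exchange_big /=; apply: eq_bigr => l _; rewrite mxE big_distrl; apply: eq_bigr => k _ /=.
  have -> : invmx P l j = invmx P j l by rewrite -[in LHS]sM mxE.
  ring.
by rewrite e1 e2; have [h1 h2 h3] := sym_swap sH; rewrite !sum3 h1 h2 h3; field.
Qed.

Lemma sym_addsc B (s : R) : sym_mx B -> sym_mx (B + s%:M).
Proof. by move=> sB; rewrite /sym_mx linearD/= tr_scalar_mx sB. Qed.

Lemma dMint_sum B H i j (s : R) : sym_mx B -> sym_mx H ->
  dMint i j (B + s%:M) H = - 2 * \sum_(k < 3) \sum_(l < 3) H k l * Cint i j k l (B + s%:M).
Proof.
move=> sB sH; have -> : \sum_(k < 3) \sum_(l < 3) H k l * Cint i j k l (B + s%:M) =
   - 2^-1 * dMint i j (B + s%:M) H.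
  rewrite -Cint_contract//; last exact: sym_addsc.
  by apply: eq_bigr => k _; apply: eq_bigr => l _; rewrite mulrC.
by field.
Qed.

Lemma nice_CintH c B H i j : 0 < c -> geI c B ->
  nice (fun s => \sum_(k < 3) \sum_(l < 3) H k l * Cint i j k l (B + s%:M)).
Proof.
move=> c0 gB; apply: nice_sum => k; apply: nice_sum => l; apply: niceZ.
exact: lipw_nice (lipw_Cint i j k l) c0 gB.
Qed.

Lemma nice_dMint c B H i j : 0 < c -> geI c B -> sym_mx H ->
  nice (fun s => dMint i j (B + s%:M) H).
Proof.
move=> c0 gB sH; have [sB _] := gB.
apply: (nice_ext _ (niceZ (- 2) (nice_CintH H i j c0 gB))) => s.
by rewrite dMint_sum.
Qed.

Lemma nice_Mint c B i j : 0 < c -> geI c B -> nice (fun s => Mint i j (B + s%:M)).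
Proof. by move=> c0 gB; exact: lipw_nice (lipw_Mint i j) c0 gB. Qed.

Lemma tcontr_CofE c B H i j : 0 < c -> geI c B -> sym_mx H ->
  tcontr (Cof B) H i j = - 2^-1 * Int (fun s => dMint i j (B + s%:M) H).
Proof.
move=> c0 gB sH; have [sB _] := gB.
have -> : (fun s => dMint i j (B + s%:M) H) =
   (fun s => - 2 * \sum_(k < 3) \sum_(l < 3) H k l * Cint i j k l (B + s%:M)).
  by apply/funext => s; exact: dMint_sum.
rewrite IntZ; last exact: nice_CintH c0 gB.
have nC k l := lipw_nice (lipw_Cint i j k l) c0 gB.
rewrite Int_sum; last by move=> k; apply: nice_sum => l; exact: niceZ.
rewrite mulrA (_ : - 2^-1 * - 2 = 1); last by field.
rewrite mul1r mxE; apply: eq_bigr => k _.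
rewrite Int_sum; last by move=> l; exact: niceZ.
apply: eq_bigr => l _; rewrite IntZ; last exact: nC.
by rewrite (CofE _ _ _ _ c0 gB) mulrC.
Qed.

Lemma Aof_frechet c D i j : 0 < c -> 0 <= D -> exists2 K : R, 0 <= K &
  forall P N, geI c P -> geI c N -> `|N - P| <= D ->
  `|Aof N i j - Aof P i j + tcontr (Cof P) (N - P) i j| <= K * `|N - P| ^+ 2.
Proof.
move=> c0 D0; have [K K0 hK] := diffw_ray (diffw_Mint i j) c0 D0.
exists K => // P N gP gN hD.
have sH : sym_mx (N - P).
  by have [sP _] := gP; have [sN _] := gN; rewrite /sym_mx linearB/= sP sN.
rewrite (tcontr_CofE _ _ c0 gP sH) !AofE mulNr -!mulrBr.
have nN := nice_Mint i j c0 gN; have nP := nice_Mint i j c0 gP.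
have nd := nice_dMint i j c0 gP sH.
have nB : nice (fun s => Mint i j (N + s%:M) - Mint i j (P + s%:M)).
  by apply: (nice_ext _ (niceD nN (niceZ (-1) nP))) => s; rewrite mulN1r.
have nR : nice (fun s => Mint i j (N + s%:M) - Mint i j (P + s%:M) - dMint i j (P + s%:M) (N - P)).
  by apply: (nice_ext _ (niceD nB (niceZ (-1) nd))) => s; rewrite mulN1r.
rewrite -IntB// -IntB// normrM ger0_norm ?invr_ge0//.
have : `|Int (fun s => Mint i j (N + s%:M) - Mint i j (P + s%:M) - dMint i j (P + s%:M) (N - P))|
   <= K * `|N - P| ^+ 2.
  by apply: norm_Int_le => // s s0; exact: hK.
set x := Int _; have := normr_ge0 x; lra.
Qed.

Lemma Aof_lip c D i j : 0 < c -> 0 <= D -> exists2 K : R, 0 <= K &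
  forall P N, geI c P -> geI c N -> `|N - P| <= D -> `|Aof N i j - Aof P i j| <= K * `|N - P|.
Proof.
move=> c0 D0; have [K K0 hK] := lipw_ray (lipw_Mint i j) c0 D0.
exists K => // P N gP gN hD.
have nN := nice_Mint i j c0 gN; have nP := nice_Mint i j c0 gP.
have nB : nice (fun s => Mint i j (N + s%:M) - Mint i j (P + s%:M)).
  by apply: (nice_ext _ (niceD nN (niceZ (-1) nP))) => s; rewrite mulN1r.
rewrite !AofE -mulrBr -IntB// normrM ger0_norm ?invr_ge0//.
have : `|Int (fun s => Mint i j (N + s%:M) - Mint i j (P + s%:M))| <= K * `|N - P|.
  by apply: norm_Int_le => // s s0; have [] := hK _ _ _ gP gN hD s0.
set x := Int _; have := normr_ge0 x; lra.
Qed.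

Lemma Cof_lip c D i j k l : 0 < c -> 0 <= D -> exists2 K : R, 0 <= K &
  forall P N, geI c P -> geI c N -> `|N - P| <= D ->
  `|Cof P i j k l| <= K /\ `|Cof N i j k l - Cof P i j k l| <= K * `|N - P|.
Proof.
move=> c0 D0; have [K K0 hK] := lipw_ray (lipw_Cint i j k l) c0 D0.
exists K => // P N gP gN hD.
have nN := lipw_nice (lipw_Cint i j k l) c0 gN.
have nP := lipw_nice (lipw_Cint i j k l) c0 gP.
have nB : nice (fun s => Cint i j k l (N + s%:M) - Cint i j k l (P + s%:M)).
  by apply: (nice_ext _ (niceD nN (niceZ (-1) nP))) => s; rewrite mulN1r.
rewrite (CofE _ _ _ _ c0 gP) (CofE _ _ _ _ c0 gN) -IntB//; split.
  by apply: norm_Int_le => // s s0; have [] := hK _ _ _ gP gN hD s0.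
by apply: norm_Int_le => // s s0; have [] := hK _ _ _ gP gN hD s0.
Qed.

Lemma dMint_hom i j P (h : R) : dMint i j P h%:M = h * dMint i j P 1%:M.
Proof.
have e : invmx P *m h%:M = h *: invmx P by rewrite mul_mx_scalar.
by rewrite /dMint mulmx1 e -scalemxAl mxtraceZ !mxE; ring.
Qed.

Lemma is_derive_Mint c B i j (s : R) : 0 < c -> geI c B -> 0 <= s ->
  is_derive s (1 : R) (fun s => Mint i j (B + s%:M)) (dMint i j (B + s%:M) 1%:M).
Proof.
move=> c0 gB s0; apply: (diffw_is_derive (diffw_Mint i j)) c0 gB s0.
exact: dMint_hom.
Qed.

Lemma is_derive_rdet c B (s : R) : 0 < c -> geI c B -> 0 <= s ->
  is_derive s (1 : R) (fun s => rdet (B + s%:M))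
    (- (2^-1 * \tr (invmx (B + s%:M)) * rdet (B + s%:M))).
Proof.
move=> c0 gB s0; have := diffw_is_derive (@diffw_rdet R) _ c0 gB s0.
rewrite mulmx1; apply=> P h; rewrite mulmx1 mul_mx_scalar mxtraceZ; ring.
Qed.

Lemma ray_cvg0 p (F : 'M[R]_3 -> R) c B : lipw p.+1 F -> 0 < c -> geI c B ->
  F (B + s%:M) @[s --> +oo] --> 0.
Proof.
move=> hF c0 gB.
have {}hF : lipw 1 F by elim: p hF => [//|p IH] h; apply: IH; exact: lipw_weaken.
have [K K0 hK] := lipw_ray hF c0 (lexx 0).
apply: (@cvg_pinfty0 _ _ K) => s s0; rewrite -[X in _ <= _ / X]expr1.
by have [] := hK B B s gB gB; rewrite ?subrr ?normr0.
Qed.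

Theorem trace_Aof B : posdef B -> \tr (Aof B) = rdet B.
Proof.
move=> /posdef_exists_geI[c c0 gB].
have nM i := nice_Mint i i c0 gB.
have nS : nice (fun s => 2^-1 * \sum_(i < 3) Mint i i (B + s%:M)).
  by apply: niceZ; exact: nice_sum.
have -> : \tr (Aof B) = Int (fun s => 2^-1 * \sum_(i < 3) Mint i i (B + s%:M)).
  rewrite IntZ; last exact: nice_sum.
  by rewrite Int_sum// mulr_sumr; apply: eq_bigr => i _; rewrite AofE.
pose F (s : R) := - rdet (B + s%:M).
have dF (s : R) : 0 <= s -> is_derive s (1 : R) F (2^-1 * \sum_(i < 3) Mint i i (B + s%:M)).
  move=> s0; have := is_deriveN (is_derive_rdet c0 gB s0).
  by rewrite opprK /mxtrace -mulrA mulr_suml.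
have Fl : F s @[s --> +oo] --> 0.
  by rewrite -oppr0; apply: cvgN; exact: ray_cvg0 (@lipw_rdet R) c0 gB.
rewrite (Int_is_derive nS dF Fl) /F.
by rewrite sub0r opprK (_ : 0%:M = 0 :> 'M[R]_3) ?addr0// raddf0.
Qed.

Lemma trace_sandwich (M H : 'M[R]_3) : \tr (M *m H *m M) = \tr (M *m M *m H).
Proof. by rewrite mxtrace_mulC mulmxA. Qed.

Theorem trace_Cof B H : posdef B -> sym_mx H ->
  \tr (tcontr (Cof B) H) = 2^-1 * rdet B * \tr (invmx B *m H).
Proof.
move=> /posdef_exists_geI[c c0 gB] sH.
have nd i := nice_dMint i i c0 gB sH.
have nS : nice (fun s => - 2^-1 * \sum_(i < 3) dMint i i (B + s%:M) H).
  by apply: niceZ; exact: nice_sum.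
have -> : \tr (tcontr (Cof B) H) = Int (fun s => - 2^-1 * \sum_(i < 3) dMint i i (B + s%:M) H).
  rewrite IntZ; last exact: nice_sum.
  by rewrite Int_sum// mulr_sumr; apply: eq_bigr => i _; rewrite (tcontr_CofE _ _ c0 gB sH).
pose F (s : R) := - 2^-1 * \sum_(k < 3) \sum_(l < 3) H l k * Mint k l (B + s%:M).
have dF (s : R) : 0 <= s ->
    is_derive s (1 : R) F (- 2^-1 * \sum_(i < 3) dMint i i (B + s%:M) H).
  move=> s0; rewrite /F.
  have -> : \sum_(i < 3) dMint i i (B + s%:M) H =
      \sum_(k < 3) \sum_(l < 3) H l k * dMint k l (B + s%:M) 1%:M.
    set P := B + s%:M; set M := invmx P; rewrite /dMint -/M !mulmx1.
    transitivity (- \tr (M *m H *m M) * rdet P - \tr M * (2^-1 * \tr (M *m H) * rdet P)).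
      by rewrite /mxtrace !sum3; ring.
    transitivity (- \tr (M *m M *m H) * rdet P - \tr (M *m H) * (2^-1 * \tr M * rdet P)).
      by rewrite trace_sandwich; ring.
    rewrite [\tr (M *m M *m H)](_ : _ = \sum_(k < 3) \sum_(l < 3) (M *m M) k l * H l k); last first.
      by apply: eq_bigr => k _; rewrite mxE.
    rewrite [\tr (M *m H)](_ : _ = \sum_(k < 3) \sum_(l < 3) M k l * H l k); last first.
      by apply: eq_bigr => k _; rewrite mxE.
    by rewrite !sum3; ring.
  have -> : (fun s : R => - 2^-1 * \sum_(k < 3) \sum_(l < 3) H l k * Mint k l (B + s%:M)) =
     - 2^-1 \*: \sum_(k < 3) \sum_(l < 3) (fun s : R => H l k * Mint k l (B + s%:M)).
    by apply/funext => x; congr (_ * _); rewrite !fct_sumE; apply: eq_bigr => k _; rewrite fct_sumE.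
  apply: is_deriveZ; do 2 (apply: is_derive_sum => ?).
  by apply: is_deriveZ; exact: is_derive_Mint c0 gB s0.
have Fl : F s @[s --> +oo] --> 0.
  have lF : lipw 2 (fun P => - 2^-1 * \sum_(k < 3) \sum_(l < 3) H l k * Mint k l P).
    apply: lipwZ; have h k : lipw 2 (fun P => \sum_(l < 3) H l k * Mint k l P).
      apply: (lipw_ext (F := fun P => H i0 k * Mint k i0 P + H i1 k * Mint k i1 P + H i2 k * Mint k i2 P)).
        by move=> P /=; rewrite [RHS]sum3.
      by do 2 (apply: lipwD; last by apply: lipwZ; exact: lipw_Mint); apply: lipwZ; exact: lipw_Mint.
    apply: (lipw_ext (F := fun P => \sum_(l < 3) H l i0 * Mint i0 l P
       + \sum_(l < 3) H l i1 * Mint i1 l P + \sum_(l < 3) H l i2 * Mint i2 l P)).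
      by move=> P /=; rewrite [RHS]sum3.
    by do 2 (apply: lipwD; last exact: h); exact: h.
  exact: ray_cvg0 lF c0 gB.
rewrite (Int_is_derive nS dF Fl) /F (_ : 0%:M = 0 :> 'M[R]_3) ?raddf0// addr0.
have -> : \tr (invmx B *m H) = \sum_(k < 3) \sum_(l < 3) invmx B k l * H l k.
  by apply: eq_bigr => k _; rewrite mxE.
by rewrite /Mint !sum3; ring.
Qed.

End ClosureTensors.

Section ClosureIdentities.
Variable R : realType.
Implicit Types (M N P B X H U : 'M[R]_3).

Lemma dMint_self i j P : posdef P -> dMint i j P P = - (5 / 2) * Mint i j P.
Proof.
move=> pP; have uP := posdef_unit pP.
by rewrite /dMint /Mint mulVmx// mul1mx mxtrace1; field.
Qed.

Lemma dMint_shift i j P (s : R) : dMint i j P (P - s%:M) = dMint i j P P - s * dMint i j P 1%:M.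
Proof.
rewrite -dMint_hom /dMint !mulmxBr !mulmxBl [\tr (_ - _)]linearB/=.
have e (X Y : 'M[R]_3) : (X - Y) i j = X i j - Y i j by rewrite !mxE.
by rewrite e; ring.
Qed.

Theorem Cof_self B : posdef B -> tcontr (Cof B) B = (3 / 2) *: Aof B.
Proof.
move=> /posdef_exists_geI[c c0 gB]; have [sB _] := gB; apply/matrixP => i j.
rewrite [RHS]mxE (tcontr_CofE _ _ c0 gB sB) AofE.
have nM := nice_Mint i j c0 gB; have nd := nice_dMint i j c0 gB sB.
pose f (s : R) := - 2^-1 * dMint i j (B + s%:M) B + - (3 / 4) * Mint i j (B + s%:M).
have nf : nice f by apply: niceD; exact: niceZ.
pose F (s : R) := 2^-1 * (s * Mint i j (B + s%:M)).
have dF (s : R) : 0 <= s -> is_derive s (1 : R) F (f s).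
  move=> s0; have h := is_derive_Mint i j c0 gB s0.
  have pP := geI_posdef c0 (geI_addsc s0 gB).
  have E : f s = 2^-1 *: (s *: dMint i j (B + s%:M) 1%:M + Mint i j (B + s%:M) *: 1).
    have e : B = B + s%:M - s%:M by rewrite addrK.
    by rewrite /f {2}e dMint_shift dMint_self// /GRing.scale/=; field.
  by rewrite E; apply: is_deriveZ; apply: is_deriveM.
have Fl : F s @[s --> +oo] --> 0.
  have [K K0 hK] := lipw_ray (lipw_Mint i j) c0 (lexx 0).
  apply: (@cvg_pinfty0 _ _ K) => s s0.
  have [] := hK B B s gB gB _ s0; rewrite ?subrr ?normr0// => h _.
  have s1 : 0 < 1 + s by lra.
  rewrite /F 2!normrM (ger0_norm s0) ger0_norm ?invr_ge0//.
  apply: (@le_trans _ _ (1 * ((1 + s) * (K / (1 + s) ^+ 2)))).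
    rewrite ler_pM ?invr_ge0 ?mulr_ge0//; first by lra.
    by apply: ler_pM => //; lra.
  by rewrite le_eqVlt; apply/orP; left; apply/eqP; field; rewrite gt_eqF.
have := Int_is_derive nf dF Fl; rewrite /F mul0r mulr0 subr0.
rewrite /f IntD; try exact: niceZ.
rewrite !IntZ//; lra.
Qed.

Lemma nice_sum2 (f : 'I_3 -> 'I_3 -> R -> R) (x : 'I_3 -> 'I_3 -> R) :
  (forall i j, nice (f i j)) -> nice (fun s => \sum_(i < 3) \sum_(j < 3) x i j * f i j s).
Proof. by move=> h; apply: nice_sum => i; apply: nice_sum => j; exact: niceZ. Qed.

Lemma Int_sum2 (f : 'I_3 -> 'I_3 -> R -> R) (x : 'I_3 -> 'I_3 -> R) :
  (forall i j, nice (f i j)) ->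
  Int (fun s => \sum_(i < 3) \sum_(j < 3) x i j * f i j s) =
  \sum_(i < 3) \sum_(j < 3) x i j * Int (f i j).
Proof.
move=> h; rewrite Int_sum; last by move=> i; apply: nice_sum => j; exact: niceZ.
apply: eq_bigr => i _; rewrite Int_sum; last by move=> j; exact: niceZ.
by apply: eq_bigr => j _; rewrite IntZ.
Qed.

Lemma mxtrace_mulE M X : \tr (M *m X) = \sum_(i < 3) \sum_(j < 3) X j i * M i j.
Proof.
by apply: eq_bigr => i _; rewrite mxE; apply: eq_bigr => j _; rewrite mulrC.
Qed.

Lemma trace_Aof_mul c B X : 0 < c -> geI c B ->
  let f (s : R) := 2^-1 * (\tr (invmx (B + s%:M) *m X) * rdet (B + s%:M)) in
  nice f /\ \tr (Aof B *m X) = Int f.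
Proof.
move=> c0 gB f; have nM i j := nice_Mint i j c0 gB.
pose g (s : R) := \sum_(i < 3) \sum_(j < 3) X j i * Mint i j (B + s%:M).
have E s : 2^-1 * g s = f s.
  rewrite /g /f mxtrace_mulE mulr_suml; congr (_ * _); apply: eq_bigr => i _.
  by rewrite mulr_suml; apply: eq_bigr => j _; rewrite mulrA.
have ng : nice g by exact: nice_sum2.
split; first exact: (nice_ext E (niceZ _ ng)).
rewrite -(eq_Int (fun s _ => E s)) IntZ// mxtrace_mulE Int_sum2// mulr_sumr.
apply: eq_bigr => i _; rewrite mulr_sumr; apply: eq_bigr => j _.
by rewrite AofE; ring.
Qed.

Lemma trace_Cof_mul c B H X : 0 < c -> geI c B -> sym_mx H ->
  let f (s : R) := let M := invmx (B + s%:M) in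
    (2^-1 * \tr (M *m H *m M *m X) + 4^-1 * (\tr (M *m H) * \tr (M *m X))) * rdet (B + s%:M) in
  nice f /\ \tr (tcontr (Cof B) H *m X) = Int f.
Proof.
move=> c0 gB sH f; have nd i j := nice_dMint i j c0 gB sH.
pose g (s : R) := \sum_(i < 3) \sum_(j < 3) X j i * dMint i j (B + s%:M) H.
have E s : - 2^-1 * g s = f s.
  rewrite /g /f /= /dMint; set P := B + s%:M; set M := invmx P.
  by rewrite (mxtrace_mulE (M *m H *m M)) (mxtrace_mulE M X) !sum3; field.
have ng : nice g by exact: nice_sum2.
split; first exact: (nice_ext E (niceZ _ ng)).
rewrite -(eq_Int (fun s _ => E s)) IntZ// mxtrace_mulE Int_sum2// mulr_sumr.
apply: eq_bigr => i _; rewrite mulr_sumr; apply: eq_bigr => j _.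
by rewrite (tcontr_CofE _ _ c0 gB sH); ring.
Qed.

Lemma Cof_symmetric B H X : posdef B -> sym_mx H -> sym_mx X ->
  \tr (tcontr (Cof B) H *m X) = \tr (tcontr (Cof B) X *m H).
Proof.
move=> /posdef_exists_geI[c c0 gB] sH sX.
have [_ ->] := trace_Cof_mul X c0 gB sH; have [_ ->] := trace_Cof_mul H c0 gB sX.
apply: eq_Int => s s0 /=; congr (_ * _); congr (_ * _ + _ * _); last exact: mulrC.
by rewrite -mulmxA mxtrace_mulC mulmxA.
Qed.

Lemma tcontrD T H X : tcontr T (H + X) = tcontr T H + tcontr T X.
Proof.
apply/matrixP => i j; rewrite !mxE -big_split; apply: eq_bigr => k _.
by rewrite -big_split; apply: eq_bigr => l _; rewrite !mxE mulrDr.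
Qed.

Lemma tcontrZ T (a : R) H : tcontr T (a *: H) = a *: tcontr T H.
Proof.
apply/matrixP => i j; rewrite !mxE mulr_sumr; apply: eq_bigr => k _.
by rewrite mulr_sumr; apply: eq_bigr => l _; rewrite !mxE mulrCA.
Qed.

Lemma rdet_lower P (k : R) : posdef P -> 1 <= k -> `|P| <= k -> (3 * k ^+ 2)^-1 <= rdet P.
Proof.
move=> pP k1 hk; have k0 : 0 < k by lra.
have d0 := posdef_det pP.
rewrite /rdet lef_pV2 ?posrE ?sqrtr_gt0// ?mulr_gt0 ?exprn_gt0//.
have h0 : 0 <= 3 * k ^+ 2 by rewrite mulr_ge0// exprn_ge0// ltW.
rewrite -[leRHS]ger0_norm// -sqrtr_sqr ler_wsqrtr//.
apply: le_trans (ler_norm _) _; apply: le_trans (norm_det _) _.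
apply: (@le_trans _ _ (6 * k ^+ 3)).
  by rewrite ler_wpM2l// ler_pXn2r// nnegrE// ltW.
rewrite exprMn -exprM; have h3 : 0 < k ^+ 3 by rewrite exprn_gt0.
rewrite (_ : k ^+ (2 * 2) = k * k ^+ 3); last by rewrite -exprS.
by rewrite expr2; nra.
Qed.

Lemma norm_ray_le B (s : R) : 0 <= s -> `|B + s%:M| <= (`|B| + 1) * (1 + s).
Proof.
move=> s0; apply: le_trans (ler_normD _ _) _.
have := norm_scalar_mx s; rewrite (ger0_norm s0) => h.
have := normr_ge0 B; nra.
Qed.

Lemma qf_trace M (v : 'cV[R]_3) : qf M v = \tr (M *m (v *m v^T)).
Proof.
rewrite mulmxA mxtrace_mulC mulmxA.
by rewrite /qf /mxtrace big_ord_recl big_ord0 addr0.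
Qed.

Lemma posdef_inv P : posdef P -> posdef (invmx P).
Proof.
move=> pP; have uP := posdef_unit pP; have [sP hP] := pP; split; first exact: sym_inv.
move=> w w0; have e : (w^T *m invmx P *m w) = ((invmx P *m w)^T *m P *m (invmx P *m w)).
  by rewrite trmx_mul (sym_inv sP) -!mulmxA mulKVmx.
rewrite e; apply: hP; apply: contra w0 => /eqP h.
by rewrite -(mulKVmx uP w) h mulmx0.
Qed.

Theorem Aof_posdef B : posdef B -> posdef (Aof B).
Proof.
move=> pB; have [c c0 gB] := posdef_exists_geI pB; split.
  apply/matrixP => i j; rewrite mxE !AofE; congr (_ * _); apply: eq_Int => s s0.
  have [sP _] := geI_addsc s0 gB; congr (_ * _).
  by rewrite -[in LHS](sym_inv sP) mxE.
move=> v v0; rewrite -/(qf _ v) qf_trace.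
have [nf ->] := trace_Aof_mul (v *m v^T) c0 gB.
set k := `|B| + 1; have k1 : 1 <= k by rewrite lerDr.
have [n4 I4] := @Int_inv4 R.
pose a := 2^-1 * ((3 * k)^-1 * sq v * (3 * k ^+ 2)^-1).
have a0 : 0 < a by rewrite !mulr_gt0 ?invr_gt0 ?mulr_gt0 ?exprn_gt0 ?sq_gt0//; lra.
apply: (@lt_le_trans _ _ (a * Int (fun s => 1 / (1 + s) ^+ 4))); first exact: mulr_gt0.
rewrite -IntZ//; apply: le_Int => //; first exact: niceZ.
move=> s s0; rewrite /a -[leLHS]mulrA ler_wpM2l ?invr_ge0// -qf_trace.
have gP := geI_addsc s0 gB; have pP := geI_posdef c0 gP; have uP := posdef_unit pP.
have s1 : 1 <= 1 + s by lra.
have ks : 1 <= k * (1 + s) by nra.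
have hP := norm_ray_le B s0; rewrite -/k in hP.
have pM := posdef_inv pP.
have gM := posdef_geI pM (lt_le_trans ltr01 ks).
rewrite invmxK in gM; have [_ hM] := gM hP.
have hr := rdet_lower pP ks hP.
have sv := sq_ge0 v.
apply: (@le_trans _ _ (((3 * (k * (1 + s)))^-1 * sq v) * (3 * (k * (1 + s)) ^+ 2)^-1)).
  set t := (3 * k)^-1 * sq v * (3 * k ^+ 2)^-1.
  have t0 : 0 <= t by rewrite !mulr_ge0 ?invr_ge0 ?mulr_ge0 ?exprn_ge0//; lra.
  rewrite [leRHS](_ : _ = t * (1 / (1 + s) ^+ 3)); last first.
    by rewrite /t; field; rewrite !gt_eqF//; lra.
  rewrite ler_wpM2l// !div1r lef_pV2 ?posrE ?exprn_gt0//; try lra.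
  by rewrite ler_weXn2l.
have p1 : 0 <= (3 * (k * (1 + s)))^-1 * sq v by rewrite mulr_ge0// invr_ge0; lra.
have p2 : 0 <= (3 * (k * (1 + s)) ^+ 2)^-1.
  by rewrite invr_ge0 mulr_ge0// exprn_ge0//; lra.
exact: ler_pM.
Qed.

Theorem Cof_coercive B H : posdef B -> sym_mx H ->
  `|H| ^+ 2 * Int (fun s => 1 / (1 + s) ^+ 4) <=
    486 * (`|B| + 1) ^+ 4 * \tr (tcontr (Cof B) H *m H).
Proof.
move=> pB sH; have [c c0 gB] := posdef_exists_geI pB.
have [nf ->] := trace_Cof_mul H c0 gB sH.
have [n4 _] := @Int_inv4 R.
rewrite -!IntZ//; apply: le_Int => [||s s0 /=]; [exact: niceZ|exact: niceZ|].
set k := `|B| + 1; have k1 : 1 <= k by rewrite lerDr.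
have gP := geI_addsc s0 gB; have pP := geI_posdef c0 gP.
have s1 : 1 <= 1 + s by lra.
have ks : 1 <= k * (1 + s) by nra.
have hP := norm_ray_le B s0; rewrite -/k in hP.
have hr := rdet_lower pP ks hP.
have hs := trace_sandwich_ge pP sH.
set P := B + s%:M in hP hr hs pP *; set M := invmx P in hs *.
set T := \tr (M *m H *m M *m H) in hs *.
have hH : `|H| ^+ 2 <= 81 * (k * (1 + s)) ^+ 2 * T.
  have T0 : 0 <= T.
    have P0 : 0 < 81 * `|P| ^+ 2.
      rewrite mulr_gt0// exprn_gt0//; apply: lt_le_trans (posdef_diag i0 pP) _.
      by apply: le_trans (ler_norm _) _; exact: mx_entry_le.
    by rewrite -(pmulr_rge0 _ P0); apply: le_trans hs; exact: sqr_ge0.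
  apply: le_trans hs _; rewrite ler_wpM2r// ler_wpM2l// ler_pXn2r// nnegrE//.
  by lra.
have k0 : 0 < k by lra.
have s10 : 0 < 1 + s by lra.
set x := (k * (1 + s)) ^+ 2 in hH hr.
have x0 : 0 < x by rewrite exprn_gt0// mulr_gt0.
have hT : `|H| ^+ 2 / (81 * x) <= T by rewrite ler_pdivrMr ?mulr_gt0// mulrC.
have E : `|H| ^+ 2 * (1 / (1 + s) ^+ 4) = 486 * k ^+ 4 * ((2^-1 * (`|H| ^+ 2 / (81 * x))) * (3 * x)^-1).
  by rewrite /x; field; rewrite !gt_eqF.
rewrite E; apply: ler_wpM2l; first exact: mulr_ge0 (ler0n _ _) (exprn_ge0 _ (ltW k0)).
apply: ler_pM => //.
- by rewrite mulr_ge0 ?invr_ge0// divr_ge0 ?exprn_ge0// mulr_ge0// ltW.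
- by rewrite invr_ge0 mulr_ge0// ltW.
- have := sqr_ge0 (\tr (M *m H)); rewrite expr2 => ht; lra.
Qed.

End ClosureIdentities.

(** * The Lyapunov function *)

Section AofTimesB.
Variable R : realType.
Implicit Types (M N P B X H U : 'M[R]_3).

Lemma mxtrace_inj M N : (forall X, \tr (M *m X) = \tr (N *m X)) -> M = N.
Proof.
have h (Y : 'M[R]_3) (i j : 'I_3) : \tr (Y *m delta_mx j i) = Y i j :> R.
  rewrite mxtrace_mulE (bigD1 i)//= (bigD1 j)//= !mxE !eqxx mul1r.
  rewrite !big1 ?addr0// => [k ki|k kj].
    by apply: big1 => l _; rewrite mxE (negbTE ki) andbF mul0r.
  by rewrite mxE (negbTE kj) mul0r.
by move=> E; apply/matrixP => i j; rewrite -!h E.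
Qed.

Lemma invmx_ray B (s : R) : posdef (B + s%:M) ->
  invmx (B + s%:M) *m B = 1%:M - s *: invmx (B + s%:M) /\
  B *m invmx (B + s%:M) = 1%:M - s *: invmx (B + s%:M).
Proof.
move=> pP; have uP := posdef_unit pP.
have e : B = B + s%:M - s%:M by rewrite addrK.
split; first by rewrite {2}e mulmxBr mulVmx// mul_mx_scalar.
by rewrite {1}e mulmxBl mulmxV// mul_scalar_mx.
Qed.

Lemma Aof_comm B : posdef B -> Aof B *m B = B *m Aof B.
Proof.
move=> /posdef_exists_geI[c c0 gB]; apply: mxtrace_inj => X.
rewrite -[X in \tr X = _]mulmxA.
have -> : \tr (B *m Aof B *m X) = \tr (Aof B *m (X *m B)).
  by rewrite -mulmxA mxtrace_mulC mulmxA.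
have [_ ->] := trace_Aof_mul (B *m X) c0 gB; have [_ ->] := trace_Aof_mul (X *m B) c0 gB.
apply: eq_Int => s s0; congr (_ * (_ * _)).
have [h1 h2] := invmx_ray (geI_posdef c0 (geI_addsc s0 gB)).
rewrite mulmxA h1; set M := invmx _.
by rewrite mulmxA (mxtrace_mulC (M *m X)) mulmxA h2.
Qed.

Definition psd P := sym_mx P /\ forall v, 0 <= qf P v.

Lemma posdef_psd P : posdef P -> psd P.
Proof.
move=> [sP hP]; split => // v; have [->|v0] := eqVneq v 0; last exact/ltW/hP.
by rewrite /qf mulmx0 mxE.
Qed.

Lemma qf_sandwich M X v : sym_mx M -> qf (M *m X *m M) v = qf X (M *m v).
Proof. by move=> sM; rewrite /qf trmx_mul sM !mulmxA. Qed.

Lemma qf_sqr B v : sym_mx B -> qf (B *m B) v = sq (B *m v).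
Proof. by move=> sB; rewrite /qf /sq trmx_mul sB !mulmxA. Qed.

Lemma psd_AofB B : posdef B -> psd (Aof B *m B).
Proof.
move=> pB; have [c c0 gB] := posdef_exists_geI pB.
have [sA _] := Aof_posdef pB; have [sB _] := pB; split.
  by rewrite /sym_mx trmx_mul sA sB Aof_comm.
move=> v; rewrite qf_trace -mulmxA.
have [nf ->] := trace_Aof_mul (B *m (v *m v^T)) c0 gB.
rewrite -(@Int0 R); apply: le_Int => //; first exact: nice0.
move=> s s0; have gP := geI_addsc s0 gB; have pP := geI_posdef c0 gP.
have -> : \tr (invmx (B + s%:M) *m (B *m (v *m v^T))) = qf (invmx (B + s%:M) *m B) v.
  by rewrite qf_trace; congr (\tr _); exact: mulmxA.
rewrite mulr_ge0 ?invr_ge0// mulr_ge0//; last exact/ltW/rdet_gt0.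
have uP := posdef_unit pP; set P := B + s%:M in pP uP *.
have -> : invmx P *m B = invmx P *m (B *m P) *m invmx P.
  by rewrite -!mulmxA mulmxV// mulmx1.
rewrite qf_sandwich; last by apply: sym_inv; case: pP.
rewrite /P mulmxDr mul_mx_scalar qfD qfZ qf_sqr// addr_ge0 ?sq_ge0// mulr_ge0//.
by have [_] := posdef_psd pB.
Qed.

Lemma psd_entries P : psd P -> [/\ 0 <= P i0 i0, 0 <= P i1 i1, 0 <= P i2 i2 &
  [/\ `|P i0 i1| <= (P i0 i0 + P i1 i1) / 2, `|P i0 i2| <= (P i0 i0 + P i2 i2) / 2
    & `|P i1 i2| <= (P i1 i1 + P i2 i2) / 2]].
Proof.
move=> [sP h]; have q a b c := h (col3 a b c).
have q1 := q 1 0 0; have q2 := q 0 1 0; have q3 := q 0 0 1.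
have q4 := q 1 1 0; have q5 := q 1 (-1) 0; have q6 := q 1 0 1; have q7 := q 1 0 (-1).
have q8 := q 0 1 1; have q9 := q 0 1 (-1).
move: q1 q2 q3 q4 q5 q6 q7 q8 q9; rewrite !qf3// !col3E !ler_norml.
move=> q1 q2 q3 q4 q5 q6 q7 q8 q9; split; try lra.
by split; apply/andP; split; lra.
Qed.

Lemma psd_trace_mul_le P X : psd P -> `|\tr (P *m X)| <= 3 * `|X| * \tr P.
Proof.
move=> pP; have [p0 p1 p2 [h1 h2 h3]] := psd_entries pP; have [sP _] := pP.
have [e1 e2 e3] := sym_swap sP.
have b i j (a : R) : `|P i j| <= a -> `|X j i * P i j| <= `|X| * a.
  by move=> ha; rewrite normrM ler_pM// mx_entry_le.
have d i : 0 <= P i i -> `|P i i| <= P i i by move=> ?; rewrite ger0_norm.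
have c00 := b i0 i0 _ (d _ p0); have c11 := b i1 i1 _ (d _ p1); have c22 := b i2 i2 _ (d _ p2).
have c01 := b _ _ _ h1; have c02 := b _ _ _ h2; have c12 := b _ _ _ h3.
have c10 := b i1 i0 _; rewrite e1 in c10; have {}c10 := c10 _ h1.
have c20 := b i2 i0 _; rewrite e2 in c20; have {}c20 := c20 _ h2.
have c21 := b i2 i1 _; rewrite e3 in c21; have {}c21 := c21 _ h3.
rewrite mxtrace_mulE mxtrace3 !sum3 e1 e2 e3.
move: c00 c11 c22 c01 c02 c12 c10 c20 c21; rewrite !ler_norml.
set x := `|X|; clearbody x.
by move=> /andP[? ?] /andP[? ?] /andP[? ?] /andP[? ?] /andP[? ?] /andP[? ?] /andP[? ?]
   /andP[? ?] /andP[? ?]; apply/andP; split; lra.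
Qed.

Lemma posdef_e2 B : posdef B -> 0 < e2 B /\ 2 * \tr B * \det B <= e2 B ^+ 2.
Proof.
move=> pB; have [sB _] := pB; have [e10 e20 e21] := sym_swap sB.
have q a b c h : 0 < _ := @posdef_col3 R B a b c pB h.
have p0 := posdef_diag i0 pB; have p1 := posdef_diag i1 pB.
have m1 : 0 < B i0 i0 * B i1 i1 - B i0 i1 ^+ 2.
  have := q (- B i0 i1) (B i0 i0) 0; rewrite (gt_eqF p0) orbT => /(_ isT).
  rewrite qf3// !col3E (_ : _ + _ = B i0 i0 * (B i0 i0 * B i1 i1 - B i0 i1 ^+ 2)); last ring.
  by rewrite pmulr_rgt0.
have m2 : 0 < B i0 i0 * B i2 i2 - B i0 i2 ^+ 2.
  have := q (- B i0 i2) 0 (B i0 i0); rewrite (gt_eqF p0) !orbT => /(_ isT).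
  rewrite qf3// !col3E (_ : _ + _ = B i0 i0 * (B i0 i0 * B i2 i2 - B i0 i2 ^+ 2)); last ring.
  by rewrite pmulr_rgt0.
have m3 : 0 < B i1 i1 * B i2 i2 - B i1 i2 ^+ 2.
  have := q 0 (- B i1 i2) (B i1 i1); rewrite (gt_eqF p1) !orbT => /(_ isT).
  rewrite qf3// !col3E (_ : _ + _ = B i1 i1 * (B i1 i1 * B i2 i2 - B i1 i2 ^+ 2)); last ring.
  by rewrite pmulr_rgt0.
rewrite /e2 e10 e20 e21; split; first by rewrite -!expr2; lra.
rewrite mxtrace3 det3 e10 e20 e21 -subr_ge0.
set a := B i0 i0; set b := B i1 i1; set c := B i2 i2.
set x := B i0 i1; set y := B i0 i2; set z := B i1 i2.
rewrite (_ : _ - _ = (a * b - x ^+ 2) ^+ 2 + (a * c - y ^+ 2) ^+ 2 + (b * c - z ^+ 2) ^+ 2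
  + 2 * (y * x - a * z) ^+ 2 + 2 * (x * z - b * y) ^+ 2 + 2 * (y * z - c * x) ^+ 2); last by ring.
by repeat first [exact: sqr_ge0 | done | apply: addr_ge0 | apply: mulr_ge0].
Qed.

End AofTimesB.

Section TraceBound.
Variable R : realType.

(* Majorizes [1 / sqrt (det (B + s I))] by [4 / (sqrt sg * w * (1 + w)^(3/2))], whose
   primitive is elementary; [D] stands for [det (B + s I)]. *)
Lemma cubic_lower (sg s w D : R) : 1 <= sg -> 0 <= s -> 0 < w -> w ^+ 2 = s + sg^-1 ->
  s ^+ 3 + sg ^+ 2 * s ^+ 2 + sg * s + 1 <= D ->
  sg * w ^+ 2 * (1 + w) ^+ 3 <= 16 * D.
Proof.
move=> sg1 s0 w0 w2 hD.
have sg0 : 0 < sg by lra.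
pose p := 1 + sg * s.
have pE : sg * w ^+ 2 = p by rewrite w2 mulrDr mulfV ?gt_eqF// /p addrC.
have s3 : 0 <= s ^+ 3 by rewrite exprn_ge0.
have ss : 0 <= sg * s by rewrite mulr_ge0// ltW.
have ss2 : 0 <= sg ^+ 2 * s ^+ 2 by rewrite mulr_ge0// sqr_ge0.
have h1 : p <= D by rewrite /p; lra.
have h2 : p ^+ 2 <= 2 * D.
  rewrite (_ : p ^+ 2 = 1 + 2 * (sg * s) + sg ^+ 2 * s ^+ 2); last by rewrite /p; ring.
  lra.
have i1 : 0 < sg^-1 <= 1 by rewrite invr_gt0 sg0 invf_le1.
have h3 : (w ^+ 3) ^+ 2 <= 4 * D.
  rewrite -exprM mulnC exprM w2.
  have [i10 i11] := andP i1; set i := sg^-1 in i10 i11 *.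
  have i3 : i ^+ 3 <= 1 by rewrite exprn_ile1// ltW.
  have : (s + i) ^+ 3 <= 4 * (s ^+ 3 + i ^+ 3).
    rewrite -subr_ge0 (_ : _ - _ = 3 * (s + i) * (s - i) ^+ 2); last by ring.
    by rewrite mulr_ge0 ?sqr_ge0// mulr_ge0//; lra.
  lra.
have h4 : (1 + w) ^+ 3 <= 4 * (1 + w ^+ 3).
  rewrite -subr_ge0 (_ : _ - _ = 3 * (1 + w) * (1 - w) ^+ 2); last by ring.
  by rewrite mulr_ge0 ?sqr_ge0// mulr_ge0//; lra.
have p0 : 0 < p by rewrite /p; lra.
rewrite pE; apply: (@le_trans _ _ (p * (4 * (1 + w ^+ 3)))); first by rewrite ler_pM2l.
have := sqr_ge0 (p - w ^+ 3).
rewrite (_ : (p - w ^+ 3) ^+ 2 = p ^+ 2 - 2 * (p * w ^+ 3) + (w ^+ 3) ^+ 2); last by ring.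
rewrite (_ : p * (4 * (1 + w ^+ 3)) = 4 * p + 4 * (p * w ^+ 3)); last by ring.
lra.
Qed.

Definition Gprim (k e s : R) : R := - k * (Num.sqrt (1 + Num.sqrt (s + e)))^-1.

Lemma is_derive_Gprim (k e s : R) : 0 < e -> 0 <= s ->
  let w := Num.sqrt (s + e) in let q := Num.sqrt (1 + w) in
  is_derive s (1 : R) (Gprim k e) (k / (4 * w * q ^+ 3)).
Proof.
move=> e0 s0 w q.
have w0 : 0 < w by rewrite sqrtr_gt0; lra.
have q0 : 0 < q by rewrite sqrtr_gt0; lra.
have d1 : is_derive s (1 : R) (fun s => Num.sqrt (s + e)) ((2 * w)^-1 * 1).
  apply: (is_derive1_comp (f := Num.sqrt) (g := fun s => s + e)).
    by apply: is_derive1_sqrt; lra.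
  by apply: is_derive_eq; rewrite addr0.
have d2 : is_derive s (1 : R) (fun s => Num.sqrt (1 + Num.sqrt (s + e))) ((2 * q)^-1 * (2 * w)^-1).
  apply: (is_derive1_comp (f := Num.sqrt) (g := fun s => 1 + Num.sqrt (s + e))).
    by apply: is_derive1_sqrt; rewrite -/w; lra.
  by rewrite -[(2 * w)^-1]add0r -[(2 * w)^-1]mulr1; apply: is_deriveD.
have qn : q != 0 by rewrite gt_eqF.
have d3 := is_deriveZ (- k) (@is_deriveV R (fun s => Num.sqrt (1 + Num.sqrt (s + e))) s _ 1 qn d2).
apply: (is_derive_eq d3); rewrite /GRing.scale/= -/w -/q; field.
by rewrite qn gt_eqF.
Qed.

Lemma Gprim_cvg (k e : R) : 0 <= k -> 0 < e -> Gprim k e s @[s --> +oo] --> 0.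
Proof.
move=> k0 e0; apply/cvgrPdist_le => d d0; near=> s.
have s0 : 0 <= s by near: s; exact: nbhs_pinfty_ge.
have hs : (k / d) ^+ 4 <= s by near: s; apply: nbhs_pinfty_ge; exact: num_real.
have kd : 0 <= k / d by rewrite divr_ge0// ltW.
set w := Num.sqrt (s + e).
have hw : (k / d) ^+ 2 <= w.
  rewrite -[leLHS]ger0_norm ?exprn_ge0// -sqrtr_sqr -exprM; apply: ler_wsqrtr; lra.
have hq : k / d <= Num.sqrt (1 + w).
  rewrite -[leLHS]ger0_norm// -sqrtr_sqr; apply: ler_wsqrtr; lra.
have q0 : 0 < Num.sqrt (1 + w) by rewrite sqrtr_gt0 ltr_pwDl// sqrtr_ge0.
rewrite sub0r normrN /Gprim -/w mulNr normrN ger0_norm ?divr_ge0 ?sqrtr_ge0//.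
by rewrite ler_pdivrMr// mulrC -ler_pdivrMr.
Unshelve. all: by end_near. Qed.

Theorem trace_AofB_le (B : 'M[R]_3) (sg : R) : posdef B -> \det B = 1 -> 1 <= sg ->
  sg ^+ 2 <= \tr B -> \tr (Aof B *m B) <= 24 / Num.sqrt sg.
Proof.
move=> pB dB sg1 hsg; have [c c0 gB] := posdef_exists_geI pB.
have sg0 : 0 < sg by lra.
have [e20 e2h] := posdef_e2 pB.
have e2g : sg <= e2 B.
  rewrite -(@ler_pXn2r _ 2)// ?nnegrE ?(ltW sg0) ?(ltW e20)//.
  by apply: le_trans e2h; rewrite dB mulr1; have := sqr_ge0 sg; lra.
have [nf ->] := trace_Aof_mul B c0 gB.
have e0 : 0 < sg^-1 by rewrite invr_gt0.
have t0 : 0 < Num.sqrt sg by rewrite sqrtr_gt0.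
pose k := 24 / Num.sqrt sg.
have k0 : 0 < k by rewrite divr_gt0.
pose w (s : R) := Num.sqrt (s + sg^-1); pose q s := Num.sqrt (1 + w s).
pose g s := k / (4 * w s * q s ^+ 3).
have w0 s : 0 <= s -> 0 < w s by move=> s0; rewrite sqrtr_gt0; lra.
have q0 s : 0 <= s -> 0 < q s by move=> s0; rewrite sqrtr_gt0; have := w0 s s0; lra.
have g0 s : 0 <= s -> 0 <= g s.
  move=> s0; rewrite /g divr_ge0 ?(ltW k0)// mulr_ge0 ?exprn_ge0 ?(ltW (q0 s s0))//.
  by rewrite mulr_ge0// (ltW (w0 s s0)).
have cg : halfline_cont g.
  move=> s s0; have cw : w x @[x --> s] --> w s.
    apply: (@continuous_comp _ _ _ (fun s => s + sg^-1) Num.sqrt); last exact: sqrt_continuous.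
    by apply: cvgD; [exact: cvg_id|exact: cvg_cst].
  have cq : q x @[x --> s] --> q s.
    apply: (@continuous_comp _ _ _ (fun s => 1 + w s) Num.sqrt); last exact: sqrt_continuous.
    by apply: cvgD; [exact: cvg_cst|exact: cw].
  apply: cvgM; first exact: cvg_cst.
  apply: cvgV; first by rewrite !mulf_neq0 ?expf_neq0// gt_eqF ?w0 ?q0.
  apply: cvgM; first by apply: cvgM; [exact: cvg_cst|exact: cw].
  by apply: (@continuous_comp _ _ _ q (fun y : R => y ^+ 3)); [exact: cq|exact: exprn_continuous].
have dg (s : R) : 0 <= s -> is_derive s (1 : R) (Gprim k sg^-1) (g s).
  by move=> s0; exact: is_derive_Gprim.
have [ig Ig] := is_derive_ge0_Int g0 cg dg (Gprim_cvg (ltW k0) e0).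
apply: (@le_trans _ _ (Int g)); last first.
  rewrite Ig sub0r /Gprim add0r mulNr opprK ler_piMr// ?(ltW k0)//.
  rewrite invf_le1; last by rewrite sqrtr_gt0 ltr_pwDl// sqrtr_ge0.
  rewrite -[X in X <= _]sqrtr1; apply: ler_wsqrtr; have := sqrtr_ge0 (sg^-1); lra.
apply: le_Rintegral => //; first exact: nice_integrable.
move=> s /=; rewrite in_itv/= andbT => s0.
have gP := geI_addsc s0 gB; have pP := geI_posdef c0 gP.
have [-> _] := invmx_ray pP.
set r := rdet _; have r0 : 0 < r by exact: rdet_gt0.
have hT : \tr (1%:M - s *: invmx (B + s%:M)) <= 3.
  rewrite linearB/= mxtrace1 linearZ/= lerBlDr lerDl mulr_ge0//.
  have pM := posdef_inv pP; rewrite mxtrace3 !addr_ge0// ltW// posdef_diag//.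
apply: (@le_trans _ _ (2^-1 * (3 * r))).
  by rewrite ler_wpM2l ?invr_ge0// ler_pM2r.
have hD : s ^+ 3 + sg ^+ 2 * s ^+ 2 + sg * s + 1 <= \det (B + s%:M).
  rewrite det_add_scalar dB lerD2r lerD//; last exact: ler_wpM2r.
  by rewrite lerD2l ler_wpM2r// sqr_ge0.
have w2 : w s ^+ 2 = s + sg^-1 by rewrite sqr_sqrtr//; lra.
have q2 : q s ^+ 2 = 1 + w s by rewrite sqr_sqrtr//; have := w0 s s0; lra.
have key := cubic_lower sg1 s0 (w0 s s0) w2 hD.
have hr : r <= 4 / (Num.sqrt sg * w s * q s ^+ 3).
  have den0 : 0 < Num.sqrt sg * w s * q s ^+ 3.
    by rewrite mulr_gt0 ?exprn_gt0 ?q0// mulr_gt0// w0.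
  rewrite ler_pdivlMr// /r /rdet mulrC ler_pdivrMr ?sqrtr_gt0 ?posdef_det//.
  rewrite -(@ler_pXn2r _ 2)// ?nnegrE ?(ltW den0) ?mulr_ge0 ?sqrtr_ge0//.
  have E : (Num.sqrt sg * w s * q s ^+ 3) ^+ 2 = sg * w s ^+ 2 * (1 + w s) ^+ 3.
    rewrite (_ : _ ^+ 2 = Num.sqrt sg ^+ 2 * w s ^+ 2 * (q s ^+ 2) ^+ 3); last by ring.
    by rewrite q2 sqr_sqrtr// ltW.
  rewrite E; apply: le_trans key _.
  rewrite [leRHS](_ : _ = 16 * Num.sqrt (\det (B + s%:M)) ^+ 2); last by ring.
  by rewrite sqr_sqrtr// ltW// posdef_det.
apply: (@le_trans _ _ (2^-1 * (3 * (4 / (Num.sqrt sg * w s * q s ^+ 3))))).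
  by rewrite ler_wpM2l ?invr_ge0// ler_wpM2l.
rewrite /g /k le_eqVlt; apply/orP; left; apply/eqP; field.
by rewrite !gt_eqF ?w0 ?q0.
Qed.

End TraceBound.

(** * The inverse tensor D(B) *)

Section InverseClosure.
Variable R : realType.
Implicit Types (M N P B X H U : 'M[R]_3).

Lemma sym_mxB X H : sym_mx X -> sym_mx H -> sym_mx (X - H).
Proof. by move=> sX sH; rewrite /sym_mx linearB/= sX sH. Qed.

(* [C(B)] annihilates antisymmetric matrices; adding [H - H^T] makes it
   invertible on all of ['M_3]. *)
Definition Cext B H : 'M[R]_3 := tcontr (Cof B) H + (H - H^T).

Fact Cext_linear B : linear (Cext B).
Proof.
move=> a X Y; rewrite /Cext tcontrD tcontrZ.
move: (tcontr _ X) (tcontr _ Y) => C1 C2.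
by apply/matrixP => i j; rewrite !mxE; ring.
Qed.

HB.instance Definition _ B := GRing.isLinear.Build R 'M[R]_3 'M[R]_3 _ (Cext B) (Cext_linear B).

Definition Csolve B N : 'M[R]_3 := vec_mx (mxvec N *m invmx (lin_mx (Cext B))).

Lemma Csolve_linear B (a : R) X Y : Csolve B (a *: X + Y) = a *: Csolve B X + Csolve B Y.
Proof. by rewrite /Csolve linearP mulmxDl -scalemxAl linearP. Qed.

Lemma tcontr_Cof_sym B H : posdef B -> sym_mx (tcontr (Cof B) H).
Proof.
move=> /posdef_exists_geI[c c0 gB]; have [sB _] := gB; apply/matrixP => i j; rewrite !mxE.
apply: eq_bigr => k _; apply: eq_bigr => l _; congr (_ * _).
rewrite !(CofE _ _ _ _ c0 gB); apply: eq_Int => s s0; rewrite /Cint.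
have [sP _] := geI_addsc s0 gB; have sM := sym_inv sP.
have -> : invmx (B + s%:M) j i = invmx (B + s%:M) i j by rewrite -[in LHS]sM mxE.
by congr (_ * (_ * _)); congr (_ + _); rewrite addrC mulrC; congr (_ + _); rewrite mulrC.
Qed.

Lemma sym_norm_le_of_Cof B : posdef B -> forall H, sym_mx H ->
  `|H| * Int (fun s : R => 1 / (1 + s) ^+ 4) <= 9 * (486 * (`|B| + 1) ^+ 4) * `|tcontr (Cof B) H|.
Proof.
move=> pB H sH; have h := Cof_coercive pB sH; have [_ I0] := @Int_inv4 R.
set I := Int _ in h I0 *.
have k0 : 0 <= 486 * (`|B| + 1) ^+ 4.
  by apply: mulr_ge0; [exact: ler0n|rewrite exprn_ge0// addr_ge0].
have [h0|hn] := eqVneq `|H| 0.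
  by rewrite h0 mul0r; apply: mulr_ge0; [apply: mulr_ge0; [exact: ler0n|exact: k0]|exact: normr_ge0].
have hp : 0 < `|H| by rewrite lt_neqAle eq_sym hn normr_ge0.
have ht : \tr (tcontr (Cof B) H *m H) <= 9 * `|tcontr (Cof B) H| * `|H|.
  apply: le_trans (ler_norm _) _; apply: le_trans (norm_tr _) _.
  have := norm_mulmx (tcontr (Cof B) H) H; lra.
rewrite -(ler_pM2l hp); apply: (@le_trans _ _ (`|H| ^+ 2 * I)); first by rewrite expr2 mulrA.
apply: le_trans h _.
apply: le_trans (ler_wpM2l k0 ht) _; rewrite le_eqVlt; apply/orP; left; apply/eqP; ring.
Qed.

Lemma Cof_inj B H : posdef B -> sym_mx H -> tcontr (Cof B) H = 0 -> H = 0.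
Proof.
move=> pB sH CH; have := sym_norm_le_of_Cof pB sH; have [_ I0] := @Int_inv4 R.
rewrite CH normr0 mulr0 pmulr_lle0// normr_le0 => /eqP; exact.
Qed.

Lemma Cext_sym B N X : posdef B -> sym_mx N -> Cext B X = N ->
  sym_mx X /\ tcontr (Cof B) X = N.
Proof.
move=> pB sN E; have sC := tcontr_Cof_sym X pB.
have sX : X^T = X.
  have E' : (Cext B X)^T = Cext B X by rewrite E.
  move: E'; rewrite /Cext linearD/= linearB/= trmxK sC => /addrI E'.
  apply/matrixP => i j; have := congr1 (fun M : 'M[R]_3 => M i j) E'; rewrite !mxE; lra.
split => //; by move: E; rewrite /Cext sX subrr addr0.
Qed.

Lemma Cext_unit B : posdef B -> lin_mx (Cext B) \in unitmx.
Proof.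
move=> pB; rewrite -row_free_unit -kermx_eq0; apply/eqP/row_matrixP => i.
rewrite row0; have : (row i (kermx (lin_mx (Cext B))) <= kermx (lin_mx (Cext B)))%MS by exact: row_sub.
set u := row i _ => /sub_kermxP; rewrite -[u]vec_mxK mul_vec_lin => /eqP.
rewrite -[0](linear0 mxvec) (can_eq mxvecK) => /eqP h.
have s0 : sym_mx (0 : 'M[R]_3) by rewrite /sym_mx trmx0.
have [sX CX] := Cext_sym pB s0 h.
by rewrite (Cof_inj pB sX CX).
Qed.

Lemma CsolveP B N : posdef B -> sym_mx N ->
  sym_mx (Csolve B N) /\ tcontr (Cof B) (Csolve B N) = N.
Proof.
move=> pB sN; apply: Cext_sym => //.
apply: (can_inj mxvecK); rewrite -mul_vec_lin /Csolve vec_mxK -mulmxA mulVmx ?mulmx1//.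
exact: Cext_unit.
Qed.

Lemma Csolve_unique B H : posdef B -> sym_mx H -> Csolve B (tcontr (Cof B) H) = H.
Proof.
move=> pB sH; have [sX CX] := CsolveP pB (tcontr_Cof_sym H pB).
apply/eqP; rewrite -subr_eq0; apply/eqP; apply: (Cof_inj pB).
  exact: sym_mxB.
by rewrite -[- H]scaleN1r tcontrD tcontrZ CX scaleN1r subrr.
Qed.

Definition symE k l : 'M[R]_3 := 2^-1 *: (delta_mx k l + delta_mx l k).

Definition Dtensor B : tensor4 R := fun i j k l => Csolve B (symE k l) i j.

Lemma symE_sym k l : sym_mx (symE k l).
Proof. by rewrite /sym_mx /symE linearZ/= linearD/= !trmx_delta addrC. Qed.

Lemma Csolve_sum B (I : finType) (F : I -> 'M[R]_3) : 
  Csolve B (\sum_i F i) = \sum_i Csolve B (F i).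
Proof.
apply: (big_morph (Csolve B)) => [X Y|].
  by rewrite -[X in Csolve B (X + _)]scale1r Csolve_linear scale1r.
by rewrite /Csolve linear0 mul0mx linear0.
Qed.

Lemma CsolveZ B (a : R) N : Csolve B (a *: N) = a *: Csolve B N.
Proof.
have c0 : Csolve B 0 = 0 by rewrite /Csolve linear0 mul0mx linear0.
by have := Csolve_linear B a N 0; rewrite c0 !addr0.
Qed.

Lemma tcontr_Dtensor B N : sym_mx N -> tcontr (Dtensor B) N = Csolve B N.
Proof.
move=> sN.
have E : N = \sum_k \sum_l N k l *: symE k l.
  apply/matrixP => i j; rewrite summxE.
  have e k l : (N k l *: symE k l) i j = 2^-1 * N k l * ((k == i) && (l == j))%:R
      + 2^-1 * N k l * ((l == i) && (k == j))%:R.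
    by rewrite !mxE !(eq_sym i) !(eq_sym j); ring.
  under eq_bigr => k _ do (rewrite summxE; under eq_bigr => l _ do rewrite e).
  have [h1 h2 h3] := sym_swap sN.
  by rewrite !sum3 {e}; elim/ord3_ind: i; elim/ord3_ind: j; rewrite /= ?h1 ?h2 ?h3; field.
rewrite [in RHS]E Csolve_sum; apply/matrixP => i j; rewrite mxE summxE.
apply: eq_bigr => k _; rewrite Csolve_sum summxE; apply: eq_bigr => l _.
by rewrite CsolveZ mxE mulrC.
Qed.

Theorem is_Dof_Dtensor B : posdef B -> is_Dof B (Dtensor B).
Proof.
move=> pB; split.
  move=> i j k l; rewrite /Dtensor; have [sX _] := CsolveP pB (symE_sym k l).
  by rewrite -[in RHS]sX [RHS]mxE.
split; first by move=> i j k l; rewrite /Dtensor /symE addrC.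
move=> M sM; have [sX CX] := CsolveP pB sM; rewrite tcontr_Dtensor//; split => //.
by rewrite tcontr_Dtensor ?Csolve_unique//; exact: tcontr_Cof_sym.
Qed.

Theorem Csolve_Aof B : posdef B -> Csolve B (Aof B) = (2 / 3) *: B.
Proof.
move=> pB; have [sB _] := pB.
have -> : Aof B = (2 / 3) *: tcontr (Cof B) B.
  rewrite Cof_self// scalerA (_ : 2 / 3 * (3 / 2) = 1 :> R) ?scale1r//; by field.
by rewrite CsolveZ Csolve_unique.
Qed.

Lemma Csolve_bound (beta : R) : 0 <= beta -> exists2 k : R, 0 <= k &
  forall B, posdef B -> `|B| <= beta -> forall H, sym_mx H -> `|H| <= k * `|tcontr (Cof B) H|.
Proof.
move=> b0; have [_ I0] := @Int_inv4 R; set I := Int _ in I0.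
exists (9 * (486 * (beta + 1) ^+ 4) / I).
  apply: divr_ge0; last exact: ltW.
  by apply: mulr_ge0; [exact: ler0n|apply: mulr_ge0; [exact: ler0n|rewrite exprn_ge0// addr_ge0]].
move=> B pB hB H sH; have := sym_norm_le_of_Cof pB sH; rewrite -/I => h.
rewrite mulrAC ler_pdivlMr//; apply: le_trans h _.
rewrite ler_wpM2r// ler_wpM2l// ler_wpM2l ?ler0n// ler_pXn2r// ?nnegrE ?addr_ge0//.
by rewrite lerD2r.
Qed.

Lemma tcontr_bound T H (k : R) : (forall i j l m, `|T i j l m| <= k) ->
  `|tcontr T H| <= 9 * k * `|H|.
Proof.
move=> hT; have k0 : 0 <= k by apply: le_trans (hT i0 i0 i0 i0).
apply: mx_norm_le => [|i j]; first by rewrite !mulr_ge0.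
rewrite mxE; apply: le_trans (ler_norm_sum _ _ _) _.
have h l : `|\sum_(m < 3) T i j l m * H l m| <= 3 * (k * `|H|).
  apply: le_trans (ler_norm_sum _ _ _) _.
  have h m : `|T i j l m * H l m| <= k * `|H| by rewrite normrM ler_pM// mx_entry_le.
  by rewrite sum3; have := h i0; have := h i1; have := h i2; lra.
by rewrite sum3; have := h i0; have := h i1; have := h i2; lra.
Qed.

Lemma Cof_lip_unif c D : 0 < c -> 0 <= D -> exists2 K : R, 0 <= K &
  forall P N, geI c P -> geI c N -> `|N - P| <= D -> forall i j k l,
  `|Cof P i j k l| <= K /\ `|Cof N i j k l - Cof P i j k l| <= K * `|N - P|.
Proof.
move=> c0 D0.
have /choice [K hK] : forall x : 'I_3 * 'I_3 * 'I_3 * 'I_3, exists K : R, 0 <= K /\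
  forall P N, geI c P -> geI c N -> `|N - P| <= D ->
  `|Cof P x.1.1.1 x.1.1.2 x.1.2 x.2| <= K /\
  `|Cof N x.1.1.1 x.1.1.2 x.1.2 x.2 - Cof P x.1.1.1 x.1.1.2 x.1.2 x.2| <= K * `|N - P|.
  move=> [[[i j] k] l]; have [K K0 hK] := Cof_lip i j k l c0 D0; by exists K.
exists (\sum_x K x); first by apply: sumr_ge0 => x _; case: (hK x).
move=> P N gP gN hD i j k l; set x := (i, j, k, l).
have Kx : K x <= \sum_x K x.
  by rewrite (bigD1 x)//= lerDl; apply: sumr_ge0 => y _; case: (hK y).
have [_ h] := hK x; have [h1 h2] := h P N gP gN hD; split; first exact: le_trans Kx.
by apply: le_trans h2 _; rewrite ler_wpM2r.
Qed.

Lemma tcontr_diff (T T' : tensor4 R) X H : tcontr T X = tcontr T' H ->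
  tcontr T (H - X) = - tcontr (fun i j l m => T' i j l m - T i j l m) H.
Proof.
move=> E; rewrite -[- X]scaleN1r tcontrD tcontrZ E scaleN1r.
apply/matrixP => i j; rewrite !mxE -sumrB -sumrN; apply: eq_bigr => l _.
by rewrite -sumrB -sumrN; apply: eq_bigr => m _; ring.
Qed.

Lemma Csolve_lip c beta : 0 < c -> 0 <= beta -> exists2 K : R, 0 <= K &
  forall P N Y, geI c P -> geI c N -> `|P| <= beta -> `|N| <= beta -> sym_mx Y ->
  `|Csolve P Y| <= K * `|Y| /\ `|Csolve N Y - Csolve P Y| <= K * `|N - P| * `|Y|.
Proof.
move=> c0 b0; have [k k0 hk] := Csolve_bound b0.
have D0 : 0 <= 2 * beta by rewrite mulr_ge0.
have [K K0 hK] := Cof_lip_unif c0 D0.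
exists (k + k * (9 * K) * k); first by rewrite addr_ge0// !mulr_ge0.
move=> P N Y gP gN hP hN sY.
have pP := geI_posdef c0 gP; have pN := geI_posdef c0 gN.
have [sX CX] := CsolveP pP sY; have [sZ CZ] := CsolveP pN sY.
move: (Csolve P Y) (Csolve N Y) sX CX sZ CZ => X Z sX CX sZ CZ.
have bX : `|X| <= k * `|Y| by rewrite -CX; exact: hk.
have bZ : `|Z| <= k * `|Y| by rewrite -CZ; exact: hk.
have kk : 0 <= k * (9 * K) * k by rewrite !mulr_ge0.
split.
  by apply: le_trans bX _; rewrite ler_wpM2r// lerDl.
have hD : `|N - P| <= 2 * beta.
  by apply: le_trans (ler_normB _ _) _; rewrite [2 * beta]mulrDl mul1r lerD.
have sD := sym_mxB sZ sX.
have E := tcontr_diff (etrans CX (esym CZ)).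
apply: le_trans (hk P pP hP _ sD) _; rewrite E normrN.
have hC i j l m : `|Cof N i j l m - Cof P i j l m| <= K * `|N - P|.
  by have [] := hK P N gP gN hD i j l m.
apply: le_trans (ler_wpM2l k0 (tcontr_bound _ hC)) _.
apply: (@le_trans _ _ (k * (9 * (K * `|N - P|) * (k * `|Y|)))).
  by rewrite !ler_wpM2l// !mulr_ge0.
rewrite (_ : k * _ = k * (9 * K) * k * `|N - P| * `|Y|); last by ring.
by rewrite ler_wpM2r// ler_wpM2r// lerDr.
Qed.

End InverseClosure.

(** * Cutoff and vector field *)

Section Cutoff.
Variable R : realType.
Implicit Types (M N P B X H U : 'M[R]_3).

Definition lmin_set B : set R := [set c : R | forall v : 'cV[R]_3, c * sq v <= qf B v].
Definition lmin B : R := sup (lmin_set B).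

Lemma qf_ge B v : - (3 * `|B|) * sq v <= qf B v.
Proof.
have := qf_le (- B) v; rewrite normrN.
by have -> : qf (- B) v = - qf B v; [rewrite -scaleN1r qfZ mulN1r|lra].
Qed.

Lemma lmin_has_sup B : has_sup (lmin_set B).
Proof.
split; first by exists (- (3 * `|B|)) => v; exact: qf_ge.
exists (qf B (col3 1 0 0)) => c /(_ (col3 1 0 0)).
by rewrite sqE !col3E !expr2 !mulr0 mulr1 !addr0 mulr1.
Qed.

Lemma lmin_ub B c : (forall v, c * sq v <= qf B v) -> c <= lmin B.
Proof. by move=> h; apply: ub_le_sup => //; case: (lmin_has_sup B). Qed.

Lemma lmin_qf B v : lmin B * sq v <= qf B v.
Proof.
have [s0|s0] := eqVneq (sq v) 0.
  by rewrite (sq_eq0 s0) /sq /qf !mulmx0 !mxE mulr0.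
have sp : 0 < sq v by rewrite lt_neqAle eq_sym s0 sq_ge0.
rewrite -ler_pdivlMr//; apply: ge_sup; first by case: (lmin_has_sup B).
by move=> c /(_ v); rewrite ler_pdivlMr.
Qed.

Lemma lmin_lip B N : `|lmin N - lmin B| <= 3 * `|N - B|.
Proof.
have h X Y : lmin X <= lmin Y + 3 * `|Y - X|.
  rewrite -lerBlDr; apply: lmin_ub => v.
  have e : qf Y v = qf (Y - X) v + qf X v by rewrite -qfD subrK.
  by rewrite e; have := lmin_qf X v; have := qf_ge (Y - X) v; lra.
rewrite ler_norml; have := h N B; have := h B N; rewrite (distrC B N).
by move=> ? ?; apply/andP; split; lra.
Qed.

(* [c <= rho B] encodes both [B >= c I] and [1 + |B| <= 1 / c]. *)
Definition rho B : R := Num.min (lmin B) (1 + `|B|)^-1.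

Lemma min_lip (a b c d e : R) : `|a - b| <= e -> `|c - d| <= e ->
  `|Num.min a c - Num.min b d| <= e.
Proof.
rewrite !ler_norml => /andP[? ?] /andP[? ?].
by case: (leP a c) => ?; case: (leP b d) => ?; apply/andP; split; lra.
Qed.

Lemma rho_lip B N : `|rho N - rho B| <= 3 * `|N - B|.
Proof.
apply: min_lip; first exact: lmin_lip.
have a0 : 0 < 1 + `|N| by rewrite ltr_pwDl.
have b0 : 0 < 1 + `|B| by rewrite ltr_pwDl.
rewrite (_ : _ - _ = (`|B| - `|N|) * ((1 + `|N|)^-1 * (1 + `|B|)^-1)); last first.
  by field; rewrite !gt_eqF.
rewrite normrM; apply: (@le_trans _ _ (`|B - N| * 1)).
  rewrite ler_pM//; first exact: ler_dist_dist.
  rewrite ger0_norm ?mulr_ge0 ?invr_ge0 ?addr_ge0// mulr_ile1 ?invr_ge0 ?addr_ge0//.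
    by rewrite invf_le1// lerDl.
  by rewrite invf_le1// lerDl.
by rewrite mulr1 distrC; have := normr_ge0 (N - B); lra.
Qed.

Lemma rho_geI B c : 0 < c -> sym_mx B -> c <= rho B -> geI c B /\ `|B| <= c^-1.
Proof.
move=> c0 sB; rewrite le_min => /andP[h1 h2]; split.
  split => // v; apply: le_trans (lmin_qf B v); by rewrite ler_wpM2r// sq_ge0.
have b0 : 0 < 1 + `|B| by rewrite ltr_pwDl.
have : 1 + `|B| <= c^-1 by rewrite -[1 + _]invrK lef_pV2 ?posrE ?invr_gt0.
lra.
Qed.

Lemma rho_ge B (c : R) : geI c B -> c <= (1 + `|B|)^-1 -> c <= rho B.
Proof. by move=> [_ h] h2; rewrite le_min h2 andbT; exact: lmin_ub. Qed.

Definition chi (c : R) B : R := Num.max 0 (Num.min 1 (rho B / c - 1)).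

Lemma chi_ge0 c B : 0 <= chi c B.
Proof. by rewrite le_max lexx. Qed.

Lemma chi_le1 c B : chi c B <= 1.
Proof. by rewrite ge_max ler01 ge_min lexx. Qed.

Lemma chi_eq0 c B : 0 < c -> rho B < c -> chi c B = 0.
Proof.
move=> c0 h; apply/max_idPl; rewrite ge_min; apply/orP; right.
by rewrite subr_le0 ler_pdivrMr// mul1r ltW.
Qed.

Lemma chi_eq1 c B : 0 < c -> 2 * c <= rho B -> chi c B = 1.
Proof.
move=> c0 h; rewrite /chi (min_idPl _); first exact/max_idPr.
by rewrite lerBrDr -[1 + 1]/(2%:R) ler_pdivlMr.
Qed.

Lemma max0_lip (a b : R) : `|Num.max 0 a - Num.max 0 b| <= `|a - b|.
Proof.
rewrite ler_norml; have := ler_norm (a - b); have := ler_norm (b - a); rewrite (distrC b).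
by move=> ? ?; have := normr_ge0 (a - b); case: (leP 0 a) => ?; case: (leP 0 b) => ? ?;
  apply/andP; split; lra.
Qed.

Lemma chi_lip c B N : 0 < c -> `|chi c N - chi c B| <= 3 / c * `|N - B|.
Proof.
move=> c0; apply: le_trans (max0_lip _ _) _; apply: min_lip.
  by rewrite subrr normr0 mulr_ge0// divr_ge0// ltW.
rewrite (_ : _ - _ = (rho N - rho B) / c); last by ring.
rewrite normrM [`|c^-1|]ger0_norm ?invr_ge0 ?(ltW c0)// mulrAC ler_wpM2r ?invr_ge0 ?(ltW c0)//.
exact: rho_lip.
Qed.

Lemma chi_cont (c : R -> R) B : (forall t, 0 < c t) -> continuous c ->
  continuous (fun t => chi (c t) B).
Proof.
move=> c0 cc t; apply/cvgrPdist_le => e e0.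
have h : (fun t => rho B / c t) t @[t --> t] --> rho B / c t.
  by apply: cvgM; [exact: cvg_cst|apply: cvgV; [rewrite gt_eqF|exact: cc]].
have /cvgrPdist_le/(_ e e0) := h; apply: filterS => s hs.
apply: le_trans (max0_lip _ _) _; apply: min_lip; first by rewrite subrr normr0 ltW.
by rewrite opprB addrA subrK.
Qed.

Lemma cutoff_lip (S : 'M[R]_3 -> Prop) (f : 'M[R]_3 -> R) (F : 'M[R]_3 -> 'M[R]_3) (L L' K : R) :
  0 <= L -> 0 <= L' -> 0 <= K ->
  (forall B, ~ S B -> f B = 0) -> (forall B, `|f B| <= 1) ->
  (forall B N, `|f N - f B| <= L * `|N - B|) ->
  (forall B, S B -> `|F B| <= K) -> (forall B N, S B -> S N -> `|F N - F B| <= L' * `|N - B|) ->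
  forall B N, `|f N *: F N - f B *: F B| <= (L * K + L') * `|N - B|.
Proof.
move=> L0 L'0 K0 f0 f1 fL FK FL B N.
have e0 : 0 <= L' * `|N - B| by rewrite mulr_ge0.
have e1 : 0 <= L * K * `|N - B| by rewrite !mulr_ge0.
have half X Y : S X -> ~ S Y -> `|f X *: F X| <= L * K * `|X - Y|.
  move=> SX SY; rewrite normrZ; have := fL Y X; rewrite (f0 Y SY) subr0 => h.
  by rewrite mulrAC; apply: ler_pM => //; exact: FK.
have [SB|SB] := pselect (S B); have [SN|SN] := pselect (S N).
- rewrite (_ : _ - _ = (f N - f B) *: F N + f B *: (F N - F B)); last first.
    by rewrite scalerBl scalerBr addrA subrK.
  apply: le_trans (ler_normD _ _) _; rewrite !normrZ mulrDl lerD//.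
    by rewrite mulrAC; apply: ler_pM => //; exact: FK.
  apply: (@le_trans _ _ (1 * (L' * `|N - B|))); last by rewrite mul1r.
  by apply: ler_pM => //; exact: FL.
- rewrite (f0 N SN) scale0r sub0r normrN mulrDl; have := half B N SB SN; rewrite distrC; lra.
- rewrite (f0 B SB) scale0r subr0 mulrDl; have := half N B SN SB; lra.
- by rewrite (f0 B SB) (f0 N SN) !scale0r subrr normr0 mulrDl addr_ge0.
Qed.

End Cutoff.

Section VectorField.
Variable R : realType.
Implicit Types (M N P Q B E X H U : 'M[R]_3).

Definition linfield P Q E B : 'M[R]_3 :=
  - (2^-1 *: (B *m P + Q *m B)) - (2 * \tr E) *: B + 5 *: (B *m E + E *m B).

Definition Bfield P Q E B : 'M[R]_3 := linfield P Q E B - 2 *: Csolve B E.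

Lemma linfieldB P Q E B N : linfield P Q E N - linfield P Q E B = linfield P Q E (N - B).
Proof.
rewrite /linfield !mulmxBl !mulmxBr.
move: (N *m P) (Q *m N) (N *m E) (E *m N) (B *m P) (Q *m B) (B *m E) (E *m B) => a b c d a' b' c' d'.
by apply/matrixP => i j; rewrite !mxE; ring.
Qed.

Lemma linfield_le P Q E B (m : R) : `|P| <= m -> `|Q| <= m -> `|E| <= m ->
  `|linfield P Q E B| <= 40 * m * `|B|.
Proof.
move=> hP hQ hE.
have m0 : 0 <= m by exact: le_trans hP.
have n (X Y : 'M[R]_3) (a b : R) : `|X| <= a -> `|Y| <= b -> `|X *m Y| <= 3 * (a * b).
  move=> hX hY; apply: le_trans (norm_mulmx _ _) _; rewrite -mulrA ler_wpM2l//.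
  exact: ler_pM.
have b1 := n B P `|B| m (lexx _) hP; have b2 := n Q B m `|B| hQ (lexx _).
have b3 := n B E `|B| m (lexx _) hE; have b4 := n E B m `|B| hE (lexx _).
have ht : `|\tr E| <= 3 * m.
  by apply: le_trans (norm_tr _) _; rewrite ler_wpM2l.
have h1 : `|2^-1 *: (B *m P + Q *m B)| <= 3 * (m * `|B|).
  rewrite normrZ ger0_norm ?invr_ge0//.
  have := ler_normD (B *m P) (Q *m B); rewrite (mulrC `|B|) in b1; lra.
have h2 : `|(2 * \tr E) *: B| <= 6 * (m * `|B|).
  rewrite normrZ normrM ger0_norm// mulrA ler_wpM2r//; lra.
have h3 : `|5 *: (B *m E + E *m B)| <= 30 * (m * `|B|).
  rewrite normrZ ger0_norm//.
  have := ler_normD (B *m E) (E *m B); rewrite (mulrC `|B|) in b3; lra.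
rewrite /linfield; apply: le_trans (ler_normD _ _) _.
have := ler_normB (- (2^-1 *: (B *m P + Q *m B))) ((2 * \tr E) *: B); rewrite normrN.
have : 0 <= m * `|B| by rewrite mulr_ge0.
lra.
Qed.

Lemma Bfield_sym P Q E B : P^T = Q -> sym_mx E -> posdef B -> sym_mx (Bfield P Q E B).
Proof.
move=> PQ sE pB; have [sB _] := pB; have [sX _] := CsolveP pB sE.
rewrite /sym_mx /Bfield /linfield -PQ.
have e1 : (B *m P)^T = P^T *m B by rewrite trmx_mul sB.
have e2 : (P^T *m B)^T = B *m P by rewrite trmx_mul sB trmxK.
have e3 : (B *m E)^T = E *m B by rewrite trmx_mul sB sE.
have e4 : (E *m B)^T = B *m E by rewrite trmx_mul sB sE.
move: (B *m P) (P^T *m B) (B *m E) (E *m B) (Csolve B E) e1 e2 e3 e4 sX sB => a b c d x e1 e2 e3 e4 ex eB.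
have tr (X Y : 'M[R]_3) i j : X^T = Y -> X j i = Y i j by move=> <-; rewrite mxE.
apply/matrixP => i j; rewrite !mxE (tr _ _ i j e1) (tr _ _ i j e2) (tr _ _ i j e3) (tr _ _ i j e4).
by rewrite (tr _ _ i j ex) (tr _ _ i j eB); ring.
Qed.

Lemma BfieldB P Q E B N : Bfield P Q E N - Bfield P Q E B =
  linfield P Q E (N - B) - 2 *: (Csolve N E - Csolve B E).
Proof.
rewrite -linfieldB /Bfield.
move: (Csolve N E) (Csolve B E) (linfield P Q E N) (linfield P Q E B) => x y a b.
by apply/matrixP => i j; rewrite !mxE; ring.
Qed.

Lemma Bfield_lip c (m : R) : 0 < c -> 0 <= m -> exists2 K : R, 0 <= K &
  forall P Q E, `|P| <= m -> `|Q| <= m -> `|E| <= m -> sym_mx E ->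
  forall B N, sym_mx B -> sym_mx N -> c <= rho B -> c <= rho N ->
  `|Bfield P Q E B| <= K /\ `|Bfield P Q E N - Bfield P Q E B| <= K * `|N - B|.
Proof.
move=> c0 m0; have ci : 0 <= c^-1 by rewrite invr_ge0 ltW.
have [K K0 hK] := Csolve_lip c0 ci.
exists (40 * m * c^-1 + 40 * m + 2 * K * m); first by rewrite !addr_ge0// !mulr_ge0.
move=> P Q E hP hQ hE sE B N sB sN rB rN.
have [gB bB] := rho_geI c0 sB rB; have [gN bN] := rho_geI c0 sN rN.
have [h1 h2] := hK B N E gB gN bB bN sE.
have Km : 0 <= K * m by rewrite mulr_ge0.
have mc : 0 <= m * c^-1 by rewrite mulr_ge0.
split.
- apply: le_trans (ler_normB _ _) _; rewrite normrZ ger0_norm//.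
  have hl := linfield_le B hP hQ hE.
  have : 40 * m * `|B| <= 40 * m * c^-1 by rewrite ler_wpM2l// mulr_ge0.
  have : K * `|E| <= K * m by rewrite ler_wpM2l.
  lra.
- rewrite BfieldB; apply: le_trans (ler_normB _ _) _; rewrite normrZ ger0_norm//.
  have hl := linfield_le (N - B) hP hQ hE.
  have : K * `|N - B| * `|E| <= K * `|N - B| * m by rewrite ler_wpM2l// mulr_ge0.
  have : 0 <= m * c^-1 * `|N - B| by rewrite mulr_ge0.
  lra.
Qed.

Definition symm B : 'M[R]_3 := 2^-1 *: (B + B^T).

Lemma symm_sym B : sym_mx (symm B).
Proof. by rewrite /sym_mx /symm linearZ/= linearD/= trmxK addrC. Qed.

Lemma symm_id B : sym_mx B -> symm B = B.
Proof. by move=> sB; apply/matrixP => i j; rewrite /symm sB !mxE; field. Qed.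

Lemma symm_lip B N : `|symm N - symm B| <= `|N - B|.
Proof.
have -> : symm N - symm B = 2^-1 *: ((N - B) + (N - B)^T).
  by apply/matrixP => i j; rewrite !mxE; ring.
rewrite normrZ ger0_norm ?invr_ge0//; have := ler_normD (N - B) (N - B)^T.
by rewrite norm_trmx; have := normr_ge0 (N - B); lra.
Qed.

Definition Gfield (c : R) P Q E B : 'M[R]_3 := chi c (symm B) *: Bfield P Q E (symm B).

Lemma Gfield_lip c (m : R) : 0 < c -> 0 <= m -> exists2 K : R, 0 <= K &
  forall d P Q E, c <= d -> `|P| <= m -> `|Q| <= m -> `|E| <= m -> sym_mx E ->
  forall B N, `|Gfield d P Q E N - Gfield d P Q E B| <= K * `|N - B|.
Proof.
move=> c0 m0; have [K K0 hK] := Bfield_lip c0 m0.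
exists (3 / c * K + K); first by rewrite addr_ge0// !mulr_ge0// invr_ge0 ltW.
move=> d P Q E cd hP hQ hE sE B N; have d0 : 0 < d by exact: lt_le_trans cd.
have c3 : 0 <= 3 / c by rewrite divr_ge0// ltW.
pose S X := c <= rho (symm X).
apply: (@cutoff_lip _ S (fun X => chi d (symm X)) (fun X => Bfield P Q E (symm X))) => //.
- move=> X /negP; rewrite -ltNge => h; apply: chi_eq0 => //; exact: lt_le_trans cd.
- by move=> X; rewrite ger0_norm ?chi_ge0// chi_le1.
- move=> X Y; apply: le_trans (chi_lip _ _ d0) _; apply: ler_pM => //.
  + by rewrite divr_ge0// ltW.
  + by rewrite ler_wpM2l// lef_pV2// posrE.
  + exact: symm_lip.
- by move=> X SX; have [] := hK P Q E hP hQ hE sE _ _ (symm_sym X) (symm_sym X) SX SX.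
- move=> X Y SX SY; have [_ h] := hK P Q E hP hQ hE sE _ _ (symm_sym X) (symm_sym Y) SX SY.
  by apply: le_trans h _; rewrite ler_wpM2l// symm_lip.
Qed.

End VectorField.

(** * The closure along a curve *)

Section MatrixContinuity.
Variable R : realType.

Lemma cvg_mulmx (X Y : R -> 'M[R]_3) t : {for t, continuous X} -> {for t, continuous Y} ->
  {for t, continuous (fun s => X s *m Y s)}.
Proof.
move=> cX cY; apply/continuous_at_mxP => i j.
have -> : (fun s => (X s *m Y s) i j) = (fun s => X s i i0 * Y s i0 j + X s i i1 * Y s i1 j + X s i i2 * Y s i2 j).
  by apply/funext => s; rewrite mxE sum3.
have eX a b := (continuous_at_mxP X t).1 cX a b.
have eY a b := (continuous_at_mxP Y t).1 cY a b.
by apply: cvgD; [apply: cvgD|]; apply: cvgM; [exact: eX|exact: eY|exact: eX|exact: eY|exact: eX|exact: eY].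
Qed.

Lemma cvg_mxtrace (X : R -> 'M[R]_3) t : {for t, continuous X} ->
  {for t, continuous (fun s => \tr (X s))}.
Proof.
move=> cX; have -> : (fun s => \tr (X s)) = (fun s => X s i0 i0 + X s i1 i1 + X s i2 i2).
  by apply/funext => s; rewrite mxtrace3.
have eX a b := (continuous_at_mxP X t).1 cX a b.
by apply: cvgD; [apply: cvgD|]; exact: eX.
Qed.

Lemma cvg_lincomb (D : 'I_3 -> 'I_3 -> 'M[R]_3) (X : R -> 'M[R]_3) t : {for t, continuous X} ->
  {for t, continuous (fun s => \sum_(k < 3) \sum_(l < 3) X s k l *: D k l)}.
Proof.
move=> cX; have eX a b := (continuous_at_mxP X t).1 cX a b.
have h k l : {for t, continuous (fun s => X s k l *: D k l)}.
  by apply: cvgZ; [exact: eX|exact: cvg_cst].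
have h3 (F : 'I_3 -> R -> 'M[R]_3) : (forall k, {for t, continuous (F k)}) ->
    {for t, continuous (fun s => \sum_(k < 3) F k s)}.
  move=> cF; have -> : (fun s => \sum_(k < 3) F k s) = (fun s => F i0 s + F i1 s + F i2 s).
    by apply/funext => s; rewrite sum3.
  by apply: cvgD; [apply: cvgD|]; exact: cF.
by apply: (h3) => k; apply: (h3) => l; exact: h.
Qed.

Lemma cvg_Csolve (B : 'M[R]_3) (X : R -> 'M[R]_3) t : {for t, continuous X} ->
  {for t, continuous (fun s => Csolve B (X s))}.
Proof.
move=> cX; have -> : (fun s => Csolve B (X s)) =
    (fun s => \sum_(k < 3) \sum_(l < 3) X s k l *: Csolve B (delta_mx k l)).
  apply/funext => s; rewrite {1}[X s]matrix_sum_delta Csolve_sum.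
  by apply: eq_bigr => k _; rewrite Csolve_sum; apply: eq_bigr => l _; rewrite CsolveZ.
exact: cvg_lincomb.
Qed.

Lemma continuous_max0_within (X : R -> 'M[R]_3) : {within `[0, +oo[, continuous X} ->
  continuous (fun t : R => X (Num.max t 0)).
Proof.
move=> cX t; apply/cvgrPdist_le => e e0.
have p0 : `[0, +oo[%classic (Num.max t 0) by rewrite /= in_itv/= andbT le_max lexx orbT.
have hc : X @ within (`[0%R : R, +oo[%classic) (nbhs (Num.max t 0)) --> X (Num.max t 0).
  by move/subspace_continuousP : cX; exact.
have h : nbhs (Num.max t 0) [set y | `[0%R : R, +oo[%classic y -> `|X (Num.max t 0) - X y| <= e].
  by move/cvgrPdist_le : hc => /(_ e e0).
have : \forall s \near t, `[0%R : R, +oo[%classic (Num.max s 0) ->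
    `|X (Num.max t 0) - X (Num.max s 0)| <= e by exact: (continuous_max0 h).
by apply: filterS => s; apply; rewrite /= in_itv/= andbT le_max lexx orbT.
Qed.

End MatrixContinuity.

Section CutoffSolution.
Variable R : realType.

Lemma cvg_Gfield (c : R -> R) (P Q E : R -> 'M[R]_3) B : (forall t, 0 < c t) -> continuous c ->
  continuous P -> continuous Q -> continuous E ->
  continuous (fun t => Gfield (c t) (P t) (Q t) (E t) B).
Proof.
move=> c0 cc cP cQ cE t; have cB : continuous (fun _ : R => symm B) by exact: cst_continuous.
apply: cvgZ; first exact: chi_cont.
apply: cvgB; last by apply: cvgZ; [exact: cvg_cst|apply: cvg_Csolve; exact: cE].
apply: cvgD.
  apply: cvgB.
    apply: cvgN; apply: cvgZ; first exact: cvg_cst.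
    by apply: cvgD; apply: cvg_mulmx; [exact: cB|exact: cP|exact: cQ|exact: cB].
  apply: cvgZ; last exact: cvg_cst.
  by apply: cvgM; [exact: cvg_cst|apply: cvg_mxtrace; exact: cE].
apply: cvgZ; first exact: cvg_cst.
by apply: cvgD; apply: cvg_mulmx; [exact: cB|exact: cE|exact: cE|exact: cB].
Qed.

Theorem exists_cutoff_solution (c : R -> R) (P Q E : R -> 'M[R]_3) (m : R) (B0 : 'M[R]_3) :
  (forall t, 0 < c t) -> continuous c -> (forall T, exists2 c0, 0 < c0 & forall t, t <= T -> c0 <= c t) ->
  continuous P -> continuous Q -> continuous E ->
  (forall t, `|P t| <= m) -> (forall t, `|Q t| <= m) -> (forall t, `|E t| <= m) ->
  (forall t, sym_mx (E t)) ->
  exists B : R -> 'M[R]_3, [/\ continuous B, B 0 = B0 & forall t : R, 0 < t ->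
    is_derive t (1 : R) B (Gfield (c t) (P t) (Q t) (E t) (B t))].
Proof.
move=> c0 cc cT cP cQ cE hP hQ hE sE.
apply: (@picard_lindelof _ _ _ (fun t B => Gfield (c t) (P t) (Q t) (E t) B)).
  move=> T; have [d d0 hd] := cT T.
  have m0 : 0 <= m by exact: le_trans (hP 0).
  have [K K0 hK] := Gfield_lip d0 m0; exists K => t X Y tT.
  exact: hK (hd _ tT) (hP _) (hQ _) (hE _) (sE _) _ _.
by move=> X; exact: cvg_Gfield.
Qed.

End CutoffSolution.

Section ClosureAlong.
Variable R : realType.

Lemma lmin_gt0_posdef (B : 'M[R]_3) : sym_mx B -> 0 < lmin B -> geI (lmin B) B /\ posdef B.
Proof.
move=> sB l0; have g : geI (lmin B) B by split => // v; exact: lmin_qf.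
by split => //; exact: geI_posdef g.
Qed.

Lemma posdef_lmin (B : 'M[R]_3) : posdef B -> 0 < lmin B.
Proof.
move=> /posdef_exists_geI[c c0 [_ h]]; apply: lt_le_trans c0 _; exact: lmin_ub.
Qed.

Lemma continuous_Aof (B : R -> 'M[R]_3) t : {for t, continuous B} ->
  (forall s, sym_mx (B s)) -> posdef (B t) -> {for t, continuous (fun s => Aof (B s))}.
Proof.
move=> cB sB pB; have l0 := posdef_lmin pB.
have c0 : 0 < lmin (B t) / 2 by rewrite divr_gt0.
apply/continuous_at_mxP => i j; apply/cvgrPdist_le => e e0.
have [K K0 hK] := Aof_lip i j c0 ler01.
have r0 : 0 < Num.min (Num.min 1 (lmin (B t) / 6)) (e / (K + 1)).
  by rewrite !lt_min ltr01 !divr_gt0// ltr_pwDr.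
have /cvgrPdist_le/(_ _ r0) := cB; apply: filterS => s.
rewrite !le_min => /andP[/andP[h1 h2] h3].
have gt : geI (lmin (B t) / 2) (B t).
  by split => // v; apply: le_trans (lmin_qf _ _); rewrite ler_wpM2r ?sq_ge0//; lra.
have gs : geI (lmin (B t) / 2) (B s).
  split => // v; apply: le_trans (lmin_qf _ _); rewrite ler_wpM2r ?sq_ge0//.
  by have := lmin_lip (B t) (B s); rewrite (distrC (B s)) ler_norml => /andP[]; lra.
apply: le_trans (hK _ _ gs gt h1) _; apply: le_trans (ler_wpM2l K0 h3) _.
have k1 : 0 < K + 1 by lra.
rewrite mulrCA ler_piMr ?(ltW e0)// ler_pdivrMr//; lra.
Qed.

Lemma is_derive_Aof (B : R -> 'M[R]_3) (t : R) dB : is_derive t (1 : R) B dB ->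
  (forall s, sym_mx (B s)) -> posdef (B t) ->
  is_derive t (1 : R) (fun s => Aof (B s)) (- tcontr (Cof (B t)) dB).
Proof.
move=> dBt sB pB; have l0 := posdef_lmin pB.
have c0 : 0 < lmin (B t) / 2 by rewrite divr_gt0.
apply/is_derive_mxP => i j.
have [K K0 hK] := Aof_frechet i j c0 ler01.
have [d1 d10 hB] := is_derive_mx_lipschitz dBt.
have gt : geI (lmin (B t) / 2) (B t).
  by split => // v; apply: le_trans (lmin_qf _ _); rewrite ler_wpM2r ?sq_ge0//; lra.
pose r := Num.min 1 (lmin (B t) / 6).
have r0 : 0 < r by rewrite lt_min ltr01 divr_gt0.
have k0 : 0 < `|dB| + 1 by rewrite ltr_pwDr.
have del0 : 0 < Num.min d1 (r / (`|dB| + 1)) by rewrite lt_min d10 divr_gt0.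
have -> : (- tcontr (Cof (B t)) dB) i j = - (tcontr (Cof (B t)) dB i j) by rewrite mxE.
apply: (@is_derive_along _ B t dB (fun X => Aof X i j) (fun H => - (tcontr (Cof (B t)) H i j))
   (fun k l => - Cof (B t) i j k l) K _ _ dBt del0).
  by move=> H; rewrite mxE -sumrN; apply: eq_bigr => k _; rewrite -sumrN; apply: eq_bigr => l _; rewrite mulNr.
move=> h; rewrite le_min => /andP[h1 h2].
have hr : `|B (t + h) - B t| <= r.
  by apply: le_trans (hB h h1) _; rewrite mulrC -ler_pdivlMr.
move: (hr); rewrite le_min => /andP[r1 r2].
have gs : geI (lmin (B t) / 2) (B (t + h)).
  split => // v; apply: le_trans (lmin_qf _ _); rewrite ler_wpM2r ?sq_ge0//.
  by have := lmin_lip (B t) (B (t + h)); rewrite ler_norml => /andP[]; lra.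
by have := hK _ _ gt gs r1; rewrite opprK.
Qed.

Section Static.
Variables (P Q E B : 'M[R]_3) (m : R).
Hypotheses (PQ : P^T = Q) (pE : posdef E) (pB : posdef B).

Let sE : sym_mx E. Proof. by case: pE. Qed.
Let sB : sym_mx B. Proof. by case: pB. Qed.

Lemma sym_W : sym_mx (B *m P + Q *m B).
Proof. by rewrite /sym_mx linearD/= !trmx_mul sB -PQ trmxK addrC. Qed.

Lemma sym_BE : sym_mx (B *m E + E *m B).
Proof. by rewrite /sym_mx linearD/= !trmx_mul sB sE addrC. Qed.

Lemma Cof_Bfield : tcontr (Cof B) (Bfield P Q E B) =
  - (2^-1 *: tcontr (Cof B) (B *m P + Q *m B)) - 2 *: E - (3 * \tr E) *: Aof B
  + 5 *: tcontr (Cof B) (B *m E + E *m B).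
Proof.
have [_ CX] := CsolveP pB sE.
have N H : tcontr (Cof B) (- H) = - tcontr (Cof B) H by rewrite -scaleN1r tcontrZ scaleN1r.
rewrite /Bfield /linfield; move: (B *m P + Q *m B) (B *m E + E *m B) => W U.
rewrite !(tcontrD, N, tcontrZ) CX Cof_self//.
move: (tcontr _ W) (tcontr _ U) (Aof B) => x y z.
by apply/matrixP => i j; rewrite !mxE; field.
Qed.

Lemma trace_Cof_Bfield : \tr P + \tr Q = 0 ->
  \tr (tcontr (Cof B) (Bfield P Q E B)) = 2 * \tr E * (rdet B - 1).
Proof.
move=> tPQ; have uB := posdef_unit pB.
have t1 : \tr (tcontr (Cof B) (B *m P + Q *m B)) = 0.
  rewrite trace_Cof//; last exact: sym_W.
  by rewrite mulmxDr mulKmx// linearD/= (mxtrace_mulC (invmx B)) mulmxK// tPQ mulr0.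
have t2 : \tr (tcontr (Cof B) (B *m E + E *m B)) = rdet B * \tr E.
  rewrite trace_Cof//; last exact: sym_BE.
  by rewrite mulmxDr mulKmx// linearD/= (mxtrace_mulC (invmx B)) mulmxK//; field.
have tr4 (x e a y : 'M[R]_3) (k : R) : \tr (- (2^-1 *: x) - 2 *: e - k *: a + 5 *: y) =
    - (2^-1 * \tr x) - 2 * \tr e - k * \tr a + 5 * \tr y.
  by rewrite !mxtrace3 !mxE; ring.
by rewrite Cof_Bfield tr4 t1 t2 trace_Aof//; ring.
Qed.

Lemma trace_Aof_Bfield : `|P| <= m -> `|Q| <= m -> `|E| <= m ->
  - (17 * m) * \tr (Aof B *m B) <= - 2^-1 * \tr (Aof B *m Bfield P Q E B).
Proof.
move=> hP hQ hE; have pAB := psd_AofB pB; have com := Aof_comm pB.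
have [sX CX] := CsolveP pB sE.
set y := \tr (Aof B *m B).
have y0 : 0 <= y.
  by have [p0 p1 p2 _] := psd_entries pAB; rewrite /y mxtrace3; lra.
have tW : \tr (Aof B *m (B *m P + Q *m B)) = \tr ((Aof B *m B) *m P) + \tr ((Aof B *m B) *m Q).
  rewrite mulmxDr linearD/= mulmxA; congr (_ + _).
  by rewrite mulmxA mxtrace_mulC mulmxA com.
have tE : \tr (Aof B *m (B *m E + E *m B)) = 2 * \tr ((Aof B *m B) *m E).
  rewrite mulmxDr linearD/= mulmxA [\tr (_ *m (E *m B))](_ : _ = \tr ((Aof B *m B) *m E)); first by ring.
  by rewrite mulmxA mxtrace_mulC mulmxA com.
have tX : \tr (Aof B *m Csolve B E) = 2 / 3 * \tr (E *m B).
  have -> : Aof B = (2 / 3) *: tcontr (Cof B) B.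
    by rewrite Cof_self// scalerA (_ : 2 / 3 * (3 / 2) = 1 :> R) ?scale1r//; field.
  rewrite -scalemxAl linearZ/= Cof_symmetric// CX; by [].
have EB0 := trace_mul_ge0 pE pB.
have trE0 : 0 <= \tr E.
  rewrite mxtrace3; have := posdef_diag i0 pE; have := posdef_diag i1 pE.
  by have := posdef_diag i2 pE; lra.
have bd X : `|X| <= m -> `|\tr ((Aof B *m B) *m X)| <= 3 * (m * y).
  move=> hX; apply: le_trans (psd_trace_mul_le X pAB) _; rewrite -mulrA ler_wpM2l//.
  by rewrite ler_wpM2r.
have bP := bd _ hP; have bQ := bd _ hQ; have bE := bd _ hE.
have ty : 0 <= \tr E * y by rewrite mulr_ge0.
rewrite /Bfield /linfield.
have tr4 (w b u x : 'M[R]_3) (k : R) : \tr (Aof B *m (- (2^-1 *: w) - k *: b + 5 *: u - 2 *: x)) =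
    - (2^-1 * \tr (Aof B *m w)) - k * \tr (Aof B *m b) + 5 * \tr (Aof B *m u) - 2 * \tr (Aof B *m x).
  rewrite !mulmxDr !mulmxN -!scalemxAr.
  move: (Aof B *m w) (Aof B *m b) (Aof B *m u) (Aof B *m x) => w' b' u' x'.
  by rewrite !mxtrace3 !mxE; ring.
rewrite tr4 tW tE tX -/y.
move: bP bQ bE; rewrite !ler_norml => /andP[p1 p2] /andP[q1 q2] /andP[e1 e2].
lra.
Qed.

End Static.

End ClosureAlong.

(** * A priori bounds *)

Section ProductDerivatives.
Variable R : realType.

Lemma is_derive_mulmx (X Y : R -> 'M[R]_3) (t : R) dX dY :
  is_derive t (1 : R) X dX -> is_derive t (1 : R) Y dY ->
  is_derive t (1 : R) (fun s => X s *m Y s) (dX *m Y t + X t *m dY).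
Proof.
move=> hX hY; apply/is_derive_mxP => i j.
have eX a b := (is_derive_mxP X t 1 dX).1 hX a b.
have eY a b := (is_derive_mxP Y t 1 dY).1 hY a b.
have -> : (fun s => (X s *m Y s) i j) = (fun s => X s i i0 * Y s i0 j + X s i i1 * Y s i1 j + X s i i2 * Y s i2 j).
  by apply/funext => s; rewrite mxE sum3.
have d k := is_deriveM (eX i k) (eY k j).
have h := is_deriveD (is_deriveD (d i0) (d i1)) (d i2).
by apply: (is_derive_eq h); rewrite [RHS]mxE !mxE !sum3 /GRing.scale/=; ring.
Qed.

Lemma is_derive_mxtrace (X : R -> 'M[R]_3) (t : R) dX :
  is_derive t (1 : R) X dX -> is_derive t (1 : R) (fun s => \tr (X s)) (\tr dX).
Proof.
move=> hX; have eX a b := (is_derive_mxP X t 1 dX).1 hX a b.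
have -> : (fun s => \tr (X s)) = (fun s => X s i0 i0 + X s i1 i1 + X s i2 i2).
  by apply/funext => s; rewrite mxtrace3.
rewrite mxtrace3; have := is_deriveD (is_deriveD (eX i0 i0) (eX i1 i1)) (eX i2 i2).
by [].
Qed.

Lemma is_derive_trmx (X : R -> 'M[R]_3) (t : R) dX :
  is_derive t (1 : R) X dX -> is_derive t (1 : R) (fun s => (X s)^T) dX^T.
Proof.
move=> hX; apply/is_derive_mxP => i j; rewrite mxE.
have -> : (fun s => (X s)^T i j) = (fun s => X s j i) by apply/funext => s; rewrite mxE.
exact: (is_derive_mxP X t 1 dX).1.
Qed.

End ProductDerivatives.

Section Lyapunov.
Variables (R : realType) (B P Q E : R -> 'M[R]_3) (x : R -> R) (m T : R).
Hypotheses (T0 : 0 <= T) (cB : continuous B) (sB : forall t, sym_mx (B t))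
  (PQ : forall t, (P t)^T = Q t) (tPQ : forall t, \tr (P t) + \tr (Q t) = 0)
  (pE : forall t, posdef (E t))
  (hP : forall t, `|P t| <= m) (hQ : forall t, `|Q t| <= m) (hE : forall t, `|E t| <= m)
  (x01 : forall t, 0 <= x t <= 1)
  (dB : forall t : R, 0 < t -> is_derive t (1 : R) B (x t *: Bfield (P t) (Q t) (E t) (B t)))
  (pB : forall t, 0 <= t <= T -> posdef (B t)).

Let V t := Bfield (P t) (Q t) (E t) (B t).

Lemma det_conserved : \det (B 0) = 1 -> \det (B T) = 1.
Proof.
move=> d0; pose z t := \tr (Aof (B t)).
have cz t : 0 <= t <= T -> {for t, continuous z}.
  by move=> ht; apply: cvg_mxtrace; apply: continuous_Aof => //; [exact: cB|exact: pB].
have dz (t : R) : 0 < t < T -> is_derive t (1 : R) z (- (x t * (2 * \tr (E t) * (z t - 1)))).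
  move=> /andP[t0 tT]; have pt : posdef (B t) by apply: pB; rewrite !ltW.
  have := is_derive_mxtrace (is_derive_Aof (dB t0) sB pt).
  by rewrite linearN/= tcontrZ linearZ/= trace_Cof_Bfield// -(trace_Aof pt).
have mono : - ((z 0 - 1) * (z 0 - 1)) <= - ((z T - 1) * (z T - 1)).
  apply: (@nondecreasing_of_derive _ (fun t => - ((z t - 1) * (z t - 1)))
     (fun t => 4 * (x t * \tr (E t)) * (z t - 1) ^+ 2) _ _ T0) => t ht.
  - have c1 : (fun t => z t - 1) s @[s --> t] --> z t - 1.
      by apply: cvgB; [exact: cz|exact: cvg_cst].
    by apply: cvgN; apply: cvgM.
  - have d1 : is_derive t (1 : R) (fun t => z t - 1) (- (x t * (2 * \tr (E t) * (z t - 1))) - 0).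
      by apply: is_deriveB; exact: dz.
    have h := is_deriveN (is_deriveM d1 d1).
    by apply: (is_derive_eq h); rewrite /GRing.scale/=; ring.
  - have [x0 _] := andP (x01 t).
    have e0 : 0 <= \tr (E t).
      rewrite mxtrace3; have := posdef_diag i0 (pE t); have := posdef_diag i1 (pE t).
      by have := posdef_diag i2 (pE t); lra.
    by apply: mulr_ge0; [rewrite !mulr_ge0|exact: sqr_ge0].
have pT : posdef (B T) by apply: pB; rewrite lexx andbT.
have p0 : posdef (B 0) by apply: pB; rewrite lexx.
have z0 : z 0 = 1 by rewrite /z trace_Aof// /rdet d0 sqrtr1 invr1.
have zT : z T = 1.
  move: mono; rewrite z0 subrr mul0r oppr0 oppr_ge0 -expr2 => h.
  have : (z T - 1) ^+ 2 = 0 by apply/eqP; rewrite eq_le h sqr_ge0.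
  by move/eqP; rewrite sqrf_eq0 subr_eq0 => /eqP.
have dT := posdef_det pT.
have : rdet (B T) = 1 by rewrite -trace_Aof.
rewrite /rdet => /eqP; rewrite invr_eq1 => /eqP h.
by rewrite -[LHS]sqr_sqrtr ?ltW// h expr1n.
Qed.

Lemma trace_AofB_decay :
  \tr (Aof (B 0) *m B 0) <= \tr (Aof (B T) *m B T) * expR (17 * m * T).
Proof.
pose y t := \tr (Aof (B t) *m B t).
have m0 : 0 <= m by exact: le_trans (hP 0).
have cy t : 0 <= t <= T -> {for t, continuous y}.
  move=> ht; apply: cvg_mxtrace; apply: cvg_mulmx; last exact: cB.
  by apply: continuous_Aof => //; [exact: cB|exact: pB].
have dy (t : R) : 0 < t < T -> is_derive t (1 : R) y (x t * (- 2^-1 * \tr (Aof (B t) *m V t))).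
  move=> /andP[t0 tT]; have pt : posdef (B t) by apply: pB; rewrite !ltW.
  have h := is_derive_mxtrace (is_derive_mulmx (is_derive_Aof (dB t0) sB pt) (dB t0)).
  apply: (is_derive_eq h); rewrite -/(V t) tcontrZ mulNmx -scalemxAl -scalemxAr.
  have sV : sym_mx (V t) by apply: Bfield_sym => //; case: (pE t).
  have e : \tr (tcontr (Cof (B t)) (V t) *m B t) = 3 / 2 * \tr (Aof (B t) *m V t).
    by rewrite Cof_symmetric// Cof_self// -scalemxAl mxtraceZ.
  by rewrite mxtraceD -scaleNr !mxtraceZ e; field.
have y0 t : 0 <= t <= T -> 0 <= y t.
  by move=> /pB/psd_AofB/psd_entries[p0 p1 p2 _]; rewrite /y mxtrace3; lra.
have e (t : R) := is_derive_scaled_expR 1 (17 * m) t.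
pose w t : R := 1 * expR (17 * m * t).
have cw (t : R) : {for t, continuous w} by exact: (is_derive_continuous (e t)).
suff : y 0 * w 0 <= y T * w T by rewrite /w mulr0 expR0 !mul1r mulr1.
apply: (@nondecreasing_of_derive _ (fun t => y t * w t)
  (fun t => y t *: (17 * m * w t) + w t *: (x t * (- 2^-1 * \tr (Aof (B t) *m V t))))) => // t ht.
- by apply: cvgM; [exact: cy|exact: cw].
- by apply: is_deriveM; exact: dy.
- have ht' : 0 <= t <= T by case/andP: ht => ? ?; rewrite !ltW.
  have := trace_Aof_Bfield (pE t) (pB ht') (hP t) (hQ t) (hE t).
  rewrite -/(V t) -/(y t) => h; have := y0 t ht'; have e0 := expR_gt0 (17 * m * t).
  move: (x01 t) => /andP[x0 x1] yt.
  have my : 0 <= 17 * m * y t by rewrite !mulr_ge0.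
  have h1 : - (17 * m * y t) <= x t * (- 2^-1 * \tr (Aof (B t) *m V t)).
    apply: (@le_trans _ _ (x t * (- (17 * m) * y t))); last by rewrite ler_wpM2l.
    rewrite mulNr mulrN lerN2 ler_piMl//.
  rewrite /GRing.scale/= /w mul1r.
  rewrite (_ : _ + _ = expR (17 * m * t) * (17 * m * y t + x t * (- 2^-1 * \tr (Aof (B t) *m V t)))); last by ring.
  by rewrite mulr_ge0 ?(ltW e0)//; lra.
Qed.

End Lyapunov.

Section APriori.
Variable R : realType.

Lemma psd_norm_le_trace (B : 'M[R]_3) : psd B -> `|B| <= \tr B.
Proof.
move=> pB; have [p0 p1 p2 [h1 h2 h3]] := psd_entries pB; have [sB _] := pB.
have [e1 e2 e3] := sym_swap sB; rewrite mxtrace3.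
apply: mx_norm_le => [|i j]; first by lra.
elim/ord3_ind: i; elim/ord3_ind: j; rewrite ?e1 ?e2 ?e3 ?(ger0_norm p0) ?(ger0_norm p1) ?(ger0_norm p2); lra.
Qed.

Lemma norm_adj (B : 'M[R]_3) : `|\adj B| <= 2 * `|B| ^+ 2.
Proof.
apply: mx_norm_le => [|i j]; first by rewrite mulr_ge0// exprn_ge0.
rewrite mxE /cofactor normrM normrX normrN1 expr1n mul1r.
rewrite (expand_det_row _ ord0) !big_ord_recl big_ord0 addr0 /cofactor !det_mx11 !mxE.
apply: le_trans (ler_normD _ _) _; rewrite !normrM !normrX !normrN1 !expr1n !mul1r.
have h a b c d : `|B a b| * `|B c d| <= `|B| ^+ 2 by rewrite expr2 ler_pM// mx_entry_le.
set p := _ * _; set q := _ * _.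
have hp : p <= `|B| ^+ 2 by exact: h.
have hq : q <= `|B| ^+ 2 by exact: h.
lra.
Qed.

Lemma trace_le_of_AofB (B : 'M[R]_3) (K : R) : posdef B -> \det B = 1 -> 0 < K ->
  24 <= K * \tr (Aof B *m B) -> \tr B <= 1 + K ^+ 4.
Proof.
move=> pB dB K0 hK; have K4 : 0 <= K ^+ 4 by rewrite exprn_ge0// ltW.
have [h|h] := leP (\tr B) 1; first by lra.
have t0 : 0 <= \tr B by lra.
pose sg := Num.sqrt (\tr B).
have sg2 : sg ^+ 2 = \tr B by rewrite sqr_sqrtr.
have sg1 : 1 <= sg by rewrite -[leLHS]sqrtr1; apply: ler_wsqrtr; exact: ltW.
have sg0 : 0 < Num.sqrt sg by rewrite sqrtr_gt0; lra.
have := trace_AofB_le pB dB sg1; rewrite sg2 => /(_ (lexx _)) hA.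
have hs : Num.sqrt sg <= K.
  have : 24 <= K * (24 / Num.sqrt sg) by apply: le_trans hK _; rewrite ler_pM2l.
  by rewrite mulrA ler_pdivlMr// mulrC ler_pM2r.
have : \tr B = Num.sqrt sg ^+ 4.
  rewrite -sg2 (_ : 4 = 2 * 2)%N// exprM sqr_sqrtr//; lra.
move=> ->; have : Num.sqrt sg ^+ 4 <= K ^+ 4 by rewrite ler_pXn2r// nnegrE ltW.
lra.
Qed.

Lemma rho_lower (B : 'M[R]_3) (b : R) : posdef B -> \det B = 1 -> \tr B <= b -> 0 <= b ->
  2 * (12 * (1 + b) ^+ 2)^-1 <= rho B.
Proof.
move=> pB dB tb b0; have hB : `|B| <= b by apply: le_trans tb; exact: psd_norm_le_trace (posdef_psd pB).
have uB := posdef_unit pB.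
have b1 : 1 <= 1 + b by lra.
have bb : 1 + b <= (1 + b) ^+ 2 by rewrite expr2 ler_peMr//; lra.
have b2 : 0 < (1 + b) ^+ 2 by rewrite exprn_gt0//; lra.
have -> : 2 * (12 * (1 + b) ^+ 2)^-1 = (3 * (2 * (1 + b) ^+ 2))^-1.
  by field; rewrite gt_eqF//; lra.
apply: rho_ge.
  apply: posdef_geI => //; first by rewrite mulr_gt0.
  rewrite /invmx uB dB invr1 scale1r; apply: le_trans (norm_adj _) _.
  have q0 : 0 <= 1 + b by lra.
  have hB1 : `|B| <= 1 + b by lra.
  by rewrite ler_wpM2l// ler_pXn2r ?nnegrE.
have n0 : 0 < 1 + `|B| by rewrite ltr_pwDl.
have n1 : 0 < 3 * (2 * (1 + b) ^+ 2) by apply: mulr_gt0 => //; exact: mulr_gt0.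
by rewrite lef_pV2 ?posrE//; lra.
Qed.

End APriori.

(** * Global existence *)

Section GlobalExistence.
Variable R : realType.

Lemma Gfield_sym (c : R) (P Q E X : 'M[R]_3) : 0 < c -> P^T = Q -> sym_mx E ->
  sym_mx (Gfield c P Q E X).
Proof.
move=> c0 PQ sE; rewrite /Gfield.
have [h|h] := leP c (rho (symm X)); last first.
  by rewrite chi_eq0// scale0r /sym_mx trmx0.
have [gX _] := rho_geI c0 (symm_sym X) h.
have sV := Bfield_sym PQ sE (geI_posdef c0 gX).
by rewrite /sym_mx linearZ/= sV.
Qed.

Lemma trace_AofB_gt0 (B : 'M[R]_3) : posdef B -> 0 < \tr (Aof B *m B).
Proof.
move=> pB; have l0 := posdef_lmin pB; have [sB _] := pB; have pA := Aof_posdef pB.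
set c := lmin B / 2; have c0 : 0 < c by rewrite divr_gt0.
have gB : geI (lmin B) B by split => // v; exact: lmin_qf.
have gc := geI_scalar (- c) gB.
have pc : posdef (B + (- c)%:M) by apply: geI_posdef gc; rewrite /c; lra.
have := trace_mul_ge0 pA pc; rewrite mulmxDr mul_mx_scalar mxtraceD mxtraceZ trace_Aof//.
by have := mulr_gt0 c0 (rdet_gt0 pB); lra.
Qed.

Lemma near_max0 (t : R) : 0 < t -> \near t, Num.max t 0 = t.
Proof. by move=> t0; near=> s; rewrite max_l// ltW//; near: s; exact: lt_nbhsr.
Unshelve. all: by end_near. Qed.

Definition growth (k m t : R) : R := k * expR (m * Num.max t 0).

Definition radius (k m t : R) : R := (12 * (1 + (1 + growth k m t ^+ 4)) ^+ 2)^-1.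

Section Radius.
Variables (k m : R).
Hypotheses (k0 : 0 < k) (m0 : 0 <= m).

Lemma growth_gt0 t : 0 < growth k m t.
Proof. by rewrite mulr_gt0// expR_gt0. Qed.

Lemma growth_le s t : s <= t -> growth k m s <= growth k m t.
Proof.
move=> st; rewrite /growth ler_pM2l// ler_expR ler_wpM2l//.
by rewrite ge_max !le_max st lexx orbT.
Qed.

Lemma radius_den_gt0 t : 0 < 1 + (1 + growth k m t ^+ 4).
Proof. by have : 0 < growth k m t ^+ 4; [rewrite exprn_gt0// growth_gt0|lra]. Qed.

Lemma radius_gt0 t : 0 < radius k m t.
Proof. by rewrite invr_gt0 mulr_gt0// exprn_gt0// radius_den_gt0. Qed.

Lemma radius_le s t : s <= t -> radius k m t <= radius k m s.
Proof.
move=> st; have d1 := radius_den_gt0 s; have d2 := radius_den_gt0 t.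
rewrite lef_pV2 ?posrE ?mulr_gt0 ?exprn_gt0// ler_wpM2l// ler_pXn2r ?nnegrE ?(ltW d1) ?(ltW d2)//.
rewrite !lerD2l ler_pXn2r ?nnegrE ?(ltW (growth_gt0 _))//; exact: growth_le.
Qed.

Lemma continuous_radius : continuous (radius k m).
Proof.
have cg : continuous (growth k m).
  move=> t; apply: cvgM; first exact: cvg_cst.
  apply: (@continuous_comp _ _ _ (fun t : R => m * Num.max t 0) expR); last exact: continuous_expR.
  by apply: cvgM; [exact: cvg_cst|exact: continuous_max0].
move=> t; have d := radius_den_gt0 t; apply: cvgV.
  by rewrite mulf_neq0// expf_neq0// gt_eqF.
apply: cvgM; first exact: cvg_cst.
apply: (@continuous_comp _ _ _ (fun t : R => 1 + (1 + growth k m t ^+ 4)) (fun y : R => y ^+ 2));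
  last exact: exprn_continuous.
apply: cvgD; first exact: cvg_cst; apply: cvgD; first exact: cvg_cst.
by apply: (@continuous_comp _ _ _ (growth k m) (fun y : R => y ^+ 4)); [exact: cg|exact: exprn_continuous].
Qed.

End Radius.

Section Solution.
Variables (P Q E : R -> 'M[R]_3) (m : R) (B0 : 'M[R]_3).
Hypotheses (cP : continuous P) (cQ : continuous Q) (cE : continuous E)
  (PQ : forall t, (P t)^T = Q t) (tPQ : forall t, \tr (P t) + \tr (Q t) = 0)
  (pE : forall t, posdef (E t))
  (hP : forall t, `|P t| <= m) (hQ : forall t, `|Q t| <= m) (hE : forall t, `|E t| <= m)
  (pB0 : posdef B0) (dB0 : \det B0 = 1).

Theorem exists_global_solution : exists B : R -> 'M[R]_3,
  [/\ continuous B, B 0 = B0, forall t, posdef (B t), forall t, 0 <= t -> \det (B t) = 1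
    & forall t : R, 0 < t -> is_derive t (1 : R) B (Bfield (P t) (Q t) (E t) (B t))].
Proof.
have m0 : 0 <= m by exact: le_trans (hP 0).
have m17 : 0 <= 17 * m by rewrite mulr_ge0.
pose y0 := \tr (Aof B0 *m B0); have y00 : 0 < y0 by exact: trace_AofB_gt0.
pose k := 24 / y0; have k0 : 0 < k by rewrite divr_gt0.
pose c := radius k (17 * m).
have c0 t : 0 < c t by exact: radius_gt0.
have cc : continuous c by exact: continuous_radius.
have sE t : sym_mx (E t) by case: (pE t).
have cT T : exists2 d, 0 < d & forall t, t <= T -> d <= c t.
  by exists (c T) => // t; exact: radius_le.
have [B1 [cB1 B10 dB1]] := exists_cutoff_solution B0 c0 cc cT cP cQ cE hP hQ hE sE.
pose B t := B1 (Num.max t 0).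
have cB : continuous B.
  by move=> t; apply: (@continuous_comp _ _ _ (fun t : R => Num.max t 0) B1); [exact: continuous_max0|exact: cB1].
have B00 : B 0 = B0 by rewrite /B max_l.
have dB (t : R) : 0 < t -> is_derive t (1 : R) B (Gfield (c t) (P t) (Q t) (E t) (B t)).
  move=> t0; have -> : B t = B1 t by rewrite /B max_l// ltW.
  apply: near_eq_is_derive (dB1 t t0).
  by have := near_max0 t0; apply: filterS => s hs; rewrite /B hs.
have sB1 t : 0 <= t -> sym_mx (B1 t).
  move=> t0; have cN s : {for s, continuous (fun s => B1 s - (B1 s)^T)}.
    have cBT : {for s, continuous (fun s => (B1 s)^T)}.
      apply/continuous_at_mxP => i j.
      have -> : (fun s => (B1 s)^T i j) = (fun s => B1 s j i) by apply/funext => ?; rewrite mxE.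
      exact: (continuous_at_mxP B1 s).1 (cB1 s) j i.
    by apply: cvgB; [exact: cB1|exact: cBT].
  have dN (s : R) : 0 < s -> is_derive s (1 : R) (fun s => B1 s - (B1 s)^T) 0.
    move=> s0; have h := is_deriveB (dB1 s s0) (is_derive_trmx (dB1 s s0)).
    by apply: (is_derive_eq h); rewrite (Gfield_sym _ (c0 s) (PQ s) (sE s)) subrr.
  have := @le_dist_of_derive_mx R 3 3 (fun s => B1 s - (B1 s)^T) (fun=> 0) (fun=> 0) (fun=> 0) 0 t t0.
  have [sB0 _] := pB0.
  rewrite B10 sB0 !subrr subr0 => h.
  have hle : `|B1 t - (B1 t)^T| <= 0.
    apply: h => s.
    - by move=> _; exact: cN.
    - by move=> _; exact: cvg_cst.
    - by move=> /andP[s0 _]; exact: dN.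
    - by rewrite normr0.
  by apply/esym/eqP; rewrite -subr_eq0 -normr_le0.
have sB t : sym_mx (B t) by apply: sB1; rewrite le_max lexx orbT.
pose x t := chi (c t) (B t).
have x01 t : 0 <= x t <= 1 by rewrite chi_ge0 chi_le1.
have {}dB (t : R) : 0 < t -> is_derive t (1 : R) B (x t *: Bfield (P t) (Q t) (E t) (B t)).
  by move=> /dB; rewrite /Gfield symm_id.
have key T : 0 <= T -> (forall s, 0 <= s <= T -> 0 < lmin (B s)) ->
    \det (B T) = 1 /\ 2 * c T <= rho (B T).
  move=> T0 hl; have pB s : 0 <= s <= T -> posdef (B s).
    by move=> hs; have [] := lmin_gt0_posdef (sB s) (hl s hs).
  have dT : \det (B T) = 1.
    by apply: (det_conserved T0 cB sB PQ tPQ pE x01 dB pB); rewrite B00.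
  have pT : posdef (B T) by apply: pB; rewrite T0 lexx.
  split => //.
  have := trace_AofB_decay T0 cB sB PQ pE hP hQ hE x01 dB pB; rewrite B00 -/y0 => hy.
  pose K := growth k (17 * m) T.
  have K0 : 0 < K by exact: growth_gt0.
  have hK : 24 <= K * \tr (Aof (B T) *m B T).
    rewrite /K /growth max_l// /k.
    rewrite [leRHS](_ : _ = 24 * (\tr (Aof (B T) *m B T) * expR (17 * m * T) / y0)); last by ring.
    by rewrite ler_peMr// ler_pdivlMr// mul1r.
  have tb := trace_le_of_AofB pT dT K0 hK.
  apply: rho_lower => //; by rewrite addr_ge0// exprn_ge0// ltW.
have cl t e : 0 < e -> exists2 d, 0 < d & forall s, `|t - s| < d -> `|lmin (B t) - lmin (B s)| <= e.
  move=> e0; have e3 : 0 < e / 3 by rewrite divr_gt0.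
  have /cvgrPdist_le/(_ _ e3)/nbhs_ballP[d /= d0 hd] := cB t.
  exists d => // s /hd /= hs; apply: le_trans (lmin_lip _ _) _; lra.
have allpos t : 0 <= t -> 0 < lmin (B t).
  move=> t0; rewrite ltNge; apply/negP => ht.
  pose S := [set s | 0 <= s /\ lmin (B s) <= 0].
  have hS : has_inf S by split; [exists t|exists 0 => s []].
  pose t1 := inf S.
  have t10 : 0 <= t1 by apply: lb_le_inf => [|s []//]; case: hS.
  have below s : 0 <= s < t1 -> 0 < lmin (B s).
    move=> /andP[s0 st]; rewrite ltNge; apply/negP => hs.
    have : t1 <= s by apply: ge_inf => //; case: hS.
    by rewrite leNgt st.
  have l1 : lmin (B t1) <= 0.
    rewrite leNgt; apply/negP => lp.
    have l2 : 0 < lmin (B t1) / 2 by rewrite divr_gt0.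
    have [d d0 hd] := cl t1 _ l2.
    have [s [s0 ls] sd] := inf_adherent d0 hS.
    have : t1 <= s by apply: ge_inf => //; case: hS.
    move=> ts; have : `|t1 - s| < d by rewrite ltr_norml; apply/andP; split; rewrite /t1 in ts *; lra.
    by move=> /hd; rewrite ler_norml => /andP[]; lra.
  have t1p : 0 < t1.
    rewrite lt_neqAle t10 andbT; apply/eqP => e.
    by move: l1; rewrite -e B00 leNgt posdef_lmin.
  have [d d0 hd] := cl t1 (c t1) (c0 t1).
  pose s := Num.max 0 (t1 - d / 2).
  have st : 0 <= s < t1.
    by rewrite le_max lexx /= gt_max t1p /=; lra.
  have [s0 s1] := andP st.
  have sd : `|t1 - s| < d.
    rewrite ger0_norm ?subr_ge0 ?(ltW s1)//.
    have : t1 - d / 2 <= s by rewrite le_max lexx orbT.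
    lra.
  have below' r : 0 <= r <= s -> 0 < lmin (B r).
    by move=> /andP[r0 rs]; apply: below; rewrite r0 (le_lt_trans rs).
  have [_ hr] := key s s0 below'.
  have cs : c t1 <= c s by apply: radius_le => //; exact: ltW.
  have : rho (B s) <= lmin (B s) by rewrite ge_min lexx.
  have := hd s sd; rewrite ler_norml => /andP[]; have := c0 t1; lra.
exists B; split => //.
- move=> t; have t0 : 0 <= Num.max t 0 by rewrite le_max lexx orbT.
  have -> : B t = B (Num.max t 0) by rewrite /B (max_l t0).
  by have [] := lmin_gt0_posdef (sB (Num.max t 0)) (allpos _ t0).
- by move=> t t0; have [] := key t t0 (fun s hs => allpos s (proj1 (andP hs))).
- move=> t t0; have [_ hr] := key t (ltW t0) (fun s hs => allpos s (proj1 (andP hs))).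
  by have := dB t t0; rewrite /x chi_eq1// scale1r.
Qed.

End Solution.
End GlobalExistence.

Unset Implicit Arguments.

Theorem theorem2 (R : realType) (lam : R)
  (Om Ga Dr : R -> 'M[R]_3) (B0 : 'M[R]_3) :
  (* Omega antisymmetric, Gamma sym_mx traceless, both continuous and bounded on [0,oo) *)
  (forall t, 0 <= t -> (Om t)^T = - Om t) ->
  (forall t, 0 <= t -> sym_mx (Ga t) /\ \tr (Ga t) = 0) ->
  {within `[0, +oo[, continuous Om} ->
  {within `[0, +oo[, continuous Ga} ->
  (exists M : R, forall t, 0 <= t -> `|Om t| <= M) ->
  (exists M : R, forall t, 0 <= t -> `|Ga t| <= M) ->
  (* D_r sym_mx positive definite, C^1, with D_r, dD_r/dt, D_r^{-1} bounded *)
  (forall t, 0 <= t -> posdef (Dr t)) ->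
  {within `[0, +oo[, continuous Dr} ->
  (forall t, 0 < t -> derivable Dr t 1) ->
  (forall t, 0 < t -> {for t, continuous (fun s => 'D_1 Dr s)}) ->
  (exists M : R, forall t, 0 <= t -> `|Dr t| <= M) ->
  (exists M : R, forall t, 0 < t -> `|'D_1 Dr t| <= M) ->
  (exists M : R, forall t, 0 <= t -> `|invmx (Dr t)| <= M) ->
  (* initial data *)
  posdef B0 -> \det B0 = 1 ->
  exists A B : R -> 'M[R]_3,
    A 0 = Aof B0 /\ B 0 = B0 /\
    {within `[0, +oo[, continuous A} /\
    {within `[0, +oo[, continuous B} /\
    (forall t, 0 < t ->
       let W := B t *m (Om t + lam *: Ga t) + (- Om t + lam *: Ga t) *m B t in
       let BD := B t *m Dr t + Dr t *m B t in
       is_derive t 1 A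
         (2^-1 *: tcontr (Cof (B t)) W + 2 *: Dr t
          + (3 * \tr (Dr t)) *: A t - 5 *: tcontr (Cof (B t)) BD) /\
       exists D, is_Dof (B t) D /\
       is_derive t 1 B
         (- (2^-1 *: W) - tcontr D (2 *: Dr t + (3 * \tr (Dr t)) *: A t)
          + 5 *: BD)) /\
    (forall t, 0 <= t ->
       posdef (B t) /\ \det (B t) = 1 /\ A t = Aof (B t) /\
       posdef (A t) /\ \tr (A t) = 1).
Proof.
move=> tOm hGa cOm cGa [mO hO] [mG hG] pDr cDr _ _ [mD hD] _ _ pB0 dB0.
have n0 t : 0 <= Num.max t 0 :> R by rewrite le_max lexx orbT.
pose P t := Om (Num.max t 0) + lam *: Ga (Num.max t 0).
pose Q t := - Om (Num.max t 0) + lam *: Ga (Num.max t 0).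
pose E t := Dr (Num.max t 0).
have cOm' := continuous_max0_within cOm; have cGa' := continuous_max0_within cGa.
have cE : continuous E := continuous_max0_within cDr.
have cP : continuous P.
  by move=> t; apply: cvgD; [exact: cOm'|apply: cvgZ; [exact: cvg_cst|exact: cGa']].
have cQ : continuous Q.
  by move=> t; apply: cvgD; [apply: cvgN; exact: cOm'|apply: cvgZ; [exact: cvg_cst|exact: cGa']].
have PQ t : (P t)^T = Q t.
  by rewrite /P /Q linearD/= linearZ/= tOm//; have [-> _] := hGa _ (n0 t).
have tPQ t : \tr (P t) + \tr (Q t) = 0.
  have [_ tG] := hGa _ (n0 t).
  by rewrite /P /Q !mxtraceD !mxtraceZ tG linearN/=; ring.
have pE t : posdef (E t) by exact: pDr.
pose m := mO + `|lam| * mG + mD.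
have mO0 : 0 <= mO by apply: le_trans (hO 0 (lexx 0)).
have mG0 : 0 <= mG by apply: le_trans (hG 0 (lexx 0)).
have mD0 : 0 <= mD by apply: le_trans (hD 0 (lexx 0)).
have lG t : `|lam *: Ga (Num.max t 0)| <= `|lam| * mG.
  by rewrite normrZ ler_wpM2l// hG.
have hP t : `|P t| <= m.
  by apply: le_trans (ler_normD _ _) _; have := lG t; have := hO _ (n0 t); rewrite /m; lra.
have hQ t : `|Q t| <= m.
  apply: le_trans (ler_normD _ _) _; rewrite normrN.
  by have := lG t; have := hO _ (n0 t); rewrite /m; lra.
have lm0 : 0 <= `|lam| * mG by rewrite mulr_ge0.
have hE t : `|E t| <= m by apply: le_trans (hD _ (n0 t)) _; rewrite /m; lra.
have [B [cB B00 pB dB DB]] := exists_global_solution cP cQ cE PQ tPQ pE hP hQ hE pB0 dB0.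
have sB t : sym_mx (B t) by case: (pB t).
exists (fun t => Aof (B t)), B; split; first by rewrite B00.
split; first by [].
split.
  by apply: continuous_subspaceT => t; apply: continuous_Aof => //; exact: cB.
split; first exact: continuous_subspaceT.
split; last first.
  move=> t t0; split => //; split; first exact: dB.
  split => //; split; first exact: Aof_posdef.
  by rewrite trace_Aof// /rdet dB// sqrtr1 invr1.
move=> t t0 W BD; have tE : Num.max t 0 = t by rewrite max_l// ltW.
have sE : sym_mx (Dr t) by case: (pDr t (ltW t0)).
have := DB t t0; have := PQ t; rewrite /P /Q /E tE => PQt dBt.
have dA := is_derive_Aof dBt sB (pB t).
split.
  apply: (is_derive_eq dA); rewrite (Cof_Bfield _ _ (pDr t (ltW t0)) (pB t)) -/W -/BD.
  move: (tcontr _ W) (tcontr _ BD) => w u.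
  by apply/matrixP => i j; rewrite !mxE; ring.
exists (Dtensor (B t)); split; first exact: is_Dof_Dtensor.
apply: (is_derive_eq dBt).
have sN : sym_mx (2 *: Dr t + (3 * \tr (Dr t)) *: Aof (B t)).
  by have [sA _] := Aof_posdef (pB t); rewrite /sym_mx linearD/= !linearZ/= sE sA.
rewrite tcontr_Dtensor// Csolve_linear CsolveZ Csolve_Aof// /Bfield /linfield -/W -/BD.
move: (Csolve _ _) W BD => v w u.
by apply/matrixP => i j; rewrite !mxE; field.
Qed.
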